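(* For almost all quadruples $(a,c,d,r)\in(0,\infty)^4$ (with respect to Lebesgue measure) the following property holds. For any $x_0\in\mathbb T$, any $T>0$ and any $(u_0,v_0),(u_T,v_T)\in H:=L^2(\mathbb T)\times L^2(\mathbb T)$ there exist control functions $f,g\in L^2_{\rm loc}(\mathbb R)$ such that the solution $(u,v)$ of $$\begin{cases}u_t+u_{xxx}+av_{xxx}=f(t)\delta_{x_0}&\text{in }\mathbb R\times\mathbb T,\\ cv_t+rv_x+v_{xxx}+du_{xxx}=g(t)\delta_{x_0}&\text{in }\mathbb R\times\mathbb T,\\ u(0)=u_0,\quad v(0)=v_0&\text{in }\mathbb T\end{cases}$$ satisfies the final conditions $u(T)=u_T$ and $v(T)=v_T$.
   Context: $\mathbb T=\mathbb R/2\pi\mathbb Z$ is the circle, and $\delta_{x_0}$ is the Dirac mass at $x_0\in\mathbb T$. Solutions of the controlled system are defined by transposition. For $(\varphi_0,\psi_0)\in H$ let $(\varphi,\psi)\in C(\mathbb R,H)$ be the solution (in the sense of distributions) of the homogeneous adjoint system $$\varphi_t+\varphi_{xxx}+\tfrac dc\psi_{xxx}=0,\qquad \psi_t+\tfrac rc\psi_x+a\varphi_{xxx}+\tfrac1c\psi_{xxx}=0,\qquad \varphi(0)=\varphi_0,\ \psi(0)=\psi_0$$ in $\mathbb R\times\mathbb T$. The traces $\varphi(\cdot,x_0),\psi(\cdot,x_0)\in L^2_{\rm loc}(\mathbb R)$ are defined by evaluating the Fourier series in $x$ at $x_0$: if $\varphi(t,x)=\sum_{k\in\mathbb Z}\hat\varphi_k(t)e^{ikx}$,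 then $\varphi(\cdot,x_0):=\sum_k\hat\varphi_k(\cdot)e^{ikx_0}$, with convergence in $L^2_{\rm loc}(\mathbb R)$; similarly for $\psi$. A solution of the controlled system is a function $(u,v):\mathbb R\to H$, continuous for the weak topology of $H$, such that $$\int_{\mathbb T}u(s)\varphi(s)+v(s)\psi(s)\,dx=\int_{\mathbb T}u_0\varphi_0+v_0\psi_0\,dx+\int_0^s f(t)\varphi(t,x_0)+\tfrac1c g(t)\psi(t,x_0)\,dt$$ for all $s\in\mathbb R$ and all $(\varphi_0,\psi_0)\in H$. (The factor $\frac1c$ comes from dividing the second equation by $c$.) For every $(u_0,v_0)\in H$ and $f,g\in L^2_{\rm loc}(\mathbb R)$ there is exactly one such solution. *)

(* Defs.v *)
From HB Require Import structures.
From mathcomp Require Import all_boot all_order all_algebra.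
From mathcomp Require Export complex.
From mathcomp Require Import all_classical all_reals all_analysis.

Set Implicit Arguments.
Unset Strict Implicit.
Unset Printing Implicit Defensive.

Import Order.TTheory GRing.Theory Num.Theory.
Import numFieldNormedType.Exports.

Local Open Scope classical_set_scope.
Local Open Scope ring_scope.
Local Open Scope complex_scope.

Section SquareIntegrable.
Variable R : realType.
Implicit Types (D : set R) (f g : R -> R[i]).

Local Notation lambda := (@lebesgue_measure R).

Definition cmeasurable D f : Prop :=
  measurable_fun D (fun x => complex.Re (f x)) /\ measurable_fun D (fun x => complex.Im (f x)).

Definition sqnorm D f : \bar R :=
  (\int[lambda]_(x in D) (ComplexField.Normc.normc (f x) ^+ 2)%:E)%E.

Definition square_integrable D f : Prop :=
  cmeasurable D f /\ (sqnorm D f < +oo)%E.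

Definition cintegral D f : R[i] :=
  (\int[lambda]_(x in D) complex.Re (f x)) +i* (\int[lambda]_(x in D) complex.Im (f x)).

(* \int_0^s f for s of either sign *)
Definition cintegral_from0 (s : R) f : R[i] :=
  if 0 <= s then cintegral `[0, s] f else - cintegral `[s, 0] f.

Definition L2loc f : Prop :=
  forall K : set R, compact K -> square_integrable K f.

Definition cvg_L2loc (F : nat -> R -> R[i]) f : Prop :=
  forall K : set R, compact K ->
    sqnorm K (fun t => F N t - f t) @[N --> \oo] --> 0%E.

(* The circle R / 2 pi Z with its Lebesgue measure is represented by the
   fundamental domain [0, 2 pi[: only the restriction to [0, 2 pi[ of a
   function "on the circle" matters, and a point of the circle is given by any
   of its real representatives. *)
Definition circle : set R := [set` `[0, 2 * pi[].

Definition L2T f : Prop := square_integrable circle f.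

Definition eqL2T f g : Prop :=
  (f = g %[ae lambda in circle])%E.

(* bilinear, without complex conjugation *)
Definition pairing f g : R[i] := cintegral circle (fun x => f x * g x).

Definition expi (y : R) : R[i] := cos y +i* sin y.

Definition fourier_coef f (k : int) : R[i] :=
  ((2 * pi)^-1)%:C * cintegral circle (fun x => f x * expi (- (k%:~R * x))).

(* \sum_(|k| <= N) \hat f_k e^{i k x} *)
Definition fourier_sum f (x : R) (N : nat) : R[i] :=
  \sum_(j < N.*2.+1)
    let k := j%:Z - N%:Z in fourier_coef f k * expi (k%:~R * x).

End SquareIntegrable.

Section Evolution.
Variable R : realType.
(* time-dependent functions on the circle: [phi t x] *)
Implicit Types (phi psi u v : R -> R -> R[i]).

Definition continuous_L2T phi : Prop :=
  (forall t, L2T (phi t)) /\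
  forall t0, sqnorm (@circle R) (fun x => phi t x - phi t0 x) @[t --> t0] --> 0%E.

Definition weakly_continuous_L2T u v : Prop :=
  (forall s, L2T (u s) /\ L2T (v s)) /\
  forall w1 w2 : R -> R[i], L2T w1 -> L2T w2 ->
    let h s := pairing (u s) w1 + pairing (v s) w2 in
    continuous (fun s => complex.Re (h s)) /\
    continuous (fun s => complex.Im (h s)).

Definition is_trace phi (x0 : R) (tau : R -> R[i]) : Prop :=
  L2loc tau /\ cvg_L2loc (fun N t => fourier_sum (phi t) x0 N) tau.

Definition dt (chi : R -> R -> R) : R -> R -> R :=
  fun t x => derive1 (fun s => chi s x) t.

Definition dx (chi : R -> R -> R) : R -> R -> R :=
  fun t x => derive1 (chi t) x.

Fixpoint Cn (n : nat) (chi : R -> R -> R) : Prop :=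
  continuous (fun p : R * R => chi p.1 p.2) /\
  if n is m.+1 then
    [/\ forall t x, derivable (fun s => chi s x) t 1,
        forall t x, derivable (chi t) x 1,
        Cn m (dt chi) & Cn m (dx chi)]
  else True.

(* Real-valued test functions suffice: distributions are complex linear. *)
Definition test_function (chi : R -> R -> R) : Prop :=
  [/\ forall n, Cn n chi,
      forall t, periodic (chi t) (2 * pi) &
      exists M : R, forall t x, M < `|t| -> chi t x = 0].

(* \int_R \int_T phi(t, x) chi(t, x) dx dt *)
Definition distr phi (chi : R -> R -> R) : R[i] :=
  cintegral setT (fun t => pairing (phi t) (fun x => (chi t x)%:C)).

(* The equations
     phi_t + phi_xxx + (d/c) psi_xxx = 0,
     psi_t + (r/c) psi_x + a phi_xxx + (1/c) psi_xxx = 0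
   in the sense of distributions. Every term carries a derivative of odd order,
   so moving the derivatives to the test function multiplies each equation by
   -1 as a whole. *)
Definition adjoint_solution (a c d r : R) (phi0 psi0 : R -> R[i])
    phi psi : Prop :=
  [/\ continuous_L2T phi,
      continuous_L2T psi,
      eqL2T (phi 0) phi0,
      eqL2T (psi 0) psi0 &
      forall chi, test_function chi ->
        distr phi (dt chi) + distr phi (dx (dx (dx chi)))
          + (d / c)%:C * distr psi (dx (dx (dx chi))) = 0 /\
        distr psi (dt chi) + (r / c)%:C * distr psi (dx chi)
          + a%:C * distr phi (dx (dx (dx chi)))
          + (c^-1)%:C * distr psi (dx (dx (dx chi))) = 0].

(* Solution by transposition of
     u_t + u_xxx + a v_xxx = f(t) delta_{x0},
     c v_t + r v_x + v_xxx + d u_xxx = g(t) delta_{x0},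
     u(0) = u0,  v(0) = v0. *)
Definition transposition_solution (a c d r x0 : R) (f g : R -> R[i])
    (u0 v0 : R -> R[i]) u v : Prop :=
  weakly_continuous_L2T u v /\
  forall phi0 psi0 : R -> R[i], L2T phi0 -> L2T psi0 ->
  forall phi psi, adjoint_solution a c d r phi0 psi0 phi psi ->
  forall phix0 psix0 : R -> R[i], is_trace phi x0 phix0 -> is_trace psi x0 psix0 ->
  forall s : R,
    pairing (u s) (phi s) + pairing (v s) (psi s) =
    pairing u0 phi0 + pairing v0 psi0 +
    cintegral_from0 s
      (fun t => f t * phix0 t + (c^-1)%:C * (g t * psix0 t)).

End Evolution.

(* Main.v *)
Require Import Defs.
From HB Require Import structures.
From mathcomp Require Import all_boot all_order all_algebra.
From mathcomp Require Import all_classical all_reals all_analysis.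
From mathcomp Require Import measurable_realfun ring lra zify.
Set Implicit Arguments.
Unset Strict Implicit.
Unset Printing Implicit Defensive.
Import Order.TTheory GRing.Theory Num.Theory.
Import numFieldNormedType.Exports.
Local Open Scope classical_set_scope.
Local Open Scope ring_scope.
Local Open Scope complex_scope.

(* In Fourier series the adjoint system splits into 2 x 2 systems with real
   frequencies, and reaching a final state amounts to a moment problem for the
   exponentials of all these frequencies on [0, T]. It is solvable once the
   exponentials satisfy Ingham's inequality on every interval of positive length.
   If the frequencies are distinct and the sum of [(w_p - w_q)^-2] over all pairs is
   finite, the off-diagonal part of their Gram matrix is Hilbert-Schmidt: outside
   of a finite set of frequencies it is small compared to the diagonal, and the
   remaining frequencies are added one by one at the price of an arbitrarily small
   increase of the length of the interval.

   For almost all parameters this sum is finite. With [a, c, r] fixed, for all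
   but finitely many pairs of spectral branches [k <> l] the difference
   [w_p - w_q] is a function of [d] whose difference quotients are of size at least
   [C |k^3 - l^3|], so that the integral of [(1 + (w_p - w_q)^2)^-1] over a
   bounded interval of [d] is [O(|k^3 - l^3|^-1)], which is summable. For each pair,
   [w_p = w_q] holds for at most two values of [d], or for one value of [r]. *)

(** * Complex numbers *)

(** Two controls make the moment problem scalar. [f] and [g] each solve a moment problem for the
    same family of exponentials: [f] carries the coefficients of [u0] to those of [uT] along both
    spectral branches of every mode, [g] does so for [v0] and [vT]. At time [T] the spectral
    projections add up to the identity, so the coupling never has to be inverted; bounds on the
    projections that are uniform in the mode give the bounds on the trajectory. The sum of
    [(w_p - w_q)^-2] cannot be integrated in [d], since it blows up where two frequencies cross. The
    sum of [(1 + (w_p - w_q)^2)^-1] can, and once it is finite, only finitely many pairs are at a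
    distance less than 1. The definition by transposition quantifies over all distributional
    solutions of the adjoint system. Their Fourier coefficients are therefore identified one mode at
    a time by a du Bois-Reymond argument, whereas the controlled trajectory is built from the
    Fourier coefficients that the transposition identity forces on it. *)

Section ComplexNumbers.
Variable R : realType.
Implicit Types (z w : R[i]) (x y : R).
Local Notation cj := (@conjc R).

(** Estimates are stated for real-valued squared moduli: they are polynomial in real and imaginary
    parts, within reach of [ring] and [nra]. *)
Definition nsq z : R := complex.Re z ^+ 2 + complex.Im z ^+ 2.

Lemma cReD z w : complex.Re (z + w) = complex.Re z + complex.Re w.
Proof. by case: z w => [? ?] [? ?]. Qed.
Lemma cImD z w : complex.Im (z + w) = complex.Im z + complex.Im w.
Proof. by case: z w => [? ?] [? ?]. Qed.
Lemma cReN z : complex.Re (- z) = - complex.Re z.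
Proof. by case: z => [? ?]. Qed.
Lemma cImN z : complex.Im (- z) = - complex.Im z.
Proof. by case: z => [? ?]. Qed.
Lemma cReM z w :
  complex.Re (z * w) = complex.Re z * complex.Re w - complex.Im z * complex.Im w.
Proof. by case: z w => [? ?] [? ?]. Qed.
Lemma cImM z w :
  complex.Im (z * w) = complex.Re z * complex.Im w + complex.Im z * complex.Re w.
Proof. by case: z w => [? ?] [? ?]. Qed.
Lemma cReJ z : complex.Re (cj z) = complex.Re z.
Proof. by case: z. Qed.
Lemma cImJ z : complex.Im (cj z) = - complex.Im z.
Proof. by case: z. Qed.

Definition cE := (cReD, cImD, cReN, cImN, cReM, cImM, cReJ, cImJ).

Lemma complex_eqP z w :
  complex.Re z = complex.Re w -> complex.Im z = complex.Im w -> z = w.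
Proof. by case: z w => [? ?] [? ?] /= -> ->. Qed.

Lemma conjcD z w : (cj (z + w)) = (cj z) + (cj w).
Proof. by apply: complex_eqP; rewrite !cE // opprD. Qed.
Lemma conjcM z w : (cj (z * w)) = (cj z) * (cj w).
Proof. by apply: complex_eqP; rewrite !cE; ring. Qed.
Lemma conjcN z : (cj (- z)) = - (cj z).
Proof. by apply: complex_eqP; rewrite !cE. Qed.
Lemma realcM x y : (x * y)%:C = x%:C * y%:C.
Proof. by rewrite rmorphM. Qed.
Lemma realcB x y : (x - y)%:C = x%:C - y%:C.
Proof. by rewrite rmorphB. Qed.
Lemma conjc_sum I (s : seq I) (P : pred I) (F : I -> R[i]) :
  (cj (\sum_(i <- s | P i) F i)) = \sum_(i <- s | P i) (cj (F i)).
Proof. by rewrite (big_morph _ conjcD (conjc0 R)). Qed.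
Lemma Re_sum I (s : seq I) (P : pred I) (F : I -> R[i]) :
  complex.Re (\sum_(i <- s | P i) F i) = \sum_(i <- s | P i) complex.Re (F i).
Proof. by rewrite (big_morph _ cReD (erefl : complex.Re 0 = 0)). Qed.
Lemma Im_sum I (s : seq I) (P : pred I) (F : I -> R[i]) :
  complex.Im (\sum_(i <- s | P i) F i) = \sum_(i <- s | P i) complex.Im (F i).
Proof. by rewrite (big_morph _ cImD (erefl : complex.Im 0 = 0)). Qed.

Lemma nsq_ge0 z : 0 <= nsq z.
Proof. by rewrite addr_ge0 ?sqr_ge0. Qed.
Hint Resolve nsq_ge0 : core.

Lemma nsq0 : nsq 0 = 0. Proof. by rewrite /nsq /= expr0n addr0. Qed.

Lemma nsq_eq0 z : nsq z = 0 -> z = 0.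
Proof.
move=> /eqP; rewrite paddr_eq0 ?sqr_ge0// !sqrf_eq0 => /andP[/eqP a0 /eqP b0].
exact: complex_eqP.
Qed.

Lemma nsqM z w : nsq (z * w) = nsq z * nsq w.
Proof. by rewrite /nsq !cE; ring. Qed.

Lemma nsqN z : nsq (- z) = nsq z.
Proof. by rewrite /nsq !cE; ring. Qed.

Lemma nsqJ z : nsq (cj z) = nsq z.
Proof. by rewrite /nsq !cE; ring. Qed.

Lemma nsqR x : nsq x%:C = x ^+ 2.
Proof. by rewrite /nsq /= expr0n addr0. Qed.

Lemma mulcJ z : z * (cj z) = (nsq z)%:C.
Proof. by apply: complex_eqP; rewrite !cE /nsq /=; ring. Qed.

Lemma nsqD_le z w : nsq (z + w) <= 2 * nsq z + 2 * nsq w.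
Proof.
rewrite /nsq !cE.
have := sqr_ge0 (complex.Re z - complex.Re w).
have := sqr_ge0 (complex.Im z - complex.Im w).
by nra.
Qed.

Lemma nsqB_le z w : nsq (z - w) <= 2 * nsq z + 2 * nsq w.
Proof. by rewrite -(nsqN w) nsqD_le. Qed.

Lemma normc_sqr z : ComplexField.Normc.normc z ^+ 2 = nsq z.
Proof. by case: z => a b /=; rewrite sqr_sqrtr ?addr_ge0 ?sqr_ge0. Qed.

Lemma Re_le_nsq z : complex.Re z ^+ 2 <= nsq z.
Proof. by rewrite lerDl sqr_ge0. Qed.
Lemma Im_le_nsq z : complex.Im z ^+ 2 <= nsq z.
Proof. by rewrite lerDr sqr_ge0. Qed.

Lemma expiD x y : expi (x + y) = expi x * expi y.
Proof. by rewrite /expi cosD sinD; apply: complex_eqP; rewrite !cE /=; ring. Qed.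

Lemma expi0 : expi 0 = 1 :> R[i].
Proof. by rewrite /expi cos0 sin0. Qed.

Lemma expiJ x : (cj (expi x)) = expi (- x).
Proof. by rewrite /expi cosN sinN. Qed.

Lemma expiNK x : expi x * expi (- x) = 1.
Proof. by rewrite -expiD subrr expi0. Qed.

Lemma nsq_expi x : nsq (expi x) = 1.
Proof. by rewrite /nsq /= cos2Dsin2. Qed.

(** The discriminant argument behind both Cauchy-Schwarz inequalities, for sums and for
    integrals. *)
Lemma quadratic_nonneg (A C : R) (B : R[i]) : 0 <= C ->
  (forall t : R[i], 0 <= A + 2 * complex.Re (t * B) + nsq t * C) ->
  nsq B <= A * C.
Proof.
move=> C0 H.
(* The choice of [t] as a real multiple of the conjugate of [B] makes the cross term real and
   negative for [s > 0]. *)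
have H' s : 0 <= A - 2 * s * nsq B + s ^+ 2 * nsq B * C.
  have := H (- (s%:C * (cj B))).
  rewrite nsqN nsqM nsqJ nsqR mulNr -(mulrA s%:C) (mulrC (cj B)) mulcJ !cE /=.
  by congr (_ <= _); ring.
move: C0; rewrite le_eqVlt => /orP[/eqP C0|C0].
  rewrite -C0 mulr0 leNgt; apply/negP => B0.
  have A0 : 0 <= A by have := H' 0; rewrite expr0n /= mulr0 !mul0r subr0 addr0.
  (* For [C = 0] the form is affine in [s], and this [s] gives it the value [- A - 2 < 0]. *)
  have := H' ((A + 1) / nsq B); rewrite -C0 mulr0 addr0.
  rewrite mulrA -mulrA mulVf ?gt_eqF// mulr1.
  by rewrite leNgt => /negP; apply; lra.
have := H' C^-1.
have -> : A - 2 * C^-1 * nsq B + C^-1 ^+ 2 * nsq B * C = A - nsq B / C.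
  by field; rewrite gt_eqF.
by rewrite subr_ge0 ler_pdivrMr.
Qed.

Lemma sum_CauchySchwarz I (s : seq I) (P : pred I) (f g : I -> R[i]) :
  nsq (\sum_(i <- s | P i) f i * g i) <=
  (\sum_(i <- s | P i) nsq (f i)) * (\sum_(i <- s | P i) nsq (g i)).
Proof.
apply: quadratic_nonneg => [|t]; first by apply: sumr_ge0.
have -> : \sum_(i <- s | P i) nsq (f i) +
    2 * complex.Re (t * \sum_(i <- s | P i) f i * g i) +
    nsq t * \sum_(i <- s | P i) nsq (g i) =
    \sum_(i <- s | P i) nsq ((cj (f i)) + t * g i).
  rewrite mulr_sumr Re_sum !mulr_sumr -!big_split /=; apply: eq_bigr => i _.
  by rewrite /nsq !cE; ring.
by apply: sumr_ge0.
Qed.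

End ComplexNumbers.
#[global] Hint Resolve nsq_ge0 : core.

(** * Square integrable functions *)

Section SquareIntegrableTheory.
Variable R : realType.
Local Notation mu := (@lebesgue_measure R).
Local Notation cj := (@conjc R).

Section FixedDomain.
Variables (D : set R) (mD : measurable (D : set (measurableTypeR R))).
Implicit Types (f g : R -> R[i]) (h k : R -> R).

Local Notation rint h := (mu.-integrable D (EFin \o h)).

Definition cintegrable f :=
  rint (fun x => complex.Re (f x)) /\ rint (fun x => complex.Im (f x)).

Definition norm2 f : R := \int[mu]_(x in D) nsq (f x).

Lemma rint_meas h : rint h -> measurable_fun D h.
Proof. by move=> /measurable_int /measurable_EFinP. Qed.

Lemma rint_le h k : measurable_fun D h -> rint k ->
  (forall x, D x -> `|h x| <= k x) -> rint h.
Proof.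
move=> mh ik hk; apply: (le_integrable mD _ _ ik).
  exact/measurable_EFinP.
move=> x Dx /=; rewrite lee_fin; apply: (le_trans (hk x Dx)).
exact: ler_norm.
Qed.

Lemma rintD h k : rint h -> rint k -> rint (fun x => h x + k x).
Proof. exact: (integrableD mD). Qed.
Lemma rintB h k : rint h -> rint k -> rint (fun x => h x - k x).
Proof. by move=> ih ik; have := integrableB mD ih ik. Qed.
Lemma rintZ (a : R) h : rint h -> rint (fun x => a * h x).
Proof. by move=> ih; have := integrableZl mD a ih. Qed.
Lemma eq_rint h k : (forall x, D x -> h x = k x) -> rint h -> rint k.
Proof.
move=> hk; apply: eq_integrable => // x; rewrite inE => Dx /=.
by rewrite hk.
Qed.

Lemma cmeasurableD f g : cmeasurable D f -> cmeasurable D g ->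
  cmeasurable D (fun x => f x + g x).
Proof.
move=> [rf If] [rg Ig]; split.
  apply: eq_measurable_fun (measurable_funD rf rg) => x _ /=; by rewrite cReD.
apply: eq_measurable_fun (measurable_funD If Ig) => x _ /=; by rewrite cImD.
Qed.

Lemma cmeasurableM f g : cmeasurable D f -> cmeasurable D g ->
  cmeasurable D (fun x => f x * g x).
Proof.
move=> [rf If] [rg Ig]; split.
  apply: eq_measurable_fun
    (measurable_funB (measurable_funM rf rg) (measurable_funM If Ig)) => x _ /=.
  by rewrite cReM.
apply: eq_measurable_fun
    (measurable_funD (measurable_funM rf Ig) (measurable_funM If rg)) => x _ /=.
by rewrite cImM.
Qed.

Lemma cmeasurable_cst (a : R[i]) : cmeasurable D (fun=> a).
Proof. by split; exact: measurable_cst. Qed.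

Lemma cmeasurableJ f : cmeasurable D f -> cmeasurable D (fun x => (cj (f x))).
Proof.
move=> [rf If]; split.
  by apply: eq_measurable_fun rf => x _; rewrite cReJ.
by apply: eq_measurable_fun (measurable_funN If) => x _ /=; rewrite cImJ.
Qed.

Lemma measurable_nsq f : cmeasurable D f -> measurable_fun D (fun x => nsq (f x)).
Proof. by move=> [rf If]; apply: measurable_funD; exact: measurable_funX. Qed.

Lemma cintegrableD f g : cintegrable f -> cintegrable g ->
  cintegrable (fun x => f x + g x).
Proof.
move=> [rf If] [rg Ig]; split.
  by apply: eq_rint (rintD rf rg) => x _; rewrite cReD.
by apply: eq_rint (rintD If Ig) => x _; rewrite cImD.
Qed.

Lemma cintegrableZ (a : R[i]) f : cintegrable f -> cintegrable (fun x => a * f x).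
Proof.
move=> [rf If]; split.
  by apply: eq_rint (rintB (rintZ (complex.Re a) rf) (rintZ (complex.Im a) If))
    => x _; rewrite cReM.
by apply: eq_rint (rintD (rintZ (complex.Re a) If) (rintZ (complex.Im a) rf))
    => x _; rewrite cImM.
Qed.

Lemma cintegralD f g : cintegrable f -> cintegrable g ->
  cintegral D (fun x => f x + g x) = cintegral D f + cintegral D g.
Proof.
move=> [rf If] [rg Ig]; apply: complex_eqP; rewrite !cE /cintegral /=.
  by rewrite -RintegralD//; apply: eq_Rintegral => x _; rewrite cReD.
by rewrite -RintegralD//; apply: eq_Rintegral => x _; rewrite cImD.
Qed.

Lemma cintegralZ (a : R[i]) f : cintegrable f ->
  cintegral D (fun x => a * f x) = a * cintegral D f.
Proof.
move=> [rf If]; apply: complex_eqP; rewrite !cE /cintegral /=.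
  rewrite -!RintegralZl// -RintegralB//; [|exact: rintZ|exact: rintZ].
  by apply: eq_Rintegral => x _; rewrite cReM.
rewrite -!RintegralZl// -RintegralD//; [|exact: rintZ|exact: rintZ].
by apply: eq_Rintegral => x _; rewrite cImM.
Qed.

Lemma eq_cintegral f g : (forall x, D x -> f x = g x) -> cintegral D f = cintegral D g.
Proof.
move=> fg; rewrite /cintegral; congr (_ +i* _);
by apply: eq_Rintegral => x; rewrite inE => Dx; rewrite fg.
Qed.

Lemma eq_cintegrable f g : (forall x, D x -> f x = g x) ->
  cintegrable f -> cintegrable g.
Proof.
move=> fg [rf If]; split.
  by apply: eq_rint rf => x Dx; rewrite fg.
by apply: eq_rint If => x Dx; rewrite fg.
Qed.

Lemma cintegralN f : cintegrable f ->
  cintegral D (fun x => - f x) = - cintegral D f.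
Proof.
move=> cf; rewrite -mulN1r -cintegralZ//.
by apply: eq_cintegral => x _; rewrite mulN1r.
Qed.

Lemma cintegralB f g : cintegrable f -> cintegrable g ->
  cintegral D (fun x => f x - g x) = cintegral D f - cintegral D g.
Proof.
move=> cf cg; rewrite -cintegralN// -cintegralD//.
by apply: eq_cintegrable (cintegrableZ (-1) cg) => x _; rewrite mulN1r.
Qed.

Lemma cintegrable0 : cintegrable (fun=> 0).
Proof. by split; exact: integrable0. Qed.

Lemma cintegral0 : cintegral D (fun=> 0) = 0 :> R[i].
Proof. by rewrite /cintegral /= Rintegral_cst// mul0r. Qed.

Lemma cintegrable_sum (I : Type) (s : seq I) (F : I -> R -> R[i]) :
  (forall i, cintegrable (F i)) -> cintegrable (fun x => \sum_(i <- s) F i x).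
Proof.
move=> iF; elim: s => [|i s IH].
  by apply: eq_cintegrable cintegrable0 => x _; rewrite big_nil.
by apply: eq_cintegrable (cintegrableD (iF i) IH) => x _; rewrite big_cons.
Qed.

Lemma cintegral_sum (I : Type) (s : seq I) (F : I -> R -> R[i]) :
  (forall i, cintegrable (F i)) ->
  cintegral D (fun x => \sum_(i <- s) F i x) = \sum_(i <- s) cintegral D (F i).
Proof.
move=> iF; elim: s => [|i s IH].
  by rewrite big_nil -[RHS]cintegral0; apply: eq_cintegral => x _; rewrite big_nil.
rewrite big_cons -IH -cintegralD//; last exact: cintegrable_sum.
by apply: eq_cintegral => x _; rewrite big_cons.
Qed.

Lemma square_integrableP f :
  square_integrable D f <-> cmeasurable D f /\ rint (fun x => nsq (f x)).
Proof.
rewrite /square_integrable /sqnorm; split=> -[mf H]; split=> //.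
  apply/integrableP; split; first by apply/measurable_EFinP; apply: measurable_nsq.
  apply: le_lt_trans H; rewrite le_eqVlt; apply/orP; left; apply/eqP.
  by apply: eq_integral => x _; rewrite normc_sqr /= ger0_norm ?nsq_ge0.
move/integrableP : H => [_]; apply: le_lt_trans.
rewrite le_eqVlt; apply/orP; left; apply/eqP.
by apply: eq_integral => x _; rewrite normc_sqr /= ger0_norm ?nsq_ge0.
Qed.

Lemma sqnormE f : square_integrable D f -> sqnorm D f = (norm2 f)%:E.
Proof.
move=> /square_integrableP[mf If].
rewrite /norm2 /Rintegral fineK; last exact: integrable_fin_num.
by apply: eq_integral => x _; rewrite normc_sqr.
Qed.

Lemma norm2_ge0 f : 0 <= norm2 f.
Proof. by apply: Rintegral_ge0 => x _. Qed.

Local Notation L2 := (square_integrable D).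

Lemma L2_cmeasurable f : L2 f -> cmeasurable D f. Proof. by case. Qed.

Lemma L2_nsq f : L2 f -> rint (fun x => nsq (f x)).
Proof. by move=> /square_integrableP[]. Qed.

Lemma L2D f g : L2 f -> L2 g -> L2 (fun x => f x + g x).
Proof.
move=> /square_integrableP[mf If] /square_integrableP[mg Ig].
have m := cmeasurableD mf mg.
apply/square_integrableP; split=> //.
apply: rint_le (rintD (rintZ 2 If) (rintZ 2 Ig)) _; first exact: measurable_nsq.
by move=> x _; rewrite ger0_norm; [exact: nsqD_le|exact: nsq_ge0].
Qed.

Lemma L2Z (a : R[i]) f : L2 f -> L2 (fun x => a * f x).
Proof.
move=> /square_integrableP[mf If].
have m := cmeasurableM (cmeasurable_cst a) mf.
apply/square_integrableP; split=> //.
apply: eq_rint (rintZ (nsq a) If) => x _; by rewrite nsqM.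
Qed.

Lemma L2J f : L2 f -> L2 (fun x => (cj (f x))).
Proof.
move=> /square_integrableP[mf If].
have m := cmeasurableJ mf.
apply/square_integrableP; split=> //.
by apply: eq_rint If => x _; rewrite nsqJ.
Qed.

Lemma eq_L2 f g : (forall x, D x -> f x = g x) -> L2 f -> L2 g.
Proof.
move=> fg /square_integrableP[[rf If] nf]; apply/square_integrableP; split.
  split.
    by apply: eq_measurable_fun rf => x; rewrite inE => Dx; rewrite fg.
  by apply: eq_measurable_fun If => x; rewrite inE => Dx; rewrite fg.
by apply: eq_rint nf => x Dx; rewrite fg.
Qed.

Lemma L2N f : L2 f -> L2 (fun x => - f x).
Proof. by move=> /(L2Z (-1)); apply: eq_L2 => x _; rewrite mulN1r. Qed.

Lemma L2B f g : L2 f -> L2 g -> L2 (fun x => f x - g x).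
Proof. by move=> Lf Lg; exact: L2D Lf (L2N Lg). Qed.

Lemma L2_0 : L2 (fun=> 0).
Proof.
apply/square_integrableP; split; first exact: cmeasurable_cst.
by apply: eq_rint (integrable0 _ _) => x _ /=; rewrite nsq0.
Qed.

Lemma L2_sum (I : Type) (s : seq I) (F : I -> R -> R[i]) :
  (forall i, L2 (F i)) -> L2 (fun x => \sum_(i <- s) F i x).
Proof.
move=> iF; elim: s => [|i s IH].
  by apply: eq_L2 L2_0 => x _; rewrite big_nil.
by apply: eq_L2 (L2D (iF i) IH) => x _; rewrite big_cons.
Qed.

Lemma L2_mul f g : L2 f -> L2 g -> cintegrable (fun x => f x * g x).
Proof.
move=> /square_integrableP[mf If] /square_integrableP[mg Ig].
have [mr mi] := cmeasurableM mf mg.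
have B z w : `|complex.Re (z * w)| <= nsq z + nsq w /\
   `|complex.Im (z * w)| <= nsq z + nsq w :> R.
  rewrite !ler_norml /nsq !cE.
  have := sqr_ge0 (complex.Re z - complex.Re w).
  have := sqr_ge0 (complex.Re z + complex.Re w).
  have := sqr_ge0 (complex.Im z - complex.Im w).
  have := sqr_ge0 (complex.Im z + complex.Im w).
  have := sqr_ge0 (complex.Re z - complex.Im w).
  have := sqr_ge0 (complex.Re z + complex.Im w).
  have := sqr_ge0 (complex.Im z - complex.Re w).
  have := sqr_ge0 (complex.Im z + complex.Re w).
  move=> *; split; apply/andP; split; nra.
split; apply: rint_le (rintD If Ig) _ => // x _; by have [] := B (f x) (g x).
Qed.

Lemma norm2E f : L2 f -> (norm2 f)%:C = cintegral D (fun x => f x * (cj (f x))).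
Proof.
move=> Lf; apply: complex_eqP; rewrite /cintegral/=.
  by apply: eq_Rintegral => x _; rewrite mulcJ.
rewrite -[LHS](_ : \int[mu]_(x in D) 0 = 0); last by rewrite Rintegral_cst// mul0r.
by apply: eq_Rintegral => x _; rewrite mulcJ.
Qed.

Lemma eq_norm2 f g : (forall x, D x -> f x = g x) -> norm2 f = norm2 g.
Proof. by move=> fg; apply: eq_Rintegral => x; rewrite inE => /fg ->. Qed.

Lemma norm2Z (a : R[i]) f : L2 f -> norm2 (fun x => a * f x) = nsq a * norm2 f.
Proof.
move=> /L2_nsq If; rewrite /norm2 -RintegralZl//.
by apply: eq_Rintegral => x _; rewrite nsqM.
Qed.

Lemma norm2D f g : L2 f -> L2 g ->
  norm2 (fun x => f x + g x) =
  norm2 f + 2 * complex.Re (cintegral D (fun x => f x * (cj (g x)))) + norm2 g.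
Proof.
move=> Lf Lg; have [rI _] := L2_mul Lf (L2J Lg).
rewrite /norm2 /cintegral /= -RintegralZl// -RintegralD//; first last.
- exact: rintZ.
- exact: L2_nsq.
rewrite -RintegralD//; [|apply: rintD; [exact: L2_nsq|exact: rintZ]|exact: L2_nsq].
by apply: eq_Rintegral => x _; rewrite /nsq !cE; ring.
Qed.

Lemma norm2D_le f g : L2 f -> L2 g ->
  norm2 (fun x => f x + g x) <= 2 * norm2 f + 2 * norm2 g.
Proof.
move=> Lf Lg; rewrite /norm2 -!RintegralZl//; [|exact: L2_nsq|exact: L2_nsq].
rewrite -RintegralD//; [|exact/rintZ/L2_nsq|exact/rintZ/L2_nsq].
apply: le_Rintegral => //; first exact/L2_nsq/L2D.
  by apply: rintD; exact/rintZ/L2_nsq.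
by move=> x _; exact: nsqD_le.
Qed.

Lemma norm2N f : norm2 (fun x => - f x) = norm2 f.
Proof. by apply: eq_Rintegral => x _; rewrite nsqN. Qed.

Lemma norm2B_le f g : L2 f -> L2 g ->
  norm2 (fun x => f x - g x) <= 2 * norm2 f + 2 * norm2 g.
Proof.
by move=> Lf Lg; rewrite -(norm2N g); exact: norm2D_le Lf (L2N Lg).
Qed.

Lemma integral_CauchySchwarz f g : L2 f -> L2 g ->
  nsq (cintegral D (fun x => f x * g x)) <= norm2 f * norm2 g.
Proof.
move=> Lf Lg; apply: quadratic_nonneg => [|t]; first exact: norm2_ge0.
have Lt := L2J (L2Z t Lg).
suff -> : norm2 f + 2 * complex.Re (t * cintegral D (fun x => f x * g x)) +
    nsq t * norm2 g = norm2 (fun x => f x + (cj (t * g x))) by exact: norm2_ge0.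
rewrite norm2D// -norm2Z//; congr (_ + _ * complex.Re _ + _).
  rewrite -cintegralZ; last exact: L2_mul.
  by apply: eq_cintegral => x _; rewrite conjcK; ring.
by apply: eq_Rintegral => x _; rewrite nsqJ.
Qed.

End FixedDomain.

Section Subdomain.
Variables (A B : set R) (mA : measurable (A : set (measurableTypeR R))).
Hypotheses (mB : measurable (B : set (measurableTypeR R))) (AB : A `<=` B).

Lemma L2_subset f : square_integrable B f -> square_integrable A f.
Proof.
move=> Lf; have [[rf If] nf] := proj1 (square_integrableP B f) Lf.
apply/square_integrableP => //; split.
  by split; apply: measurable_funS; eauto.
exact: integrableS nf.
Qed.

Lemma norm2_subset f : square_integrable B f -> norm2 A f <= norm2 B f.
Proof.
move=> Lf; have LfA := L2_subset Lf.
rewrite /norm2 /Rintegral fine_le//.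
- by apply: integrable_fin_num => //; exact: L2_nsq.
- by apply: integrable_fin_num => //; exact: L2_nsq.
apply: ge0_subset_integral => //; last by move=> x _; rewrite lee_fin nsq_ge0.
by apply: measurable_int; exact: L2_nsq.
Qed.

End Subdomain.
End SquareIntegrableTheory.

(** * Completeness of the space of square integrable functions *)

Section L2Completeness.
Variable R : realType.
Local Notation mu := (@lebesgue_measure R).
Variables (D : set R) (mD : measurable (D : set (measurableTypeR R))).
Local Notation L2 := (square_integrable D).

Lemma cvg_nsqB (z : R[i]) (w : nat -> R[i]) (l : R[i]) :
  complex.Re (w k) @[k --> \oo] --> complex.Re l ->
  complex.Im (w k) @[k --> \oo] --> complex.Im l ->
  nsq (z - w k) @[k --> \oo] --> nsq (z - l).
Proof.
move=> rw iw; rewrite /nsq.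
have E (v : R[i]) : complex.Re (z - v) ^+ 2 + complex.Im (z - v) ^+ 2 =
  (complex.Re z - complex.Re v) * (complex.Re z - complex.Re v) +
  (complex.Im z - complex.Im v) * (complex.Im z - complex.Im v) by rewrite !cE !expr2.
rewrite E; under eq_fun do rewrite E.
by apply: cvgD; apply: cvgM; (apply: cvgB; [exact: cvg_cst|by []]).
Qed.

(** The telescoping series is dominated by a geometric one of ratio [1 / 2]. Its factor [M + 1]
    replaces the square root of [M], as [M <= (M + 1) ^+ 2]. *)
Lemma cvg_of_geometric_steps (u : nat -> R) (M : R) : 0 <= M ->
  (forall k, (u k.+1 - u k) ^+ 2 <= M * (4 ^- k)) -> cvgn u.
Proof.
move=> M0 H.
have E : u = (fun k => u 0%N + series (telescope u) k).
  by apply/funext => k; exact: eq_sum_telescope.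
rewrite E; apply: is_cvgD; first exact: is_cvg_cst.
apply: normed_cvg.
apply: (@series_le_cvg _ _ (geometric (M + 1) 2^-1)).
- by move=> n; exact: normr_ge0.
- by move=> n; rewrite /geometric /= mulr_ge0 ?exprn_ge0 ?addr_ge0.
- move=> n; rewrite /telescope /geometric /=.
  rewrite -(@ler_pXn2r _ 2) ?nnegrE ?mulr_ge0 ?exprn_ge0 ?addr_ge0//.
  rewrite real_normK ?num_real//; apply: (le_trans (H n)).
  rewrite exprMn -exprM mulnC exprM (_ : 2^-1 ^+ 2 = 4^-1 :> R); last by field.
  rewrite exprVn ler_wpM2r// ?invr_ge0 ?exprn_ge0//.
  by rewrite expr2; nra.
- by apply: is_cvg_geometric_series; rewrite ger0_norm ?invr_ge0// invf_lt1// ltr1n.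
Qed.

Lemma limn_einf_le (u : nat -> \bar R) (e : \bar R) :
  (forall k, u k <= e)%E -> (limn_einf u <= e)%E.
Proof.
move=> H; rewrite limn_einf_lim; apply: lime_le; first exact: is_cvg_einfs.
by near=> n; apply: le_trans (H n); apply: ereal_inf_lbound; exists n => /=.
Unshelve. all: by end_near. Qed.

(** The weights [4 ^+ k] leave the squared steps with a sum of finite integral, at most the sum of
    [4 ^- k]. At almost every point this sum is finite, so that the steps themselves are [O(2 ^- k)]
    there and the sequence converges. *)
Lemma rapidly_cauchy_cvg (g : nat -> R -> R[i]) :
  (forall k, L2 (g k)) ->
  (forall k, norm2 D (fun x => g k.+1 x - g k x) <= 16 ^- k) ->
  exists2 G, cmeasurable D G &
    {ae mu, forall x, D x -> complex.Re (g k x) @[k --> \oo] --> complex.Re (G x) /\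
       complex.Im (g k x) @[k --> \oo] --> complex.Im (G x)}.
Proof.
move=> Lg Hg.
pose a k x : \bar R := (4 ^+ k * nsq (g k.+1 x - g k x))%:E.
pose S x := (\sum_(0 <= k <oo) a k x)%E.
have ma k : measurable_fun D (a k).
  apply/measurable_EFinP; apply: measurable_funM => //.
  by apply: measurable_nsq => //; have [] := L2B mD (Lg k.+1) (Lg k).
have a0 k x : (0 <= a k x)%E by rewrite /a lee_fin; apply: mulr_ge0; [exact: exprn_ge0|exact: nsq_ge0].
have mS : measurable_fun D S by apply: ge0_emeasurable_sum.
have S0 x : (0 <= S x)%E by apply: nneseries_ge0.
have IS : (\int[mu]_(x in D) S x < +oo)%E.
  rewrite integral_nneseries//.
  apply: (@le_lt_trans _ _ (\sum_(0 <= k <oo) (geometric 1 4^-1 k)%:E)%E).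
    apply: lee_nneseries => [*|k _]; first by apply: integral_ge0.
    have I := L2_nsq (L2B mD (Lg k.+1) (Lg k)).
    have -> : (\int[mu]_(x in D) a k x)%E =
       (4 ^+ k * norm2 D (fun x => g k.+1 x - g k x))%:E.
      rewrite /norm2 -RintegralZl// /Rintegral fineK//.
      by apply: integrable_fin_num => //; exact: rintZ.
    rewrite lee_fin /geometric /= mul1r.
    apply: (@le_trans _ _ (4 ^+ k * 16 ^- k)); first by rewrite ler_wpM2l// exprn_ge0.
    have -> : (16 : R) = 4 * 4 by ring.
    by rewrite exprMn invfM mulrA divff ?expf_neq0// mul1r exprVn.
  have C := @cvg_geometric_series R 1 4^-1 _.
  rewrite (@cvg_lim _ _ _ _ _ _ ((1 / (1 - 4^-1))%:E)) ?ltry//.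
  rewrite [X in X @ _](_ : _ = EFin \o series (geometric 1 (4^-1 : R))).
    apply: cvg_EFin; first by near=> n.
    by apply: C; rewrite ger0_norm ?invr_ge0// invf_lt1// ltr1n.
  by apply/funext => n; rewrite /series /= -sumEFin.
have IS' : mu.-integrable D S.
  apply/integrableP; split=> //.
  by under eq_integral do rewrite gee0_abs//.
have aeS := integrable_ae mD IS'.
pose A := D `&` [set x | S x < +oo]%E.
have mA : measurable (A : set (measurableTypeR R)).
  by apply: measurable_lte => //; exact: measurable_cst.
have cvA x : A x -> cvgn (fun k => complex.Re (g k x)) /\ cvgn (fun k => complex.Im (g k x)).
  move=> [Dx Sx].
  have Sf : S x \is a fin_num by rewrite ge0_fin_numE.
  have B k : nsq (g k.+1 x - g k x) <= fine (S x) * 4 ^- k.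
    rewrite ler_pdivlMr ?exprn_gt0// mulrC -lee_fin fineK//.
    have /= := @nneseries_lim_ge R (fun k => a k x) xpredT 0 k.+1.
    move/(_ (fun n _ _ => a0 n x)); apply: le_trans.
    by rewrite big_nat_recr//= leeDr// sume_ge0.
  have F0 : 0 <= fine (S x) by apply: fine_ge0.
  split; apply: (cvg_of_geometric_steps F0) => k; apply: le_trans (B k).
    by rewrite -cReN -cReD Re_le_nsq.
  by rewrite -cImN -cImD Im_le_nsq.
(* The indicator of the convergence set makes the sequences converge everywhere, so that
   measurability passes to the limit. *)
pose G x := limn (fun k => \1_A x * complex.Re (g k x)) +i*
            limn (fun k => \1_A x * complex.Im (g k x)).
have cvR x : cvgn (fun k => \1_A x * complex.Re (g k x)).
  have [/cvA[c _]|nA] := pselect (A x).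
    by apply: is_cvgM => //; exact: is_cvg_cst.
  rewrite indicE memNset//.
  by under eq_fun do rewrite mul0r; exact: is_cvg_cst.
have cvI x : cvgn (fun k => \1_A x * complex.Im (g k x)).
  have [/cvA[_ c]|nA] := pselect (A x).
    by apply: is_cvgM => //; exact: is_cvg_cst.
  rewrite indicE memNset//.
  by under eq_fun do rewrite mul0r; exact: is_cvg_cst.
have m1 : measurable_fun D (\1_A : R -> R) by exact: measurable_indic.
exists G.
- split.
    apply: (@measurable_fun_cvg _ _ _ D (fun k x => \1_A x * complex.Re (g k x))) => [k|x Dx].
      by apply: measurable_funM => //; have [[]] := Lg k.
    exact: cvR.
  apply: (@measurable_fun_cvg _ _ _ D (fun k x => \1_A x * complex.Im (g k x))) => [k|x Dx].
    by apply: measurable_funM => //; have [[]] := Lg k.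
  exact: cvI.
- apply: filterS aeS => x Sx Dx.
  have Ax : A x by split=> //=; rewrite ltey_eq Sx.
  rewrite /G /= indicE mem_set//=.
  have [c1 c2] := cvA _ Ax; split.
    by rewrite (_ : (fun k => 1 * _) = (fun k => complex.Re (g k x)))//;
      apply/funext => k; rewrite mul1r.
  by rewrite (_ : (fun k => 1 * _) = (fun k => complex.Im (g k x)))//;
    apply/funext => k; rewrite mul1r.
Unshelve. all: by end_near. Qed.

(** A fast subsequence converges almost everywhere to some [G]. Fatou's lemma along it turns the
    Cauchy bound on [F n - F m] into the same bound on [F n - G]. *)
Lemma L2_complete (F : nat -> R -> R[i]) : (forall n, L2 (F n)) ->
  (forall e, 0 < e -> exists N, forall m n, (N <= m)%N -> (N <= n)%N ->
     norm2 D (fun x => F m x - F n x) <= e) ->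
  exists G, L2 G /\ forall e, 0 < e -> exists N, forall n, (N <= n)%N ->
     norm2 D (fun x => F n x - G x) <= e.
Proof.
move=> LF CF.
have /choice[phi phiP] : forall k, exists N, forall m n, (N <= m)%N -> (N <= n)%N ->
     norm2 D (fun x => F m x - F n x) <= 16 ^- k.
  by move=> k; apply: CF; rewrite invr_gt0 exprn_gt0.
(* The sum makes the indices nondecreasing and at least [phi k]; the summand [k] makes them
   unbounded. *)
pose psi k := (k + \sum_(j < k.+1) phi j)%N.
have psi_ge k : (phi k <= psi k)%N by rewrite /psi big_ord_recr addnA leq_addl.
have psi_mono k : (psi k <= psi k.+1)%N.
  by rewrite /psi [in leqRHS]big_ord_recr leq_add ?leq_addr.
have psi_id k : (k <= psi k)%N by rewrite /psi leq_addr.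
pose g k := F (psi k).
have [|k|G mG cG] := @rapidly_cauchy_cvg g; first by move=> k; exact: LF.
  by apply: phiP => //; apply: (leq_trans (psi_ge k)); apply: psi_mono.
have mNG : cmeasurable D (fun x => - G x).
  have := cmeasurableM (cmeasurable_cst D (-1)) mG.
  by under eq_fun do rewrite mulN1r.
have [N0 [mN0 N00 sN0]] := cG.
have mDN : measurable (D `\` N0 : set (measurableTypeR R)) by exact: measurableD.
have key e N : (forall m n, (N <= m)%N -> (N <= n)%N ->
     norm2 D (fun x => F m x - F n x) <= e) -> forall n, (N <= n)%N ->
     (\int[mu]_(x in D) (nsq (F n x - G x))%:E <= e%:E)%E.
  move=> HN n Nn.
  have mFG : cmeasurable D (fun x => F n x - G x).
    exact: cmeasurableD (L2_cmeasurable (LF n)) mNG.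
  rewrite (ge0_negligible_integral mN0)//; first last.
  - by move=> x _; rewrite lee_fin nsq_ge0.
  - by apply/measurable_EFinP; exact: measurable_nsq.
  pose h k x := (nsq (F n x - g (k + N)%N x))%:E.
  have mh k : measurable_fun D (h k).
    apply/measurable_EFinP; apply: measurable_nsq.
    by apply: L2_cmeasurable; exact: L2B (LF _) (LF _).
  have hG x : (D `\` N0) x -> limn_einf (h^~ x) = (nsq (F n x - G x))%:E.
    move=> [Dx nNx]; have [rg ig] : complex.Re (g k x) @[k --> \oo] --> complex.Re (G x) /\
       complex.Im (g k x) @[k --> \oo] --> complex.Im (G x).
      by apply: contrapT => nc; apply: nNx; apply: sN0 => /= H; apply: nc; exact: H.
    apply: (fst (cvg_limn_einf_sup _)).
    apply: cvg_EFin; first by near=> k.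
    by apply: cvg_nsqB; [move: rg|move: ig]; rewrite -(cvg_shiftn N).
  have -> : (\int[mu]_(x in D `\` N0) (nsq (F n x - G x))%:E =
      \int[mu]_(x in D `\` N0) limn_einf (h^~ x))%E.
    by apply: eq_integral => x; rewrite inE => /hG.
  apply: (le_trans (fatou _ _ _ _)) => //.
  - by move=> k; apply: measurable_funS (mh k) => //; exact: subDsetl.
  - by move=> k x _; rewrite lee_fin nsq_ge0.
  apply: limn_einf_le => k.
  apply: (@le_trans _ _ (\int[mu]_(x in D) h k x)%E).
    apply: (@ge0_subset_integral _ _ _ mu _ _ mDN mD (h k) (mh k)) => [x _|].
      by rewrite lee_fin nsq_ge0.
    exact: subDsetl.
  have L := L2B mD (LF n) (LF (psi (k + N)%N)).
  have := HN n (psi (k + N)%N) Nn (leq_trans (leq_addl _ _) (psi_id _)).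
  rewrite -lee_fin /norm2 /Rintegral fineK//.
  by apply: integrable_fin_num => //; exact: L2_nsq.
have LG : L2 G.
  have [N HN] := CF 1 ltr01.
  have L : L2 (fun x => F N x - G x).
    split; first exact: cmeasurableD (L2_cmeasurable (LF N)) mNG.
    apply: (@le_lt_trans _ _ 1%:E); last exact: ltry.
    rewrite /sqnorm; under eq_integral do rewrite normc_sqr.
    exact: (key 1 N HN N (leqnn N)).
  by apply: eq_L2 (L2B mD (LF N) L) => // x _; rewrite opprB addrC subrK.
exists G; split=> // e e0.
have [N HN] := CF e e0; exists N => n Nn.
have := key e N HN n Nn.
rewrite -lee_fin /norm2 /Rintegral fineK//.
by apply: integrable_fin_num => //; apply: L2_nsq => //; exact: L2B.
Unshelve. all: by end_near. Qed.
End L2Completeness.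

(** * Moment problems *)

(** Bounding all finite sums dispenses with an enumeration of [I]. *)
Definition square_summable (R : realType) (I : eqType) (b : I -> R[i]) : Prop :=
  exists M : R, forall s : seq I, uniq s -> \sum_(i <- s) nsq (b i) <= M.

Section MomentProblem.
Variable R : realType.
Local Notation mu := (@lebesgue_measure R).
Local Notation cj := (@conjc R).
Variables (D : set R) (mD : measurable (D : set (measurableTypeR R))).
Local Notation L2 := (square_integrable D).
Variables (I : countType) (e : I -> R -> R[i]) (delta : R).
Hypotheses (Le : forall i, L2 (e i)) (delta0 : 0 < delta).
Hypothesis riesz : forall (s : seq I) (c : I -> R[i]), uniq s ->
  delta * \sum_(i <- s) nsq (c i) <= norm2 D (fun x => \sum_(i <- s) c i * e i x).

(** The moments are bilinear, so the solution of minimal norm of a finite moment problem lies in the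
    span of the conjugates of the [e i]. *)
Definition dual_comb (s : seq I) (c : I -> R[i]) : R -> R[i] :=
  fun x => \sum_(i <- s) c i * cj (e i x).

Lemma L2_dual_comb s c : L2 (dual_comb s c).
Proof. by apply: L2_sum => // i; apply: L2Z => //; exact: L2J. Qed.

Lemma dual_combJ s c x :
  cj (dual_comb s c x) = \sum_(i <- s) cj (c i) * e i x.
Proof.
by rewrite /dual_comb conjc_sum; apply: eq_bigr => i _; rewrite conjcM conjcK.
Qed.

Lemma norm2_dual_comb_ge s c : uniq s ->
  delta * \sum_(i <- s) nsq (c i) <= norm2 D (dual_comb s c).
Proof.
move=> us; have := riesz (fun i => cj (c i)) us.
under eq_bigr do rewrite nsqJ.
rewrite (_ : norm2 D _ = norm2 D (dual_comb s c))//.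
by apply: eq_Rintegral => x _; rewrite -dual_combJ nsqJ.
Qed.

Lemma integral_dual_comb F s c : L2 F ->
  cintegral D (fun x => F x * cj (dual_comb s c x)) =
  \sum_(i <- s) cj (c i) * cintegral D (fun x => F x * e i x).
Proof.
move=> LF; under eq_cintegral => x _ do rewrite dual_combJ mulr_sumr.
rewrite cintegral_sum//; last first.
  by move=> i; apply: L2_mul => //; exact: L2Z.
apply: eq_bigr => i _; rewrite -cintegralZ//; last exact: L2_mul.
by apply: eq_cintegral => x _; rewrite mulrCA.
Qed.

(** A Gram-Schmidt step: to add the index [j], one needs a combination whose moments on [s] vanish
    and whose moment against [e j] does not. *)
Lemma finite_moment_problem (s : seq I) (b : I -> R[i]) : uniq s ->
  exists c, forall i, i \in s ->
    cintegral D (fun x => dual_comb s c x * e i x) = b i.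
Proof.
elim: s b => [|j s IH] b; first by exists (fun=> 0).
rewrite cons_uniq => /andP[js us].
have [c1 c1P] := IH b us.
have [c2 c2P] := IH (fun i => cintegral D (fun x => cj (e j x) * e i x)) us.
(* [h] is the component of the conjugate of [e j] that is orthogonal to the earlier ones. Its moment
   against [e j] is its own squared norm, at least [delta] by the Riesz bound because the
   coefficient of index [j] is 1. *)
pose h x := cj (e j x) - dual_comb s c2 x.
have Lh : L2 h by apply: L2B => //; [exact: L2J|exact: L2_dual_comb].
have hE : h = dual_comb (j :: s) (fun i => if i == j then 1 else - c2 i).
  apply/funext => x; rewrite /h /dual_comb big_cons eqxx mul1r; congr (_ + _).
  rewrite -sumrN; apply: eq_big_seq => i si.
  by rewrite ifN ?mulNr//; apply: contraNneq js => <-.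
have hs i : i \in s -> cintegral D (fun x => h x * e i x) = 0.
  move=> si; under eq_cintegral => x _ do rewrite mulrBl.
  rewrite cintegralB ?c2P ?subrr//.
  - by apply: L2_mul => //; exact: L2J.
  - by apply: L2_mul => //; exact: L2_dual_comb.
have hj : cintegral D (fun x => h x * e j x) = (norm2 D h)%:C.
  rewrite norm2E//.
  have E x : h x * e j x = h x * cj (h x) + h x * cj (dual_comb s c2 x).
    by rewrite -mulrDr -conjcD /h subrK conjcK.
  under eq_cintegral => x _ do rewrite E.
  rewrite cintegralD//; [|exact/L2_mul/L2J|exact/L2_mul/L2J/L2_dual_comb].
  rewrite integral_dual_comb// big_seq big1 ?addr0// => i si.
  by rewrite hs// mulr0.
have h0 : 0 < norm2 D h.
  apply: (@lt_le_trans _ _ delta) => //.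
  have us' : uniq (j :: s) by rewrite /= js.
  have := norm2_dual_comb_ge (fun i => if i == j then 1 else - c2 i) us'.
  rewrite -hE; apply: le_trans; apply: ler_peMr; first exact: ltW.
  rewrite big_cons eqxx.
  by rewrite {1}/nsq /= expr1n expr0n addr0 lerDl sumr_ge0// => i _; exact: nsq_ge0.
pose a := (b j - cintegral D (fun x => dual_comb s c1 x * e j x)) / (norm2 D h)%:C.
exists (fun i => if i == j then a else c1 i - a * c2 i) => i sij.
have E x : dual_comb (j :: s) (fun i => if i == j then a else c1 i - a * c2 i) x
   = dual_comb s c1 x + a * h x.
  rewrite hE /dual_comb !big_cons eqxx mul1r mulrDr addrCA; congr (_ + _).
  rewrite mulr_sumr -big_split/=; apply: eq_big_seq => k sk.
  have /negPf -> : k != j by apply: contraNneq js => <-.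
  by rewrite mulrBl mulNr mulrN mulrA.
under eq_cintegral => x _ do rewrite E mulrDl -mulrA.
have Ld := L2_dual_comb s c1.
rewrite cintegralD//; [|exact: L2_mul|exact/cintegrableZ/L2_mul].
rewrite cintegralZ//; last exact: L2_mul.
move: sij; rewrite inE => /predU1P[->|si]; last by rewrite c1P// hs// mulr0 addr0.
have n0 : (norm2 D h)%:C != 0 by rewrite eq_complex /= (gt_eqF h0).
by rewrite hj /a mulfVK// addrC subrK.
Qed.

Definition box (n : nat) : seq I := pmap pickle_inv (iota 0 n).

Lemma box_uniq n : uniq (box n).
Proof. by apply: pmap_uniq (iota_uniq _ _); exact: pickle_invK. Qed.

Lemma mem_box n i : (i \in box n) = (pickle i < n)%N.
Proof.
rewrite mem_pmap; apply/mapP/idP => [[k]|lt].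
  rewrite mem_iota /= add0n => kn /esym H.
  by have := @pickle_invK I k; rewrite /ocancel /oapp H => ->.
by exists (pickle i); rewrite ?mem_iota// pickleK_inv.
Qed.

(** The minimal solutions for growing finite sets of indices have nondecreasing bounded norms, and
    by Pythagoras their increments are controlled by the increments of the norms: they form a Cauchy
    sequence. *)
Theorem moment_problem (b : I -> R[i]) : square_summable b ->
  exists2 F, L2 F & forall i, cintegral D (fun x => F x * e i x) = b i.
Proof.
move=> [M bM].
have /choice[c cP] : forall n, exists c, forall i, i \in box n ->
    cintegral D (fun x => dual_comb (box n) c x * e i x) = b i.
  by move=> n; apply: finite_moment_problem; exact: box_uniq.
pose F n := dual_comb (box n) (c n).
have LF n : L2 (F n) by exact: L2_dual_comb.
have FE n : (norm2 D (F n))%:C = \sum_(i <- box n) cj (c n i) * b i.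
  rewrite norm2E// integral_dual_comb//.
  by apply: eq_big_seq => i si; rewrite cP.
(* With [N] the squared norm of [F n], Cauchy-Schwarz in [FE] and the Riesz bound give
   [N ^+ 2 <= (N / delta) * M]. *)
have Fle n : norm2 D (F n) <= M / delta.
  have [->|F0] := eqVneq (norm2 D (F n)) 0.
    by rewrite divr_ge0 ?(ltW delta0)//; have := bM [::] isT; rewrite big_nil.
  have {}F0 : 0 < norm2 D (F n) by rewrite lt_def F0 norm2_ge0.
  rewrite ler_pdivlMr// -(ler_pM2l F0).
  have H1 := norm2_dual_comb_ge (c n) (box_uniq n).
  have H2 := sum_CauchySchwarz (box n) xpredT (fun i => cj (c n i)) b.
  rewrite -FE nsqR in H2.
  have H3 := bM _ (box_uniq n).
  have S0 : 0 <= \sum_(i <- box n) nsq (c n i) by apply: sumr_ge0 => i _; exact: nsq_ge0.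
  have S0' : 0 <= \sum_(i <- box n) nsq (b i) by apply: sumr_ge0 => i _; exact: nsq_ge0.
  rewrite (eq_bigr (fun i => nsq (c n i))) in H2; last by move=> i _; rewrite nsqJ.
  rewrite mulrA -expr2; apply: (@le_trans _ _ (norm2 D (F n) * \sum_(i <- box n) nsq (b i))).
    apply: (@le_trans _ _ ((\sum_(i <- box n) nsq (c n i)) * (\sum_(i <- box n) nsq (b i)) * delta)).
      by rewrite ler_pM2r.
    by rewrite mulrAC ler_wpM2r// mulrC.
  by rewrite ler_wpM2l// ltW.
(* [F m] is a combination of conjugates of [e i] with [i] in [box m], and [F n - F m] has zero
   moments against these [e i]. *)
have Fdiff m n : (m <= n)%N ->
    norm2 D (F n) = norm2 D (F m) + norm2 D (fun x => F n x - F m x).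
  move=> mn.
  have L := L2B mD (LF n) (LF m).
  have -> : norm2 D (F n) = norm2 D (fun x => (F n x - F m x) + F m x).
    by apply: eq_norm2 => x _; rewrite subrK.
  rewrite norm2D// integral_dual_comb// big_seq big1 ?mulr0 ?addr0 1?addrC//.
  move=> i si.
  under eq_cintegral => x _ do rewrite mulrBl.
  rewrite cintegralB//; [|exact: L2_mul|exact: L2_mul].
  rewrite !cP ?subrr ?mulr0// mem_box.
  by move: si; rewrite mem_box => /leq_trans; apply.
have mono : {homo (fun n => norm2 D (F n)) : n m / (n <= m)%N >-> n <= m}.
  by move=> m n mn; rewrite (Fdiff _ _ mn) lerDl norm2_ge0.
have cv : cvgn (fun n => norm2 D (F n)).
  apply: nondecreasing_is_cvgn => //.
  by exists (M / delta) => _ [n _ <-].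
have [G [LG GP]] : exists G, L2 G /\ forall eps, 0 < eps -> exists N, forall n, (N <= n)%N ->
     norm2 D (fun x => F n x - G x) <= eps.
  apply: L2_complete => // eps eps0.
  move/cvgrPdist_le : cv => /(_ (eps / 2) (divr_gt0 eps0 (ltr0Sn R 1)))[N _ HN].
  exists N => m n Nm Nn.
  wlog mn : m n Nm Nn / (n <= m)%N => [W|].
    have [/W|nm] := leqP n m; first exact.
    rewrite (_ : norm2 D _ = norm2 D (fun x => F n x - F m x)); first by apply: W => //; exact: ltnW.
    by rewrite -norm2N; apply: eq_norm2 => x _; rewrite opprB.
  have := HN _ Nm; have := HN _ Nn; rewrite /= (Fdiff _ _ mn).
  rewrite !ler_norml => /andP[? ?] /andP[? ?]; lra.
exists G => // i; apply/eqP; rewrite -subr_eq0; apply/eqP; apply: nsq_eq0.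
apply/eqP; rewrite eq_le nsq_ge0 andbT; apply/ler_addgt0Pl => eps eps0; rewrite addr0.
have K0 : 0 < norm2 D (e i) + 1 by rewrite ltr_wpDl// norm2_ge0.
have [N HN] := GP _ (divr_gt0 eps0 K0).
pose n := maxn N (pickle i).+1.
have := HN n (leq_maxl _ _) => Hn.
rewrite -(cP n i); last by rewrite mem_box leq_max ltnSn orbT.
rewrite -nsqN opprB -cintegralB//; [|exact: (L2_mul mD (LF n) (Le i))|exact: L2_mul].
under eq_cintegral => x _ do rewrite -mulrBl.
have := @integral_CauchySchwarz _ _ mD _ _ (L2B mD (LF n) LG) (Le i).
move/le_trans; apply.
apply: (@le_trans _ _ (eps / (norm2 D (e i) + 1) * norm2 D (e i))).
  by rewrite ler_wpM2r ?norm2_ge0.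
by rewrite -mulrA ler_piMr ?(ltW eps0)// mulrC ler_pdivrMr// mul1r lerDl.
Qed.

End MomentProblem.

(** * Integrals of exponentials and of translates *)

Section TrigIntegrals.
Variable R : realType.
Local Notation mu := (@lebesgue_measure R).
Local Notation cj := (@conjc R).

Lemma Rintegral_FTC (F f : R -> R) (a b : R) : a <= b ->
  (forall t : R, is_derive t (1 : R) F (f t)) -> continuous f ->
  \int[mu]_(x in `[a, b]) f x = F b - F a.
Proof.
move=> ab dF cf.
have cF : continuous F by move=> t; apply: differentiable_continuous; apply/derivable1_diffP.
move: ab; rewrite le_eqVlt => /predU1P[->|ab].
  by rewrite subrr set_itv1 Rintegral_set1.
rewrite /Rintegral (@continuous_FTC2 _ f F)//.
- exact: continuous_subspaceT.
- split => //; first exact/cvg_at_right_filter/cF.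
  exact/cvg_at_left_filter/cF.
- by move=> t _; rewrite derive1E derive_val.
Qed.

Lemma is_derive_mulr (x t : R) : is_derive t (1 : R) (fun t => x * t : R) x.
Proof.
have := @is_deriveZ _ _ _ (@id R) x t (1 : R) (1 : R) (is_derive_id _ _).
by rewrite /GRing.scale /= mulr1.
Qed.

Lemma is_derive_sinM (x t : R) : is_derive t 1 (fun t => sin (x * t)) (x * cos (x * t)).
Proof.
have d1 : is_derive t 1 (fun t => x * t : R) x.
  exact: is_derive_mulr.
by have := @is_derive1_comp _ sin (fun t => x * t) t _ _ (is_derive_sin _) d1; rewrite mulrC.
Qed.

Lemma is_derive_cosM (x t : R) : is_derive t 1 (fun t => cos (x * t)) (- (x * sin (x * t))).
Proof.
have d1 : is_derive t 1 (fun t => x * t : R) x.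
  exact: is_derive_mulr.
by have := @is_derive1_comp _ cos (fun t => x * t) t _ _ (is_derive_cos _) d1; rewrite mulNr mulrC.
Qed.

Lemma continuous_cosM (x : R) : continuous (fun t => cos (x * t)).
Proof. by move=> t; apply: continuous_comp; [exact: mulrl_continuous|exact: continuous_cos]. Qed.

Lemma continuous_bigsum (I : Type) (s : seq I) (F : I -> R -> R) :
  (forall i, continuous (F i)) -> continuous (fun t => \sum_(i <- s) F i t).
Proof.
move=> cF; elim: s => [|i s IH] t.
  rewrite (_ : (fun t => _) = (fun=> 0)); first exact: cvg_cst.
  by apply/funext => x; rewrite big_nil.
rewrite (_ : (fun t => _) = (fun t => F i t + \sum_(j <- s) F j t)).
  by apply: cvgD; [exact: cF|exact: IH].
by apply/funext => x; rewrite big_cons.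
Qed.

Lemma continuous_sinM (x : R) : continuous (fun t => sin (x * t)).
Proof. by move=> t; apply: continuous_comp; [exact: mulrl_continuous|exact: continuous_sin]. Qed.

Lemma integral_cosM (x a b : R) : x != 0 -> a <= b ->
  \int[mu]_(t in `[a, b]) cos (x * t) = (sin (x * b) - sin (x * a)) / x.
Proof.
move=> x0 ab.
have dF (t : R) : is_derive t (1 : R) (fun t => x^-1 * sin (x * t)) (cos (x * t)).
  have := @is_deriveZ _ _ _ (fun t => sin (x * t)) x^-1 t (1 : R) _ (is_derive_sinM x t).
  by rewrite /GRing.scale /= mulKf.
by rewrite (Rintegral_FTC ab dF)//; [rewrite -mulrBr mulrC|exact: continuous_cosM].
Qed.

Lemma integral_sinM (x a b : R) : x != 0 -> a <= b ->
  \int[mu]_(t in `[a, b]) sin (x * t) = (cos (x * a) - cos (x * b)) / x.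
Proof.
move=> x0 ab.
have dF (t : R) : is_derive t (1 : R) (fun t => (- x^-1) * cos (x * t)) (sin (x * t)).
  have := @is_deriveZ _ _ _ (fun t => cos (x * t)) (- x^-1) t (1 : R) _ (is_derive_cosM x t).
  by rewrite /GRing.scale /= mulrN mulNr opprK mulKf.
rewrite (Rintegral_FTC ab dF)//; last exact: continuous_sinM.
by rewrite -mulrBr mulNr -mulrN opprB mulrC.
Qed.

Lemma nsq_cintegral_expi (x T : R) : x != 0 -> 0 <= T ->
  nsq (cintegral `[0, T] (fun t => expi (x * t))) <= 4 / x ^+ 2.
Proof.
move=> x0 T0; rewrite /cintegral /nsq /= integral_cosM// integral_sinM//.
rewrite mulr0 sin0 cos0 subr0 !exprMn -mulrDl exprVn ler_wpM2r ?invr_ge0 ?sqr_ge0//.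
have := cos2Dsin2 (x * T); have := cos_geN1 (x * T); nra.
Qed.

Lemma cintegral_one (a b : R) : a <= b -> cintegral `[a, b] (fun=> 1) = (b - a)%:C.
Proof.
move=> ab; rewrite /cintegral /= !Rintegral_cst// mul1r mul0r.
rewrite -[RHS]/((fine (b - a)%:E)%:C); congr (fine _ +i* _).
apply: etrans (lebesgue_measure_itv _) _; rewrite /= lte_fin; move: ab.
by rewrite le_eqVlt => /predU1P[->|->]; rewrite ?ltxx ?subrr.
Qed.

Lemma cmeasurable_expi (D : set R) (x y : R) : cmeasurable D (fun t => expi (x * t + y)).
Proof.
split; apply: measurable_funS (@subsetT _ _) _ => //; apply: continuous_measurable_fun => t /=.
  apply: continuous_comp; last exact: continuous_cos.
  by apply: cvgD; [exact: mulrl_continuous|exact: cvg_cst].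
apply: continuous_comp; last exact: continuous_sin.
by apply: cvgD; [exact: mulrl_continuous|exact: cvg_cst].
Qed.

Lemma rint_cst (D : set R) (k : R) : measurable (D : set (measurableTypeR R)) ->
  (mu D < +oo)%E -> mu.-integrable D (EFin \o (fun=> k)).
Proof.
move=> mD fD; apply/integrableP; split; first exact/measurable_EFinP.
by rewrite integral_cst// lte_mul_pinfty.
Qed.

Lemma L2_cst (D : set R) (a : R[i]) : measurable (D : set (measurableTypeR R)) ->
  (mu D < +oo)%E -> square_integrable D (fun=> a).
Proof.
move=> mD fD; apply/square_integrableP => //; split; first exact: cmeasurable_cst.
exact: rint_cst.
Qed.

Lemma L2_expi (D : set R) (x y : R) : measurable (D : set (measurableTypeR R)) ->
  (mu D < +oo)%E -> square_integrable D (fun t => expi (x * t + y)).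
Proof.
move=> mD fD; apply/square_integrableP => //; split; first exact: cmeasurable_expi.
apply: (@eq_rint _ _ mD (fun=> 1)); last exact: rint_cst.
by move=> t _; rewrite nsq_expi.
Qed.

Lemma L2_expiM (D : set R) (x : R) : measurable (D : set (measurableTypeR R)) ->
  (mu D < +oo)%E -> square_integrable D (fun t => expi (x * t)).
Proof.
by move=> mD fD; have := L2_expi x 0 mD fD; apply: eq_L2 => // t _; rewrite addr0.
Qed.

Lemma itv_finite (a b : R) : (mu `[a, b] < +oo)%E.
Proof. by rewrite lebesgue_measure_itv /= lte_fin; case: ifP => _; rewrite ltry. Qed.

Lemma Rintegral_shift (f : R -> R) (h T : R) : 0 <= T -> continuous f ->
  \int[mu]_(t in `[0, T]) f (t + h) = \int[mu]_(t in `[h, T + h]) f t.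
Proof.
move=> T0 cf.
have cf' t : {for t, continuous f} by exact: cf.
(* Starting the primitive at [h - 1] makes it differentiable at [h] as well, where the domain of
   integration begins. *)
pose F x := \int[mu]_(t in `[h - 1, x]) f t.
have dF x : h - 1 < x -> is_derive x 1 F (f x).
  move=> hx; have [||||d1 d2] := @continuous_FTC1 _ f (BLeft (h - 1)) x (x + 1).
  - by rewrite ltrDl.
  - apply: continuous_compact_integrable; first exact: segment_compact.
    exact: continuous_subspaceT.
  - by rewrite /= lte_fin.
  - exact: cf.
  by apply: DeriveDef; [exact: d1|rewrite -derive1E; exact: d2].
move: T0; rewrite le_eqVlt => /predU1P[<-|T0].
  by rewrite add0r !set_itv1 !Rintegral_set1.
have I x y : h <= x -> x <= y -> \int[mu]_(t in `[x, y]) f t = F y - F x.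
  move=> hx xy; rewrite /F.
  rewrite (@Rintegral_itvB _ f (BLeft (h - 1)) (BRight y) x) ?bnd_simp//; last first.
  - by rewrite (le_trans _ hx)// gerBl.
  - apply: continuous_compact_integrable; first exact: segment_compact.
    exact: continuous_subspaceT.
  rewrite Rintegral_itv_obnd_cbnd//.
  apply: (@integrableS _ _ _ mu `[x, y]%classic `]x, y]%classic) => //.
    by apply: subset_itvr; rewrite bnd_simp.
  apply: continuous_compact_integrable; first exact: segment_compact.
  exact: continuous_subspaceT.
rewrite I ?lexx ?lerDr ?(ltW T0)//.
have cs t : {for t, continuous (fun t => f (t + h))}.
  apply: continuous_comp; last exact: cf.
  by apply: cvgD; [exact: cvg_id|exact: cvg_cst].
have dG (t : R) : 0 <= t -> is_derive t (1 : R) (fun t => F (t + h)) (f (t + h)).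
  move=> t0.
  have d1 : is_derive t (1 : R) (fun t => t + h) 1.
    by apply: is_derive_eq; rewrite addr0.
  have d2 : is_derive (t + h) 1 F (f (t + h)) by apply: dF; lra.
  by have := @is_derive1_comp _ F (fun t => t + h) t _ _ d2 d1; rewrite mulr1.
have cG (t : R) : 0 <= t -> {for t, continuous (fun t => F (t + h))}.
  move=> t0; have := dG _ t0 => d.
  by apply: differentiable_continuous; apply/derivable1_diffP.
rewrite /Rintegral (@continuous_FTC2 _ _ (fun t => F (t + h)))//.
- by rewrite add0r.
- by apply: continuous_subspaceT => t; exact: cs.
- split => [t| |].
  + by rewrite in_itv /= => /andP[/ltW t0 _]; have := dG _ t0 => d.
  + by apply: cvg_at_right_filter; apply: cG.
  + by apply: cvg_at_left_filter; apply: cG; exact: ltW.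
- move=> t; rewrite in_itv /= => /andP[/ltW t0 _].
  by have := dG _ t0 => d; rewrite derive1E derive_val.
Qed.

End TrigIntegrals.

(** * Ingham's inequality *)

Section Ingham.
Variable R : realType.
Local Notation mu := (@lebesgue_measure R).
Local Notation cj := (@conjc R).

Lemma sin_le_id (x : R) : 0 <= x -> sin x <= x.
Proof.
move=> x0.
have dF (t : R) : is_derive t (1 : R) (fun t => sin (1 * t)) (1 * cos (1 * t)) by exact: is_derive_sinM.
have cf : continuous (fun t : R => 1 * cos (1 * t)).
  by move=> t; apply: cvgM; [exact: cvg_cst|exact: continuous_cosM].
have := @Rintegral_FTC _ _ _ 0 x x0 dF cf.
rewrite !mul1r sin0 subr0 => <-.
have := @cintegral_one R 0 x x0; rewrite subr0 /cintegral /= => -[E _].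
rewrite -[leRHS]E; apply: le_Rintegral => //.
- apply: continuous_compact_integrable; first exact: segment_compact.
  exact: continuous_subspaceT.
- by apply: rint_cst => //; exact: itv_finite.
Qed.

(* [1 - sin y / y] stays away from 0 when [y] does: for [y <= 2] because
   [sin y = 2 sin (y/2) cos (y/2) <= y cos (y/2)]. *)
Lemma sinc_gap (y0 : R) : 0 < y0 -> exists2 eta, 0 < eta &
  forall y, y0 <= `|y| -> sin y / y <= 1 - eta.
Proof.
move=> y00; pose z := Num.min y0 2 / 2.
have z0 : 0 < z by rewrite divr_gt0// lt_min y00 ltr0n.
have z1 : z <= 1 by rewrite ler_pdivrMr// mul1r ge_min lexx orbT.
have pi2 : 2 <= (pi : R) by exact: pi_ge2.
have cz : cos z < 1.
  rewrite -[z](_ : z / 2 + z / 2 = z); last by field.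
  rewrite cosD -!expr2 cos2sin2.
  have : 0 < sin (z / 2) by apply: sin_gt0_pi; apply/andP; split; [rewrite divr_gt0|clearbody z; lra].
  nra.
(* [1 / 2] serves [y >= 2], where [sin y / y <= 1 / y]; [1 - cos z] serves [y < 2], where
   [z <= y / 2] and the cosine decreases. *)
exists (Num.min (1 / 2) (1 - cos z)).
  by rewrite lt_min divr_gt0//= subr_gt0.
suff H y : 0 < y -> y0 <= y -> sin y / y <= 1 - Num.min (1 / 2) (1 - cos z).
  move=> y; have [y_ge0|y_lt0] := leP 0 y.
    rewrite ger0_norm// => yy; apply: H => //; exact: lt_le_trans yy.
  rewrite ltr0_norm// => yy; have := H (- y).
  rewrite sinN invrN mulrNN; apply => //; by rewrite oppr_gt0.
move=> y_gt0 yy; rewrite lerBrDr -lerBrDl ge_min.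
have [y2|y2] := leP 2 y.
  apply/orP; left; rewrite lerBrDl -lerBrDr ler_pdivrMr//.
  have := sin_le1 y; lra.
apply/orP; right.
rewrite lerBrDl -lerBrDr opprB addrCA subrr addr0 ler_pdivrMr//.
have -> : sin y = 2 * sin (y / 2) * cos (y / 2).
  by rewrite -[in LHS](_ : y / 2 + y / 2 = y) ?sinD; [ring|field].
have s1 : sin (y / 2) <= y / 2 by apply: sin_le_id; rewrite divr_ge0// ltW.
have zy : z <= y / 2 by rewrite ler_wpM2r// ge_min yy.
have c0 : cos (y / 2) <= cos z.
  have [->//|ne] := eqVneq z (y / 2).
  by apply: ltW; rewrite ltr_cos ?in_itv /=; [rewrite lt_neqAle ne zy|clearbody z; apply/andP; split; lra|clearbody z; apply/andP; split; lra].
have c1 : 0 <= cos (y / 2) by apply: cos_ge0_pihalf; apply/andP; split; clearbody z; lra.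
nra.
Qed.

Variables (I : countType) (lam : I -> R).

Definition trig_sum (s : seq I) (c : I -> R[i]) (t : R) : R[i] :=
  \sum_(i <- s) c i * expi (lam i * t).

(** The integral of [expi (x * t)] over [[0, T]] has squared modulus at most [4 / x ^+ 2] whatever
    [T]. Hence [4 * gap_sum s] bounds the squared Hilbert-Schmidt norm of the off-diagonal Gram
    matrix, uniformly in the length of the interval. *)
Definition gap_sum (s : seq I) : R :=
  \sum_(i <- s) \sum_(j <- s | i != j) (lam i - lam j) ^- 2.

Local Notation D T := (`[0, T]%classic : set R).
Local Notation mD := (measurable_itv _).

Lemma L2_trig_sum (T : R) s c : square_integrable (D T) (trig_sum s c).
Proof.
by apply: L2_sum => // i; apply: L2Z => //; apply: L2_expiM => //; exact: itv_finite.
Qed.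

Lemma norm2_trig_sum (T : R) s c : 0 <= T ->
  (norm2 (D T) (trig_sum s c))%:C = \sum_(i <- s) \sum_(j <- s)
    c i * cj (c j) * cintegral (D T) (fun t => expi ((lam i - lam j) * t)).
Proof.
move=> T0; have Le x : square_integrable (D T) (fun t => expi (x * t)).
  by apply: L2_expiM => //; exact: itv_finite.
rewrite norm2E; [|by []|exact: L2_trig_sum].
have E t : trig_sum s c t * cj (trig_sum s c t) = \sum_(i <- s) \sum_(j <- s)
    c i * cj (c j) * expi ((lam i - lam j) * t).
  rewrite /trig_sum conjc_sum mulr_suml; apply: eq_bigr => i _.
  rewrite mulr_sumr; apply: eq_bigr => j _.
  by rewrite conjcM expiJ mulrBl expiD; ring.
have I1 x : cintegrable (D T) (fun t => expi (x * t)).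
  have := L2_mul mD (Le x) (L2_cst 1 mD (itv_finite 0 T)).
  by apply: eq_cintegrable => // t _; rewrite mulr1.
under eq_cintegral => t _ do rewrite E.
rewrite cintegral_sum//; last first.
  by move=> i; apply: cintegrable_sum => // j; exact: cintegrableZ.
apply: eq_bigr => i _; rewrite cintegral_sum//; last first.
  by move=> j; exact: cintegrableZ.
by apply: eq_bigr => j _; rewrite cintegralZ.
Qed.

Hypothesis lam_inj : injective lam.

(* Off-diagonal terms of the Gram matrix, estimated in the Hilbert-Schmidt norm. *)
Lemma norm2_trig_sum_approx (T : R) s c : 0 <= T -> uniq s ->
  (norm2 (D T) (trig_sum s c) - T * \sum_(i <- s) nsq (c i)) ^+ 2 <=
  (\sum_(i <- s) nsq (c i)) ^+ 2 * (4 * gap_sum s).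
Proof.
move=> T0 us.
pose w i j := cintegral (D T) (fun t => expi ((lam i - lam j) * t)).
have E : (norm2 (D T) (trig_sum s c) - T * \sum_(i <- s) nsq (c i))%:C =
    \sum_(p <- [seq (i, j) | i <- s, j <- s] | p.1 != p.2)
      (c p.1 * cj (c p.2)) * w p.1 p.2.
  rewrite rmorphB /= norm2_trig_sum// [in RHS]big_mkcond [in RHS]big_allpairs /=.
  apply/eqP; rewrite subr_eq; apply/eqP.
  rewrite rmorphM /= rmorph_sum /= mulr_sumr -big_split /=.
  apply: eq_big_seq => i si; rewrite (bigD1_seq i)//= -big_mkcond /= [RHS]addrC.
  congr (_ + _).
    rewrite mulcJ mulrC; congr (_ * _).
    rewrite -[in RHS](subr0 T) -cintegral_one//; apply: eq_cintegral => t _.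
    by rewrite subrr mul0r expi0.
  by apply: eq_bigl => j; rewrite eq_sym.
rewrite -nsqR E; apply: le_trans (sum_CauchySchwarz _ _ _ _) _.
rewrite expr2; apply: ler_pM.
- by apply: sumr_ge0 => p _; exact: nsq_ge0.
- by apply: sumr_ge0 => p _; exact: nsq_ge0.
- rewrite big_mkcond big_allpairs /= mulr_suml; apply: ler_sum => i _.
  rewrite mulr_sumr; apply: ler_sum => j _.
  by case: ifP => _; rewrite ?nsqM ?nsqJ// mulr_ge0 ?nsq_ge0.
- rewrite big_mkcond big_allpairs /= mulr_sumr; apply: ler_sum => i _.
  rewrite mulr_sumr [leRHS]big_mkcond; apply: ler_sum => j _.
  case: ifP => // ij; apply: nsq_cintegral_expi => //.
  by rewrite subr_eq0; apply: contra_neq ij => /lam_inj.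
Qed.

Variable K : R.
Hypothesis gap_sumK : forall s, uniq s -> gap_sum s <= K.

Let K0 : 0 <= K.
Proof. by have := gap_sumK (isT : uniq [::]); rewrite /gap_sum big_nil. Qed.

(** [4 * K <= (1 + K) ^+ 2] spares a square root in the constant. *)
Lemma norm2_trig_sum_le (T : R) s c : 0 <= T -> uniq s ->
  norm2 (D T) (trig_sum s c) <= (T + (1 + K)) * \sum_(i <- s) nsq (c i).
Proof.
move=> T0 us; have := norm2_trig_sum_approx c T0 us.
set N := norm2 _ _; set S := \sum_(i <- s) _ => H.
have S0 : 0 <= S by apply: sumr_ge0 => i _; exact: nsq_ge0.
have {H}: (N - T * S) ^+ 2 <= ((1 + K) * S) ^+ 2.
  apply: (le_trans H); rewrite exprMn mulrC ler_wpM2r ?sqr_ge0//.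
  have := gap_sumK us; have := sqr_ge0 (1 - K); nra.
have KS : 0 <= (1 + K) * S by rewrite mulr_ge0// addr_ge0.
move=> H; rewrite mulrDl -lerBlDl leNgt; apply/negP => H'.
by move: H; rewrite leNgt => /negP; apply; nra.
Qed.

(** The lower Riesz bound for the frequencies selected by [P]; the predicate lets finitely many of
    them be set aside and put back. *)
Definition ingham (P : pred I) (T : R) := exists2 delta : R, 0 < delta &
  forall s c, uniq s -> all P s ->
    delta * \sum_(i <- s) nsq (c i) <= norm2 (D T) (trig_sum s c).

(** [gap_sum] is superadditive on disjoint lists. If [s0] nearly attains the supremum, then any list
    disjoint from it has a small [gap_sum], and the diagonal [T] dominates. *)
Lemma ingham_tail (T : R) : 0 < T -> exists s0 : seq I, ingham (fun i => i \notin s0) T.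
Proof.
move=> T0; pose E := [set gap_sum s | s in [set s | uniq s]].
have supE : has_sup E.
  split; first by exists (gap_sum [::]), [::].
  by exists K => _ [s us <-]; exact: gap_sumK.
(* [4 * (T ^+ 2 / 16) = (T / 2) ^+ 2]: the off-diagonal part takes at most half of the diagonal
   [T]. *)
have eps0 : 0 < T ^+ 2 / 16 by rewrite divr_gt0// exprn_gt0.
have [_ [s0 us0 <-] Hs0] := sup_adherent eps0 supE.
exists s0; exists (T / 2) => [|s c us ss0]; first by rewrite divr_gt0.
have uss : uniq (s0 ++ s).
  by rewrite cat_uniq us0 us andbT/= -all_predC.
have gs : gap_sum s <= T ^+ 2 / 16.
  have H : gap_sum (s0 ++ s) <= sup E.
    by apply: ub_le_sup; [exact: (proj2 supE)|exists (s0 ++ s)].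
  have : gap_sum s0 + gap_sum s <= gap_sum (s0 ++ s).
    rewrite /gap_sum big_cat /=; apply: lerD; apply: ler_sum => i _; rewrite big_cat /=.
      by rewrite lerDl sumr_ge0// => j _; rewrite invr_ge0 sqr_ge0.
    by rewrite lerDr sumr_ge0// => j _; rewrite invr_ge0 sqr_ge0.
  lra.
have := norm2_trig_sum_approx c (ltW T0) us.
set N := norm2 _ _; set S := \sum_(i <- s) _ => H.
have S0 : 0 <= S by apply: sumr_ge0 => i _; exact: nsq_ge0.
have {H}: (N - T * S) ^+ 2 <= (T / 2 * S) ^+ 2.
  apply: (le_trans H); rewrite exprMn mulrC ler_wpM2r ?sqr_ge0//.
  by rewrite expr_div_n; lra.
have TS : 0 <= T / 2 * S by rewrite mulr_ge0// divr_ge0// ltW.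
move=> H; rewrite leNgt; apply/negP => H'.
by move: H; rewrite leNgt => /negP; apply; nra.
Qed.

(** A single pair already gives [(lam i - lam j) ^- 2 <= K <= (1 + K) ^+ 2]. *)
Lemma frequency_gap : exists2 gamma : R, 0 < gamma &
  forall i j, i != j -> gamma <= `|lam i - lam j|.
Proof.
have L0 : 0 < 1 + K by rewrite ltr_wpDr.
exists (1 + K)^-1; first by rewrite invr_gt0.
move=> i j ij.
have x0 : lam i - lam j != 0 by rewrite subr_eq0; apply: contra_neq ij => /lam_inj.
have n0 : 0 < `|lam i - lam j| by rewrite normr_gt0.
have H : (lam i - lam j) ^- 2 <= K.
  have us : uniq [:: i; j] by rewrite /= inE ij.
  apply: le_trans (gap_sumK us).
  rewrite /gap_sum !big_cons !big_nil !eqxx ij eq_sym ij /= !addr0 lerDl.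
  by rewrite invr_ge0 sqr_ge0.
rewrite -ler_pV2 ?inE ?unitfE ?invr_eq0 ?gt_eqF// ?invr_gt0// ?n0// invrK.
rewrite -real_normK ?num_real// -exprVn in H.
set u := _^-1 in H *; have u0 : 0 <= u by rewrite invr_ge0 ltW.
by nra.
Qed.

(** Haraux's argument. For [f] a sum on [[0, T]] and [0 <= h <= tau], the function
    [f (t + h) - expi (lam j * h) * f t] on [[0, T']] no longer contains the frequency [lam j], and
    its norm is controlled by that of [f]. Averaging over [h] keeps all other coefficients uniformly
    away from 0, by the gap between the frequencies. *)
Lemma ingham_add (P : pred I) (j : I) (T' T : R) : 0 < T' -> T' < T ->
  ingham (fun i => P i && (i != j)) T' -> ingham P T.
Proof.
move=> T'0 T'T [d d0 Hd]; pose tau := T - T'.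
have tau0 : 0 < tau by rewrite subr_gt0.
have T0 : 0 < T by exact: lt_trans T'T.
have [gam gam0 Hgam] := frequency_gap.
have [eta eta0 Heta] := sinc_gap (mulr_gt0 gam0 tau0).
(* The integral is [2 * tau * (1 - sin y / y)] with [y = x * tau], and [|y| >= gam * tau] is what
   [sinc_gap] requires. *)
have avg (x : R) : gam <= `|x| ->
    2 * tau * eta <= \int[mu]_(h in `[0, tau]) (2 - 2 * cos (x * h)).
  move=> gx.
  have x0 : x != 0 by rewrite -normr_gt0; exact: lt_le_trans gx.
  rewrite RintegralB//; first last.
  - apply: rintZ => //; apply: continuous_compact_integrable; first exact: segment_compact.
    by apply: continuous_subspaceT; exact: continuous_cosM.
  - by apply: rint_cst => //; exact: itv_finite.
  rewrite RintegralZl//; last first.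
    apply: continuous_compact_integrable; first exact: segment_compact.
    by apply: continuous_subspaceT; exact: continuous_cosM.
  rewrite integral_cosM ?(ltW tau0)// mulr0 sin0 subr0.
  have -> : \int[mu]_(h in `[0, tau]) 2 = 2 * tau.
    have [E _] := @cintegral_one R 0 tau (ltW tau0).
    rewrite -[2 in LHS]mulr1 RintegralZl//; first by rewrite E subr0.
    by apply: rint_cst => //; exact: itv_finite.
  have := Heta (x * tau); rewrite normrM (gtr0_norm tau0).
  move=> /(_ (ler_wpM2r (ltW tau0) gx)).
  have -> : sin (x * tau) / (x * tau) = sin (x * tau) / x / tau.
    by rewrite invfM mulrA.
  rewrite ler_pdivrMr// => H; rewrite -mulrBr -mulrA ler_pM2l//.
  by lra.
have main s c : uniq s -> all P s ->
    d * (2 * tau * eta) * \sum_(i <- s | i != j) nsq (c i) <=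
    4 * tau * norm2 (D T) (trig_sum s c).
  move=> us Ps; pose s' := [seq i <- s | i != j].
  have us' : uniq s' by exact: filter_uniq.
  have Ps' : all (fun i => P i && (i != j)) s'.
    apply/allP => i; rewrite mem_filter => /andP[-> si].
    by rewrite (allP Ps).
  pose f := trig_sum s c.
  have cf : continuous (fun t => nsq (f t)).
    have cRe : continuous (fun t => complex.Re (f t)).
      rewrite (_ : (fun t => _) = (fun t => \sum_(i <- s)
         (complex.Re (c i) * cos (lam i * t) - complex.Im (c i) * sin (lam i * t)))).
        apply: continuous_bigsum => i t; apply: cvgB; apply: cvgM;
        [exact: cvg_cst|exact: continuous_cosM|exact: cvg_cst|exact: continuous_sinM].
      by apply/funext => t; rewrite /f /trig_sum Re_sum; apply: eq_bigr => i _; rewrite cReM.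
    have cIm : continuous (fun t => complex.Im (f t)).
      rewrite (_ : (fun t => _) = (fun t => \sum_(i <- s)
         (complex.Re (c i) * sin (lam i * t) + complex.Im (c i) * cos (lam i * t)))).
        apply: continuous_bigsum => i t; apply: cvgD; apply: cvgM;
        [exact: cvg_cst|exact: continuous_sinM|exact: cvg_cst|exact: continuous_cosM].
      by apply/funext => t; rewrite /f /trig_sum Im_sum; apply: eq_bigr => i _; rewrite cImM.
    rewrite /nsq (_ : (fun t => _) = (fun t => complex.Re (f t) * complex.Re (f t) +
        complex.Im (f t) * complex.Im (f t))); last by apply/funext => t; rewrite !expr2.
    by move=> t; apply: cvgD; apply: cvgM; (exact: cRe || exact: cIm).
  have ci a b : mu.-integrable `[a, b] (EFin \o (fun t => nsq (f t))).
    apply: continuous_compact_integrable; first exact: segment_compact.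
    exact: continuous_subspaceT.
  have nle a b : 0 <= a -> b <= T -> norm2 `[a, b] f <= norm2 (D T) f.
    move=> a0 bT; apply: norm2_subset => //; last exact: L2_trig_sum.
    by apply: subset_itv; rewrite bnd_simp.
  (* [2 - 2 * cos ((lam i - lam j) * h)] is the squared modulus of
     [expi (lam i * h) - expi (lam j * h)], the factor that the coefficient [c i] acquires. *)
  have ptw h : h \in `[0, tau] ->
      d * \sum_(i <- s | i != j) nsq (c i) * (2 - 2 * cos ((lam i - lam j) * h)) <=
      4 * norm2 (D T) f.
    rewrite in_itv /= => /andP[h0 htau].
    pose c' i := c i * (expi (lam i * h) - expi (lam j * h)).
    have := Hd s' c' us' Ps'.
    have -> : \sum_(i <- s') nsq (c' i) =
        \sum_(i <- s | i != j) nsq (c i) * (2 - 2 * cos ((lam i - lam j) * h)).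
      rewrite big_filter; apply: eq_bigr => i _; rewrite nsqM; congr (_ * _).
      rewrite mulrBl cosB /nsq !cE /= /expi /=.
      have := cos2Dsin2 (lam i * h); have := cos2Dsin2 (lam j * h); nra.
    move=> /le_trans; apply.
    have gE t : trig_sum s' c' t = f (t + h) - expi (lam j * h) * f t.
      rewrite /trig_sum big_filter big_mkcond /f /trig_sum mulr_sumr -sumrB.
      apply: eq_bigr => i _; rewrite (mulrDr (lam i)) expiD /c'.
      by case: eqP => [->|_] /=; ring.
    have Lf : square_integrable (D T') f by exact: L2_trig_sum.
    have Lfh : square_integrable (D T') (fun t => f (t + h)).
      have := L2_trig_sum T' s (fun i => c i * expi (lam i * h)).
      apply: eq_L2 => // t _; apply: eq_bigr => i _.
      by rewrite mulrDr expiD; ring.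
    rewrite (@eq_norm2 _ _ _ (fun t => f (t + h) - expi (lam j * h) * f t))//.
    have Lf2 : square_integrable (D T') (fun t => expi (lam j * h) * f t) by exact: L2Z.
    apply: le_trans (norm2B_le _ Lfh Lf2) _ => //.
    rewrite norm2Z// nsq_expi mul1r.
    have -> : norm2 (D T') (fun t => f (t + h)) = norm2 `[h, T' + h] f.
      by rewrite /norm2 (@Rintegral_shift _ (fun t => nsq (f t)))// ltW.
    have N1 : norm2 `[h, T' + h] f <= norm2 (D T) f.
      by apply: nle => //; move: htau; rewrite /tau; lra.
    have N2 : norm2 (D T') f <= norm2 (D T) f by apply: nle => //; exact: ltW.
    lra.
  have icos x : mu.-integrable `[0, tau] (EFin \o (fun h => 2 - 2 * cos (x * h))).
    apply: rintB => //; first by apply: rint_cst => //; exact: itv_finite.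
    apply: rintZ => //; apply: continuous_compact_integrable; first exact: segment_compact.
    by apply: continuous_subspaceT; exact: continuous_cosM.
  have isum : forall l : seq I, mu.-integrable `[0, tau] (EFin \o (fun h =>
      \sum_(i <- l | i != j) nsq (c i) * (2 - 2 * cos ((lam i - lam j) * h)))) /\
      \int[mu]_(h in `[0, tau]) (\sum_(i <- l | i != j)
         nsq (c i) * (2 - 2 * cos ((lam i - lam j) * h))) =
      \sum_(i <- l | i != j) nsq (c i) *
        \int[mu]_(h in `[0, tau]) (2 - 2 * cos ((lam i - lam j) * h)).
    elim=> [|i l [IH1 IH2]].
      split; first by apply: eq_rint (integrable0 _ _) => // h _; rewrite big_nil.
      rewrite big_nil (@eq_Rintegral _ _ _ _ _ (fun=> 0)) ?Rintegral_cst ?mul0r//.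
      by move=> h _; rewrite big_nil.
    have [ij|ij] := eqVneq i j.
      split; first by apply: eq_rint IH1 => // h _; rewrite big_cons ij eqxx.
      rewrite big_cons ij eqxx/= -IH2; apply: eq_Rintegral => h _.
      by rewrite big_cons eqxx.
    have i1 := rintZ mD (nsq (c i)) (icos (lam i - lam j)).
    split; first by apply: eq_rint (rintD mD i1 IH1) => // h _; rewrite big_cons ij.
    rewrite big_cons ij -IH2 -RintegralZl// -RintegralD//.
    by apply: eq_Rintegral => h _; rewrite big_cons ij.
  have [I1 I2] := isum s.
  have : \int[mu]_(h in `[0, tau]) (d * (\sum_(i <- s | i != j)
         nsq (c i) * (2 - 2 * cos ((lam i - lam j) * h)))) <=
      \int[mu]_(h in `[0, tau]) (4 * norm2 (D T) f).
    apply: le_Rintegral => //; first exact: rintZ.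
      by apply: rint_cst => //; exact: itv_finite.
  rewrite RintegralZl// I2.
  have -> : \int[mu]_(h in `[0, tau]) (4 * norm2 (D T) f) = 4 * tau * norm2 (D T) f.
    have [E _] := @cintegral_one R 0 tau (ltW tau0).
    rewrite -[4 * norm2 _ _]mulr1 RintegralZl//; first by rewrite E subr0; ring.
    by apply: rint_cst => //; exact: itv_finite.
  apply: le_trans; rewrite -mulrA ler_pM2l// mulr_sumr; apply: ler_sum => i ij.
  by rewrite mulrC ler_wpM2l ?nsq_ge0// avg// Hgam.
pose A := 4 * tau / (d * (2 * tau * eta)).
have dte : 0 < d * (2 * tau * eta) by rewrite !mulr_gt0.
have A0 : 0 <= A by rewrite divr_ge0// ?mulr_ge0 ?ltW.
pose B := T + (1 + K).
have B0 : 0 <= B by rewrite !addr_ge0// ltW.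
(* [A * N] bounds the other coefficients. The term of index [j] is [f] minus the rest, so
   [T * nsq (c j) <= 2 * N + 2 * B * (A * N)], where [B] is the constant of [norm2_trig_sum_le]. *)
pose C := A + (2 + 2 * B * A) / T.
have C0 : 0 < C.
  apply: ltr_wpDl => //; rewrite divr_gt0// ltr_wpDr// mulr_ge0// mulr_ge0//.
exists C^-1 => [|s c us Ps]; first by rewrite invr_gt0.
set N := norm2 _ _; rewrite mulrC ler_pdivrMr// mulrC.
have N0 : 0 <= N by exact: norm2_ge0.
have HA : \sum_(i <- s | i != j) nsq (c i) <= A * N.
  have := main s c us Ps; rewrite -/N mulrC -ler_pdivlMr// => /le_trans; apply.
  by rewrite /A mulrAC.
have [sj|sj] := boolP (j \in s); last first.
  rewrite (_ : \sum_(i <- s) _ = \sum_(i <- s | i != j) nsq (c i)); last first.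
    rewrite [RHS]big_mkcond; apply: eq_big_seq => i si.
    by rewrite ifT//; apply: contraNneq sj => <-.
  apply: (le_trans HA); rewrite ler_wpM2r// lerDl.
  by rewrite divr_ge0 ?(ltW T0)// addr_ge0// mulr_ge0// mulr_ge0.
rewrite (bigD1_seq j)//= mulrDl addrC lerD//.
rewrite mulrAC ler_pdivlMr// mulrC.
pose s' := [seq i <- s | i != j].
have us' : uniq s' by exact: filter_uniq.
pose f1 t := c j * expi (lam j * t).
have Le : square_integrable (D T) (fun t => expi (lam j * t)).
  by apply: L2_expiM => //; exact: itv_finite.
have f1E t : f1 t = trig_sum s c t - trig_sum s' c t.
  by rewrite /trig_sum big_filter (bigD1_seq j)//= addrK.
have -> : T * nsq (c j) = norm2 (D T) f1.
  rewrite norm2Z//= mulrC; congr (_ * _).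
  have [E _] := @cintegral_one R 0 T (ltW T0).
  have E' : \int[mu]_(t in `[0, T]) 1 = T by rewrite E subr0.
  rewrite -[LHS]E'; apply: eq_Rintegral => t _.
  by rewrite nsq_expi.
rewrite (eq_norm2 (g := fun t => trig_sum s c t - trig_sum s' c t)); last by move=> t _; exact: f1E.
apply: (le_trans (norm2B_le _ (L2_trig_sum T s c) (L2_trig_sum T s' c))) => //.
apply: (@le_trans _ _ (2 * N + 2 * (B * (A * N)))); last by rewrite [leRHS]mulrDl -!mulrA.
apply: lerD => //; rewrite ler_pM2l//.
apply: (le_trans (norm2_trig_sum_le c (ltW T0) us')).
by rewrite -/B ler_wpM2l// big_filter.
Qed.

Theorem ingham_inequality (T : R) : 0 < T -> ingham xpredT T.
Proof.
move=> T0.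
have [s0 H0] := ingham_tail (divr_gt0 T0 (ltr0Sn R 1)).
have : forall (l : seq I) (T' : R), 0 < T' -> T' < T ->
  ingham (fun i => i \notin l) T' -> ingham xpredT T.
  elim=> [|j l IH] T' T'0 T'T H.
    case: H => d d0 Hd; exists d => // s c us _.
    have as0 : all (fun i => i \notin [::]) s by apply/allP.
    apply: (le_trans (Hd s c us as0)); apply: norm2_subset => //.
      by apply: subset_itvl; rewrite bnd_simp ltW.
    exact: L2_trig_sum.
  (* Each frequency put back consumes half of the remaining length, so any finite number of them
     fits strictly between [T / 2] and [T]. *)
  apply: (IH ((T' + T) / 2)); [lra|lra|].
  apply: (@ingham_add _ j T') => //; first lra.
  case: H => d d0 Hd; exists d => // s c us Ps; apply: Hd => //.
  by apply/allP => i /(allP Ps) /andP[il ij]; rewrite inE negb_or ij.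
by move=> /(_ s0 (T / 2)); apply => //; lra.
Qed.

End Ingham.

(** * Fourier series *)

Definition freqs (N : nat) : seq int := [seq j%:Z - N%:Z | j <- iota 0 N.*2.+1].

Lemma freqs_uniq N : uniq (freqs N).
Proof. by rewrite map_inj_uniq ?iota_uniq// => i j /addIr[]. Qed.

Lemma mem_freqs N k : (k \in freqs N) = (`|k| <= N)%N.
Proof.
apply/mapP/idP => [[j]|kN]; first by rewrite mem_iota /= add0n => jN ->; lia.
exists (absz (k + N%:Z)); first by rewrite mem_iota add0n; lia.
by lia.
Qed.

Section FourierSeries.
Variable R : realType.
Local Notation mu := (@lebesgue_measure R).
Local Notation cj := (@conjc R).
Local Notation T := (@circle R).
Local Notation e k := (fun x : R => expi (k%:~R * x)).

Lemma pi2_gt0 : 0 < 2 * pi :> R. Proof. by rewrite mulr_gt0// pi_gt0. Qed.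
Let pi2_ge0 : 0 <= 2 * pi :> R. Proof. exact: ltW pi2_gt0. Qed.

Lemma measurable_circle : measurable (T : set (measurableTypeR R)).
Proof. exact: measurable_itv. Qed.
Local Notation mT := measurable_circle.

Lemma circle_finite : (mu T < +oo)%E.
Proof. by rewrite /circle lebesgue_measure_itv /= lte_fin; case: ifP => _; rewrite ltry. Qed.

Lemma expi_int (k : int) (x : R) : expi (k%:~R * (x + 2 * pi)) = expi (k%:~R * x).
Proof.
have p1 (y : R) : expi (y + 2 * pi) = expi y.
  rewrite /expi mulr_natl; congr (_ +i* _); first exact: cosD2pi.
  exact: sinD2pi.
have pn (n : nat) (y : R) : expi (y + n%:R * (2 * pi)) = expi y.
  elim: n => [|n IH]; first by rewrite mul0r addr0.
  by rewrite -natr1 mulrDl mul1r addrA p1 IH.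
rewrite mulrDr; case: k => n; first by rewrite pn.
by rewrite -[LHS](pn n.+1); congr expi; rewrite NegzE mulrNz -pmulrn; ring.
Qed.

Lemma L2_expi_int (k : int) : square_integrable T (e k).
Proof. by apply: L2_expiM; [exact: mT|exact: circle_finite]. Qed.

Lemma cintegrable_L2 f : square_integrable T f -> cintegrable T f.
Proof.
move=> Lf; have := L2_mul mT Lf (L2_cst 1 mT circle_finite).
by apply: eq_cintegrable => [|x _]; [exact: mT|rewrite mulr1].
Qed.

Lemma cintegral_circle_cc f : square_integrable T f ->
  cintegral T f = cintegral `[0, 2 * pi] f.
Proof.
move=> /cintegrable_L2[rf If]; rewrite /cintegral; congr (_ +i* _).
  exact: Rintegral_itv_bndo_bndc.
exact: Rintegral_itv_bndo_bndc.
Qed.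

Lemma cintegral_expi_int (k : int) :
  cintegral T (e k) = if k == 0 then (2 * pi)%:C else 0.
Proof.
rewrite cintegral_circle_cc; last exact: L2_expi_int.
case: eqP => [->|/eqP k0].
  rewrite -[in RHS](subr0 (2 * pi)) -cintegral_one//.
  by apply: eq_cintegral => x _; rewrite mul0r expi0.
have k0' : k%:~R != 0 :> R by rewrite intr_eq0.
rewrite /cintegral /= integral_cosM// integral_sinM//.
have := expi_int k 0; rewrite add0r mulr0 expi0 => -[-> ->].
by rewrite cos0 sin0 !subrr mul0r.
Qed.

Lemma norm2_trig_poly (s : seq int) (c : int -> R[i]) : uniq s ->
  norm2 T (fun x => \sum_(k <- s) c k * e k x) = 2 * pi * \sum_(k <- s) nsq (c k).
Proof.
move=> us; apply: (@complexI R); rewrite norm2E; [|exact: mT|]; last first.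
  by apply: L2_sum => [|k]; [exact: mT|apply: L2Z; [exact: mT|exact: L2_expi_int]].
have E x : (\sum_(k <- s) c k * e k x) * cj (\sum_(k <- s) c k * e k x) =
    \sum_(k <- s) \sum_(l <- s) c k * cj (c l) * e (k - l) x.
  rewrite conjc_sum mulr_suml; apply: eq_bigr => k _.
  rewrite mulr_sumr; apply: eq_bigr => l _.
  by rewrite conjcM expiJ intrB mulrBl expiD; ring.
under eq_cintegral => x _ do rewrite E.
rewrite cintegral_sum; [|exact: mT|]; last first.
  move=> k; apply: cintegrable_sum => [|l]; first exact: mT.
  by apply: cintegrableZ; [exact: mT|exact/cintegrable_L2/L2_expi_int].
rewrite rmorphM /= rmorph_sum /= mulr_sumr; apply: eq_big_seq => k ks.
rewrite cintegral_sum; [|exact: mT|]; last first.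
  by move=> l; apply: cintegrableZ; [exact: mT|exact/cintegrable_L2/L2_expi_int].
rewrite (bigD1_seq k)//= cintegralZ; [|exact: mT|exact/cintegrable_L2/L2_expi_int].
rewrite cintegral_expi_int subrr eqxx mulcJ mulrC big1 ?addr0// => l lk.
rewrite cintegralZ; [|exact: mT|exact/cintegrable_L2/L2_expi_int].
by rewrite cintegral_expi_int subr_eq0 eq_sym (negPf lk) mulr0.
Qed.

(** As the pairing involves no conjugation, testing against the mode [k] yields the coefficient at
    [- k]. All reflections of the index below originate here. *)
Lemma fourier_coefE f (k : int) :
  cintegral T (fun x => f x * e k x) = (2 * pi)%:C * fourier_coef f (- k).
Proof.
rewrite /fourier_coef mulrA -rmorphM /= mulfV ?gt_eqF ?pi2_gt0// mul1r.
by apply: eq_cintegral => x _; rewrite intrN mulNr opprK.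
Qed.

Lemma trig_poly_mul f (s : seq int) (c : int -> R[i]) : square_integrable T f ->
  cintegral T (fun x => f x * \sum_(k <- s) c k * e k x) =
  \sum_(k <- s) c k * ((2 * pi)%:C * fourier_coef f (- k)).
Proof.
move=> Lf; under eq_cintegral => x _ do rewrite mulr_sumr.
rewrite cintegral_sum; [|exact: mT|]; last first.
  by move=> k; apply: L2_mul => //; [exact: mT|apply: L2Z; [exact: mT|exact: L2_expi_int]].
apply: eq_bigr => k _; rewrite -fourier_coefE -cintegralZ; first last.
- by apply: L2_mul => //; [exact: mT|exact: L2_expi_int].
- exact: mT.
by apply: eq_cintegral => x _; rewrite mulrCA.
Qed.

Definition fpart f (s : seq int) (x : R) : R[i] := \sum_(k <- s) fourier_coef f k * e k x.

Lemma L2_fpart f s : square_integrable T (fpart f s).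
Proof.
by apply: L2_sum => [|k]; [exact: mT|apply: L2Z; [exact: mT|exact: L2_expi_int]].
Qed.

Lemma norm2B_fpart f s : square_integrable T f -> uniq s ->
  norm2 T (fun x => f x - fpart f s x) =
  norm2 T f - 2 * pi * \sum_(k <- s) nsq (fourier_coef f k).
Proof.
move=> Lf us; rewrite norm2D//; [|exact: mT|apply: L2N; [exact: mT|exact: L2_fpart]].
rewrite norm2N norm2_trig_poly//.
have -> : cintegral T (fun x => f x * cj (- fpart f s x)) =
   - (2 * pi * \sum_(k <- s) nsq (fourier_coef f k))%:C.
  have E x : f x * cj (- fpart f s x) = - (f x * \sum_(k <- [seq - k | k <- s])
      cj (fourier_coef f (- k)) * e k x).
    rewrite -mulrN; congr (_ * _); rewrite conjcN; congr (- _).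
    rewrite conjc_sum big_map; apply: eq_bigr => k _.
    by rewrite opprK conjcM expiJ intrN mulNr.
  under eq_cintegral => x _ do rewrite E.
  rewrite cintegralN; [|exact: mT|]; last first.
    apply: L2_mul => //; first exact: mT.
    by apply: L2_sum => [|k]; [exact: mT|apply: L2Z; [exact: mT|exact: L2_expi_int]].
  rewrite trig_poly_mul// big_map; congr (- _).
  rewrite [in RHS]rmorphM /= rmorph_sum /= mulr_sumr; apply: eq_bigr => k _.
  by rewrite !opprK mulrCA; congr (_ * _); rewrite mulrC mulcJ.
by rewrite !cE /=; ring.
Qed.

Lemma bessel f s : square_integrable T f -> uniq s ->
  2 * pi * \sum_(k <- s) nsq (fourier_coef f k) <= norm2 T f.
Proof. by move=> Lf us; rewrite -subr_ge0 -norm2B_fpart// norm2_ge0. Qed.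

Lemma fourier_coef_sum f : square_integrable T f -> square_summable (fourier_coef f).
Proof.
move=> Lf; exists (norm2 T f / (2 * pi)) => s us.
by rewrite ler_pdivlMr ?pi2_gt0// mulrC; exact: bessel.
Qed.

Lemma fourier_sumE f x N : fourier_sum f x N = fpart f (freqs N) x.
Proof.
rewrite /fourier_sum /fpart /freqs big_map.
by rewrite -(big_mkord xpredT (fun j => fourier_coef f (j%:Z - N%:Z) *
  expi ((j%:Z - N%:Z)%:~R * x))) /index_iota subn0.
Qed.

End FourierSeries.

(** * Completeness of the trigonometric system *)

Section Parseval.
Variable R : realType.
Local Notation mu := (@lebesgue_measure R).
Local Notation cj := (@conjc R).
Local Notation T := (@circle R).
Local Notation e k := (fun x : R => expi (k%:~R * x)).
Local Notation mT := (@measurable_circle R).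

Lemma L2_mul_bounded (D : set R) (f g : R -> R[i]) (M : R) :
  measurable (D : set (measurableTypeR R)) ->
  square_integrable D f -> cmeasurable D g -> (forall x, D x -> nsq (g x) <= M) ->
  square_integrable D (fun x => f x * g x).
Proof.
move=> mD Lf mg gM; have [mf If] := proj1 (square_integrableP D f) Lf.
apply/square_integrableP => //.
have m := cmeasurableM mf mg; split => //.
apply: rint_le (rintZ mD M If) _ => //; first exact: measurable_nsq.
by move=> x Dx; rewrite ger0_norm ?nsq_ge0// nsqM mulrC ler_wpM2r ?nsq_ge0// gM.
Qed.

(* A real polynomial approximation of the indicator of [v < v0] on [0, 1],
   whose composition with a trigonometric polynomial is again one. *)
Definition step_poly (v0 : R) (n : nat) (v : R) : R :=
  (1 - v ^+ n) ^+ (Num.Def.trunc (v0 ^- n)).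

Lemma bernoulli_le (x : R) (n : nat) : 0 <= x -> x <= 1 -> 1 - n%:R * x <= (1 - x) ^+ n.
Proof.
move=> x0 x1; elim: n => [|n IH]; first by rewrite mul0r subr0 expr0.
rewrite exprS; apply: (@le_trans _ _ ((1 - x) * (1 - n%:R * x))).
  have P : 0 <= n%:R * x * x by rewrite !mulr_ge0.
  by rewrite -natr1; nra.
by rewrite ler_wpM2l// subr_ge0.
Qed.

Lemma bernoulli_inv (x : R) (n : nat) : 0 <= x -> x <= 1 ->
  (1 - x) ^+ n * (1 + n%:R * x) <= 1.
Proof.
move=> x0 x1; elim: n => [|n IH]; first by rewrite mul0r addr0 expr0 mulr1.
apply: le_trans IH; rewrite exprS mulrAC mulrC; apply: ler_wpM2l.
  by rewrite exprn_ge0// subr_ge0.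
have : 0 <= n%:R * x * x by rewrite !mulr_ge0.
by rewrite -natr1; nra.
Qed.

Lemma step_poly_bounds v0 n v : 0 <= v -> v <= 1 -> 0 <= step_poly v0 n v <= 1.
Proof.
move=> v0' v1; have vn : v ^+ n <= 1 by exact: exprn_ile1.
rewrite /step_poly exprn_ge0 ?subr_ge0//= exprn_ile1 ?subr_ge0//.
by rewrite lerBlDr lerDl exprn_ge0.
Qed.

(** With [m] the integer part of [v0 ^- n], Bernoulli's inequality gives [1 - (1 - v ^+ n) ^+ m <= m
    * v ^+ n <= (v / v0) ^+ n]. *)
Lemma step_poly_lt v0 v : 0 < v0 -> v0 < 1 -> 0 <= v -> v < v0 ->
  step_poly v0 n v @[n --> \oo] --> (1 : R).
Proof.
move=> v00 v01 v_ge0 vv0.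
have q0 : 0 <= v / v0 by rewrite divr_ge0// ltW.
have q1 : v / v0 < 1 by rewrite ltr_pdivrMr// mul1r.
have v1 : v <= 1 by exact: ltW (lt_trans vv0 v01).
apply: (@squeeze_cvgr _ _ _ _ (fun n => 1 - (v / v0) ^+ n) (fun=> 1)).
- near=> n; apply/andP; split; last by have /andP[] := step_poly_bounds v0 n v_ge0 v1.
  have vn1 : v ^+ n <= 1 by exact: exprn_ile1.
  have H := bernoulli_le (Num.Def.trunc (v0 ^- n)) (exprn_ge0 n v_ge0) vn1.
  apply: le_trans H.
  rewrite lerD2l lerN2 exprMn [leLHS]mulrC exprVn ler_wpM2l ?exprn_ge0//.
  by have /trunc_itv/andP[] : 0 <= v0 ^- n by rewrite invr_ge0 exprn_ge0// ltW.
- rewrite -[X in _ --> X]subr0; apply: cvgB; first exact: cvg_cst.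
  by apply: cvg_expr; rewrite ger0_norm.
- exact: cvg_cst.
Unshelve. all: by end_near. Qed.

(** With [m] the integer part of [v0 ^- n], the value is at most [1 / (1 + m * v ^+ n)], and [(v /
    v0) ^+ n <= (m + 1) * v ^+ n <= 1 + m * v ^+ n]. *)
Lemma step_poly_gt v0 v : 0 < v0 -> v0 < 1 -> v0 < v -> v <= 1 ->
  step_poly v0 n v @[n --> \oo] --> (0 : R).
Proof.
move=> v00 v01 vv0 v1.
have v_gt0 : 0 < v by exact: lt_trans vv0.
have q0 : 0 <= v0 / v by rewrite divr_ge0// ltW.
have q1 : v0 / v < 1 by rewrite ltr_pdivrMr// mul1r.
apply: (@squeeze_cvgr _ _ _ _ (fun=> 0) (fun n => (v0 / v) ^+ n)).
- near=> n; apply/andP; split; first by have /andP[] := step_poly_bounds v0 n (ltW v_gt0) v1.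
  have vn0 : 0 < v ^+ n by rewrite exprn_gt0.
  have v0n0 : 0 < v0 ^+ n by rewrite exprn_gt0.
  have vn1 : v ^+ n <= 1 by apply: exprn_ile1 => //; exact: ltW.
  have H := bernoulli_inv (Num.Def.trunc (v0 ^- n)) (ltW vn0) vn1.
  have /andP[_ H2] : ((Num.Def.trunc (v0 ^- n))%:R <= v0 ^- n < (Num.Def.trunc (v0 ^- n)).+1%:R).
    by apply: trunc_itv; rewrite invr_ge0 ltW.
  rewrite -/(step_poly v0 n v) in H.
  have P0 : 0 <= step_poly v0 n v by have /andP[] := step_poly_bounds v0 n (ltW v_gt0) v1.
  rewrite expr_div_n ler_pdivlMr//.
  move: H2; rewrite -natr1 => H2.
  have H3 : v0 ^- n * v ^+ n <= 1 + (Num.Def.trunc (v0 ^- n))%:R * v ^+ n.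
    apply: (@le_trans _ _ (((Num.Def.trunc (v0 ^- n))%:R + 1) * v ^+ n)).
      by rewrite ler_wpM2r// ltW.
    by rewrite mulrDl mul1r addrC lerD2r.
  have H4 : step_poly v0 n v * (v0 ^- n * v ^+ n) <= 1.
    by apply: le_trans H; rewrite ler_wpM2l.
  by move: H4; rewrite mulrCA ler_pdivrMl// mulr1.
- exact: cvg_cst.
- by apply: cvg_expr; rewrite ger0_norm.
Unshelve. all: by end_near. Qed.

Lemma measure_setU1_eq0 (N : set (measurableTypeR R)) (x : R) :
  measurable N -> mu N = 0%E -> mu (N `|` [set x]) = 0%E.
Proof.
move=> mN N0; apply/eqP; rewrite eq_le measure_ge0 andbT.
apply: (le_trans (measureU2 _ mN (measurable_set1 x))).
have N1 : mu [set x] = 0%E := lebesgue_measure_set1 x.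
by change (mu N + mu [set x] <= 0)%E; rewrite N0 N1 adde0.
Qed.

Section Uniqueness.
Variable h : R -> R[i].
Hypotheses (Lh : square_integrable T h) (h0 : forall k, fourier_coef h k = 0).

(** Multipliers [p] for which all Fourier coefficients of [h * p] vanish. Asking for every [k], and
    not for [k = 0] only, makes the class stable under multiplication by trigonometric
    polynomials. *)
Let orth (p : R -> R) := square_integrable T (fun x => h x * (p x)%:C) /\
  forall k, cintegral T (fun x => h x * (p x)%:C * e k x) = 0.

(** This is the square of [cos ((x - m) / 2)]: a trigonometric polynomial with values in [[0, 1]]
    whose superlevel sets are arcs centred at [m]. *)
Definition cos2half (m x : R) : R := (1 + cos (x - m)) / 2.

Lemma cos2half_bounds m x : 0 <= cos2half m x <= 1.
Proof.
by rewrite /cos2half; have := cos_le1 (x - m); have := cos_geN1 (x - m); lra.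
Qed.

Lemma continuous_cos2half m : continuous (cos2half m).
Proof.
move=> x; apply: cvgM; last exact: cvg_cst.
apply: cvgD; first exact: cvg_cst.
apply: continuous_comp; last exact: continuous_cos.
by apply: cvgB; [exact: cvg_id|exact: cvg_cst].
Qed.

Lemma cmeasurable_continuous (D : set R) (f : R -> R) : continuous f ->
  cmeasurable D (fun x => (f x)%:C).
Proof.
move=> cf; split => /=; last exact: measurable_cst.
apply: measurable_funS (@subsetT _ _) _ => //; exact: continuous_measurable_fun.
Qed.

Lemma nsq_real01 (y : R) : 0 <= y <= 1 -> nsq y%:C <= 1.
Proof. by move=> /andP[y0 y1]; rewrite nsqR exprn_ile1. Qed.

Let orth1 : orth (fun=> 1).
Proof.
split; first by apply: eq_L2 Lh => [|x _]; [exact: mT|rewrite mulr1].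
move=> k; rewrite -[RHS](mulr0 (2 * pi)%:C) -(h0 (- k)) -fourier_coefE.
by apply: eq_cintegral => x _; rewrite mulr1.
Qed.

(** [cos (x - m)] is half the sum of two exponentials, so the coefficient at [k] becomes a
    combination of those at [k], [k + 1] and [k - 1]. *)
Let orth_cos2half m p : orth p -> orth (fun x => p x * cos2half m x).
Proof.
move=> [Lp op]; split.
  have := L2_mul_bounded mT Lp (cmeasurable_continuous T (continuous_cos2half (m := m)))
    (fun x _ => nsq_real01 (cos2half_bounds m x)).
  by apply: eq_L2 => [|x _]; [exact: mT|rewrite realcM mulrA].
move=> k.
have E x : h x * (p x * cos2half m x)%:C * e k x =
    (1 / 2)%:C * (h x * (p x)%:C * e k x) +
    ((1 / 4)%:C * expi (- m) * (h x * (p x)%:C * e (k + 1) x) +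
     (1 / 4)%:C * expi m * (h x * (p x)%:C * e (k - 1) x)).
  have -> : (p x * cos2half m x)%:C = (p x)%:C * (1 / 2)%:C + (p x)%:C *
      ((1 / 4)%:C * (expi (x - m) + expi (m - x))).
    apply: complex_eqP; rewrite !cE /= /cos2half -(opprB x m) cosN sinN.
      by rewrite !mul0r !subr0; field.
    by ring.
  have -> : e (k + 1) x = e k x * expi x by rewrite intrD mulrDl mul1r expiD.
  have -> : e (k - 1) x = e k x * expi (- x) by rewrite intrB mulrBl mul1r expiD.
  by rewrite !expiD; ring.
have I l : cintegrable T (fun x => h x * (p x)%:C * e l x).
  by apply: L2_mul => //; [exact: mT|exact: L2_expi_int].
under eq_cintegral => x _ do rewrite E.
have IZ a l : cintegrable T (fun x => a * (h x * (p x)%:C * e l x)).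
  by apply: cintegrableZ; [exact: mT|exact: I].
rewrite cintegralD; [|exact: mT|exact: IZ|by apply: cintegrableD; [exact: mT|exact: IZ|exact: IZ]].
rewrite cintegralD; [|exact: mT|exact: IZ|exact: IZ].
rewrite !cintegralZ ?op ?mulr0 ?addr0//; exact: mT.
Qed.

Let orth_cos2halfX m p n : orth p -> orth (fun x => p x * cos2half m x ^+ n).
Proof.
move=> op; elim: n => [|n IH].
  by rewrite (_ : (fun x => _) = p)//; apply/funext => x; rewrite expr0 mulr1.
rewrite (_ : (fun x => _) = (fun x => p x * cos2half m x ^+ n * cos2half m x)).
  exact: orth_cos2half.
by apply/funext => x; rewrite exprSr mulrA.
Qed.

Let orthB p q : orth p -> orth q -> orth (fun x => p x - q x).
Proof.
move=> [Lp op] [Lq oq]; split.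
  apply: eq_L2 (L2B mT Lp Lq) => [|x _]; first exact: mT.
  by rewrite realcB mulrBr.
move=> k.
have E x : h x * (p x - q x)%:C * e k x = h x * (p x)%:C * e k x - h x * (q x)%:C * e k x.
  by rewrite realcB mulrBr mulrBl.
under eq_cintegral => x _ do rewrite E.
rewrite cintegralB ?op ?oq ?subrr//; first exact: mT.
  by apply: L2_mul => //; [exact: mT|exact: L2_expi_int].
by apply: L2_mul => //; [exact: mT|exact: L2_expi_int].
Qed.

Let orth_step m v0 n : orth (fun x => step_poly v0 n (cos2half m x)).
Proof.
rewrite /step_poly; elim: (Num.Def.trunc _) => [|N IH].
  by rewrite (_ : (fun x => _) = (fun=> 1))//; apply/funext => x; rewrite expr0.
rewrite (_ : (fun x => _) = (fun x => (1 - cos2half m x ^+ n) ^+ N -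
    (1 - cos2half m x ^+ n) ^+ N * cos2half m x ^+ n)).
  exact: orthB IH (orth_cos2halfX _ _ IH).
by apply/funext => x; rewrite exprSr mulrBr mulr1.
Qed.

(** Centred at [b / 2], the function takes the same value at [0] and at [b]; its superlevel set for
    this value is the arc between them. *)
Lemma cos2half_arc (b x : R) : 0 < b -> b < 2 * pi -> 0 < x -> x < 2 * pi ->
  (x < b -> cos2half (b / 2) 0 < cos2half (b / 2) x) /\
  (b < x -> cos2half (b / 2) x < cos2half (b / 2) 0).
Proof.
move=> b0 b2 x0 x2; rewrite /cos2half sub0r cosN.
have pi0 : 0 < (pi : R) by exact: pi_gt0.
split=> xb; rewrite ltr_pM2r// ltrD2l.
  have [y0|y0] := leP 0 (x - b / 2).
    by rewrite ltr_cos ?in_itv /=; [lra|apply/andP; split; lra|apply/andP; split; lra].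
  by rewrite -(cosN (x - _)) ltr_cos ?in_itv /=; [lra|apply/andP; split; lra|apply/andP; split; lra].
have [y0|y0] := leP (x - b / 2) pi.
  by rewrite ltr_cos ?in_itv /=; [lra|apply/andP; split; lra|apply/andP; split; lra].
rewrite -(cosN (x - _)) -cosD2pi -mulr_natl.
by rewrite ltr_cos ?in_itv /=; [lra|apply/andP; split; lra|apply/andP; split; lra].
Qed.

(* dominated convergence along the trigonometric polynomials [step_poly] *)
Let arc_integral (F : R -> R) (b : R) : 0 < b -> b < 2 * pi ->
  mu.-integrable T (EFin \o F) ->
  (forall m v0 n, \int[mu]_(x in T) (F x * step_poly v0 n (cos2half m x)) = 0) ->
  \int[mu]_(x in T) (F x * (b < x)%R%:R) = 0.
Proof.
move=> b0 b2 iF H; pose v0 := cos2half (b / 2) 0.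
have pi0 : 0 < (pi : R) by exact: pi_gt0.
have v01 : v0 < 1.
  rewrite /v0 /cos2half sub0r cosN -[X in _ < X](_ : (1 + cos 0) / 2 = 1); last by rewrite cos0; field.
  by rewrite ltr_pM2r// ltrD2l ltr_cos ?in_itv /=; [lra|apply/andP; split; lra|apply/andP; split; lra].
have v00 : 0 < v0.
  rewrite /v0 /cos2half sub0r cosN -[X in X < _](_ : (1 + cos pi) / 2 = 0); last by rewrite cospi; field.
  by rewrite ltr_pM2r// ltrD2l ltr_cos ?in_itv /=; [lra|apply/andP; split; lra|apply/andP; split; lra].
pose f_ n x := (F x * step_poly v0 n (cos2half (b / 2) x))%:E.
pose f x := (F x * (b < x)%R%:R)%:E.
have mF : measurable_fun T F by exact: rint_meas iF.
have mst n : measurable_fun T (fun x => step_poly v0 n (cos2half (b / 2) x)).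
  apply: measurable_funX; apply: measurable_funB => //; apply: measurable_funX.
  apply: measurable_funS (@subsetT _ _) _ => //; apply: continuous_measurable_fun.
  exact: continuous_cos2half.
have mf_ n : measurable_fun T (f_ n).
  by apply/measurable_EFinP; apply: measurable_funM.
have mf : measurable_fun T f.
  apply/measurable_EFinP; apply: measurable_funM => //.
  rewrite (_ : (fun x => _) = \1_(`]b, +oo[%classic : set R)); last first.
    by apply/funext => x; rewrite indicE /= mem_setE in_itv /= andbT.
  by apply: measurable_indic; exact: measurable_itv.
have ig : mu.-integrable T (EFin \o (fun x => `|F x|)).
  by have := integrable_norm iF; exact.
have cvx : {ae mu, forall x, T x -> f_ n x @[n --> \oo] --> f x}.
  (* At the two endpoints of the arc the argument of [step_poly] equals the threshold [v0], and no
     limit is claimed there. *)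
  exists ([set 0] `|` [set b]); split.
  - by apply: measurableU; exact: measurable_set1.
  - by apply: measure_setU1_eq0; rewrite ?lebesgue_measure_set1//; exact: measurable_set1.
  move=> x /= /not_implyP[Tx nc]; apply: contrapT => /not_orP[/= x0 xb]; apply: nc.
  apply: cvg_EFin; first by near=> n.
  apply: cvgM; first exact: cvg_cst.
  move: Tx; rewrite /circle /= in_itv /= => /andP[x_ge0 x2].
  have {x0 x_ge0} x0 : 0 < x by rewrite lt_neqAle x_ge0 eq_sym andbT; exact/eqP.
  have [A B] := cos2half_arc b0 b2 x0 x2.
  have /andP[w0 w1] := cos2half_bounds (b / 2) x.
  have [xb'|bx|xb'] := ltgtP x b.
  - by apply: step_poly_gt => //; exact: A.
  - by apply: step_poly_lt => //; exact: B.
  - by [].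
have [|_ _] := @dominated_convergence _ _ _ mu T mT f_ f _ mf_ mf cvx ig _.
  apply: aeW => x n _; rewrite lee_fin normrM ler_piMr//.
  have /andP[w0 w1] := cos2half_bounds (b / 2) x.
  by have /andP[s0 s1] := step_poly_bounds v0 n w0 w1; rewrite ger0_norm.
rewrite (_ : [sequence _]_n = (fun=> 0%E)); last first.
  apply/funext => n; have := H (b / 2) v0 n; rewrite /Rintegral /f_.
  have I : mu.-integrable T (f_ n).
    apply: (@rint_le _ _ mT _ (fun x => `|F x|)) => //; first exact: measurable_funM.
    move=> x _; have /andP[s0 s1] := step_poly_bounds v0 n (proj1 (andP (cos2half_bounds (b / 2) x))) (proj2 (andP (cos2half_bounds (b / 2) x))).
    by rewrite normrM (ger0_norm s0) ler_piMr.
  by move=> E; rewrite /= -[LHS]fineK ?E//; exact: integrable_fin_num mT _ I.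
move=> C; have E := cvg_lim (@ereal_hausdorff R) C.
rewrite lim_cst// in E.
change (fine (\int[mu]_(x in T) f x)%E = fine 0%E); congr fine.
exact/esym/E.
Unshelve. all: by end_near. Qed.

(** The primitive of [F] from 0 vanishes on all of []0, 2 * pi[], and by Lebesgue differentiation
    [F] is almost everywhere its derivative. *)
Let zero_of_arcs (F : R -> R) : mu.-integrable T (EFin \o F) ->
  \int[mu]_(x in T) F x = 0 ->
  (forall b, 0 < b -> b < 2 * pi -> \int[mu]_(x in T) (F x * (b < x)%R%:R) = 0) ->
  {ae mu, forall x, T x -> F x = 0}.
Proof.
move=> iF F0 Fb; pose G := (F \_ T) : R -> R.
have iG : mu.-integrable setT (EFin \o G).
  by have := iF; rewrite integrable_mkcond ?restrict_EFin//; exact: mT.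
have iGD (D : set R) : measurable (D : set (measurableTypeR R)) -> mu.-integrable D (EFin \o G).
  by move=> mD; apply: integrableS iG => //; exact: measurableT.
have lG : locally_integrable setT G by apply: open_integrable_locally => //; exact: openT.
have G0 b : 0 < b -> b < 2 * pi -> \int[mu]_(x in `[0, b]) G x = 0.
  move=> b0 b2.
  have mFb : mu.-integrable T (EFin \o (fun x => F x * (b < x)%R%:R)).
    apply: (@rint_le _ _ mT _ (fun x => `|F x|)).
    - apply: measurable_funM; first exact: rint_meas iF.
      rewrite (_ : (fun x => _) = \1_(`]b, +oo[%classic : set R)); last first.
        by apply/funext => x; rewrite indicE /= mem_setE in_itv /= andbT.
      by apply: measurable_indic; exact: measurable_itv.
    - by have := integrable_norm iF; exact.
    - by move=> x _; case: ltP => _; rewrite ?mulr1 ?mulr0 ?normr0.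
  transitivity (\int[mu]_(x in T) (F x - F x * (b < x)%R%:R)); last first.
    by rewrite RintegralB ?F0 ?Fb ?subrr//; exact: mT.
  rewrite Rintegral_mkcond [RHS]Rintegral_mkcond; apply: eq_Rintegral => x _.
  rewrite /G !patchE !mem_setE /circle /= !in_itv /=.
  case: (leP 0 x) => //= x0; case: (leP x b) => //= xb.
    by rewrite (le_lt_trans xb b2) mulr0 subr0.
  by rewrite mulr1 subrr if_same.
have := @FTC1 R G (BLeft 0) (fun y => iGD _ (measurable_itv _)) lG.
move=> [N [mN N0 sN]]; exists (N `|` [set 0]); split.
- by apply: measurableU => //; exact: measurable_set1.
- exact: measure_setU1_eq0.
move=> x /= /not_implyP[Tx nF]; apply: contrapT => /not_orP[/= nNx x0]; apply: nF.
move: (Tx); rewrite /circle /= in_itv /= => /andP[x_ge0 x2].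
have {x0 x_ge0} x0 : 0 < x by rewrite lt_neqAle x_ge0 eq_sym andbT; exact/eqP.
have : (fun x0 : R => (BLeft 0%R < BRight x0)%E -> derivable (fun x1 : R =>
   \int[mu]_(t in [set` Interval (BLeft 0) (BRight x1)]) G t) x0 1 /\
   (fun x1 : R => \int[mu]_(t in [set` Interval (BLeft 0) (BRight x1)]) G t)^`()%classic x0 = G x0) x.
  by apply: contrapT => H; apply: nNx; exact: sN.
move=> /(_ _)[|_]; first by rewrite /= lte_fin.
have -> : G x = F x by rewrite /G patchE mem_set.
move=> <-; rewrite derive1E.
rewrite (@near_eq_derive _ _ _ _ (cst 0))//; first by rewrite derive_cst.
near=> y; apply: G0.
  by near: y; exact: lt_nbhsr.
by near: y; exact: lt_nbhsl.
Unshelve. all: by end_near. Qed.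

Lemma fourier_uniqueness : norm2 T h = 0.
Proof.
have [rI iI] := cintegrable_L2 Lh.
have E m v0 n : cintegral T (fun x => h x * (step_poly v0 n (cos2half m x))%:C) = 0.
  have [_ /(_ 0) H] := orth_step m v0 n; rewrite -[RHS]H.
  by apply: eq_cintegral => x _; rewrite mul0r expi0 mulr1.
have E0 : cintegral T h = 0.
  have [_ /(_ 0) H] := orth1; rewrite -[RHS]H.
  by apply: eq_cintegral => x _; rewrite mul0r expi0 !mulr1.
have R0 : {ae mu, forall x, T x -> complex.Re (h x) = 0}.
  apply: zero_of_arcs => //; first by case: E0.
  move=> b b0 b2; apply: arc_integral => // m v0 n.
  have [H _] := E m v0 n; rewrite -[RHS]H; apply: eq_Rintegral => x _.
  by rewrite cReM /= mulr0 subr0.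
have I0 : {ae mu, forall x, T x -> complex.Im (h x) = 0}.
  apply: zero_of_arcs => //; first by case: E0.
  move=> b b0 b2; apply: arc_integral => // m v0 n.
  have [_ H] := E m v0 n; rewrite -[RHS]H; apply: eq_Rintegral => x _.
  by rewrite cImM /= mulr0 add0r.
rewrite /norm2 /Rintegral -[RHS]/(fine 0%E); congr fine.
rewrite -[RHS](integral0 mu T); apply: ge0_ae_eq_integral.
- exact: mT.
- by apply/measurable_EFinP; apply: measurable_nsq; case: Lh.
- exact: measurable_cst.
- by move=> x _; rewrite lee_fin nsq_ge0.
- by [].
- have FA := ae_filter_ringOfSetsType mu.
  by apply: (filterS2 _ _ R0 I0) => x Rx Ix Tx; rewrite /nsq Rx// Ix// expr0n addr0.
Qed.

End Uniqueness.

(** Bessel's inequality makes the partial sums Cauchy. Their limit has the Fourier coefficients of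
    [f], hence is [f] by uniqueness. *)
Lemma fpart_cvg f : square_integrable T f -> forall eps : R, 0 < eps ->
  exists N, forall n, (N <= n)%N ->
    norm2 T (fun x => f x - fpart f (freqs n) x) <= eps.
Proof.
move=> Lf; pose S n := \sum_(k <- freqs n) nsq (fourier_coef f k).
have Ssub m n : (m <= n)%N -> S n = S m + \sum_(k <- freqs n | k \notin freqs m) nsq (fourier_coef f k).
  move=> mn; rewrite /S (bigID (mem (freqs m))) /=; congr (_ + _).
  rewrite -big_filter; apply: perm_big; apply: uniq_perm.
  - by rewrite filter_uniq// freqs_uniq.
  - exact: freqs_uniq.
  move=> k; rewrite mem_filter !mem_freqs andb_idr// => km.
  exact: leq_trans km mn.
have Smono : {homo S : n m / (n <= m)%N >-> n <= m}.
  move=> m n mn; rewrite (Ssub _ _ mn) lerDl sumr_ge0// => k _; exact: nsq_ge0.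
have Sbnd : has_ubound (range S).
  have [M HM] := fourier_coef_sum Lf.
  by exists M => _ [n _ <-]; apply: HM; exact: freqs_uniq.
have cS := nondecreasing_is_cvgn Smono Sbnd.
have dist m n : (m <= n)%N -> norm2 T (fun x => fpart f (freqs n) x - fpart f (freqs m) x) =
    2 * pi * (S n - S m).
  move=> mn; rewrite (Ssub _ _ mn) addrAC subrr add0r -big_filter -norm2_trig_poly; last first.
    by rewrite filter_uniq// freqs_uniq.
  apply: eq_Rintegral => x _; congr nsq.
  rewrite big_filter /fpart (bigID (mem (freqs m))) /= addrAC.
  suff -> : \sum_(k <- freqs n | k \in freqs m) fourier_coef f k * e k x =
     \sum_(k <- freqs m) fourier_coef f k * e k x by rewrite subrr add0r.
  rewrite -big_filter; apply: perm_big; apply: uniq_perm.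
  - by rewrite filter_uniq// freqs_uniq.
  - exact: freqs_uniq.
  move=> k; rewrite mem_filter !mem_freqs andb_idr// => km.
  exact: leq_trans km mn.
have LS n : square_integrable T (fpart f (freqs n)) by exact: L2_fpart.
have [G [LG GP]] : exists G, square_integrable T G /\ forall eps, 0 < eps -> exists N, forall n, (N <= n)%N ->
     norm2 T (fun x => fpart f (freqs n) x - G x) <= eps.
  apply: L2_complete => // [|eps eps0]; first exact: mT.
  move/cvgrPdist_le : cS => /(_ (eps / 2 / (2 * pi))) [].
    by rewrite !divr_gt0// pi2_gt0.
  move=> N _ HN; exists N => m n Nm Nn.
  wlog mn : m n Nm Nn / (n <= m)%N => [W|].
    have [/W|nm] := leqP n m; first exact.
    rewrite (_ : norm2 T _ = norm2 T (fun x => fpart f (freqs n) x - fpart f (freqs m) x)); first by apply: W => //; exact: ltnW.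
    by rewrite -norm2N; apply: eq_Rintegral => x _; rewrite opprB.
  rewrite dist// mulrC -ler_pdivlMr ?pi2_gt0//.
  have := HN _ Nm; have := HN _ Nn; rewrite /= !ler_norml => /andP[? ?] /andP[? ?].
  have -> : eps / (2 * pi) = eps / 2 / (2 * pi) + eps / 2 / (2 * pi).
    by rewrite -mulrDl -splitr.
  lra.
(* For [n >= |k|] the partial sum has the coefficient of [f] at [k], so Bessel's inequality for this
   single mode bounds [b] by the distance from the partial sum to [G]. *)
have G0 k : fourier_coef (fun x => f x - G x) k = 0.
  pose b := fourier_coef (fun x => f x - G x) k.
  apply: nsq_eq0; apply/eqP; rewrite eq_le nsq_ge0 andbT.
  apply/ler_addgt0Pl => eps eps0; rewrite addr0.
  have [N HN] := GP _ (mulr_gt0 (pi2_gt0 R) eps0).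
  pose n := maxn N (absz k).
  have L : square_integrable T (fun x => fpart f (freqs n) x - G x) by apply: L2B => //; exact: mT.
  have := bessel L (isT : uniq [:: k]); rewrite big_seq1.
  have -> : fourier_coef (fun x => fpart f (freqs n) x - G x) k = b.
    have -> : b = fourier_coef (fun x => (fpart f (freqs n) x - G x) + (f x - fpart f (freqs n) x)) k.
      rewrite /b /fourier_coef; congr (_ * _); apply: eq_cintegral => x _.
      by congr (_ * _); ring.
    have Lff : square_integrable T (fun x => f x - fpart f (freqs n) x) by apply: L2B => //; exact: mT.
    rewrite -[in RHS](opprK k); apply: (mulfI (x := (2 * pi)%:C)).
      by rewrite eq_complex /= gt_eqF ?pi2_gt0.
    rewrite -[in LHS](opprK k) -!fourier_coefE.
    under [RHS]eq_cintegral => x _ do rewrite mulrDl.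
    have L1 := L2_mul mT L (@L2_expi_int R (- k)).
    have L2 := L2_mul mT Lff (@L2_expi_int R (- k)).
    rewrite cintegralD//; last exact: mT.
    under [X in _ + X]eq_cintegral => x _ do rewrite mulrBl.
    rewrite cintegralB//; first last.
    - exact: (L2_mul mT (LS n) (@L2_expi_int R _)).
    - exact: (L2_mul mT Lf (@L2_expi_int R _)).
    - exact: mT.
    have -> : cintegral T (fun x => fpart f (freqs n) x * e (- k) x) =
        cintegral T (fun x => f x * e (- k) x).
      under eq_cintegral => x _ do rewrite mulrC.
      rewrite trig_poly_mul; last exact: L2_expi_int.
      rewrite (bigD1_seq k) ?freqs_uniq//=; last by rewrite mem_freqs leq_maxr.
      rewrite fourier_coefE opprK big1_seq ?addr0.
        rewrite -fourier_coefE.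
        have -> : cintegral T (fun x => e (- k) x * e k x) = (2 * pi)%:C.
          rewrite (eq_cintegral (g := e 0)) ?cintegral_expi_int ?eqxx// => x _.
          by rewrite -expiD -mulrDl -intrD addNr.
        exact: mulrC.
      move=> l /andP[lk _]; rewrite -fourier_coefE.
      rewrite (eq_cintegral (g := e (l - k))); last first.
        by move=> x _; rewrite -expiD -mulrDl -intrD addrC.
      by rewrite cintegral_expi_int subr_eq0 (negPf lk) mulr0.
    by rewrite subrr addr0.
  move=> /le_trans/(_ (HN n (leq_maxl _ _))).
  by rewrite ler_pM2l// pi2_gt0.
have LfG : square_integrable T (fun x => f x - G x) by apply: L2B => //; exact: mT.
have N0 := fourier_uniqueness LfG G0.
move=> eps eps0; have [N HN] := GP (eps / 2) (divr_gt0 eps0 (ltr0Sn R 1)).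
exists N => n Nn.
have E x : f x - fpart f (freqs n) x = (f x - G x) - (fpart f (freqs n) x - G x).
  by rewrite opprB addrA subrK.
rewrite (eq_norm2 (g := fun x => (f x - G x) - (fpart f (freqs n) x - G x))); last by move=> x _; exact: E.
apply: le_trans (norm2B_le mT LfG (L2B mT (LS n) LG)) _.
rewrite N0 mulr0 add0r.
by have := HN n Nn; lra.
Qed.

Theorem parseval f g : square_integrable T f -> square_integrable T g ->
  forall eps : R, 0 < eps -> exists N, forall n, (N <= n)%N ->
    nsq (pairing f g - (2 * pi)%:C *
         \sum_(k <- freqs n) fourier_coef f k * fourier_coef g (- k)) <= eps.
Proof.
move=> Lf Lg eps eps0.
have K0 : 0 < norm2 T g + 1 by rewrite ltr_wpDl// norm2_ge0.
have [N HN] := fpart_cvg Lf (divr_gt0 eps0 K0).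
exists N => n Nn.
have -> : (2 * pi)%:C * \sum_(k <- freqs n) fourier_coef f k * fourier_coef g (- k) =
    cintegral T (fun x => fpart f (freqs n) x * g x).
  under [RHS]eq_cintegral => x _ do rewrite mulrC.
  by rewrite trig_poly_mul// mulr_sumr; apply: eq_bigr => k _; rewrite mulrCA.
have LS := L2_fpart f (freqs n).
rewrite /pairing -cintegralB; [|exact: mT|exact: (L2_mul mT Lf Lg)|exact: (L2_mul mT LS Lg)].
under eq_cintegral => x _ do rewrite -mulrBl.
apply: le_trans (integral_CauchySchwarz mT (L2B mT Lf LS) Lg) _.
apply: (@le_trans _ _ (eps / (norm2 T g + 1) * norm2 T g)).
  by rewrite ler_wpM2r ?norm2_ge0// HN.
by rewrite -mulrA ler_piMr ?(ltW eps0)// mulrC ler_pdivrMr// mul1r lerDl.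
Qed.

End Parseval.

(** * Weak solutions of differential equations *)

Section SmoothFunctions.
Variable R : realType.
Local Notation mu := (@lebesgue_measure R).
Local Notation cj := (@conjc R).

(** An existential derivative reduces the closure properties to [is_derive] rules, without any
    rewriting of [derive1]. *)
Fixpoint CnR (n : nat) (f : R -> R) : Prop :=
  continuous f /\ if n is m.+1 then
    exists g, (forall t : R, is_derive t (1 : R) f (g t)) /\ CnR m g else True.

Lemma CnR_continuous n f : CnR n f -> continuous f.
Proof. by case: n => [|n] []. Qed.

Lemma is_derive_continuous (f g : R -> R) : (forall t : R, is_derive t (1 : R) f (g t)) ->
  continuous f.
Proof.
by move=> d t; have := d t => dt; apply: differentiable_continuous; apply/derivable1_diffP.
Qed.

Lemma CnR_intro n f g : (forall t : R, is_derive t (1 : R) f (g t)) -> CnR n g -> CnR n.+1 f.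
Proof. by move=> d Cg; split; [exact: is_derive_continuous d|exists g]. Qed.

Lemma CnRS n f : CnR n.+1 f -> CnR n f.
Proof.
elim: n f => [|n IH] f [cf [g [d Cg]]]; first by split.
by split=> //; exists g; split=> //; exact: IH.
Qed.

Lemma CnR_cst n (k : R) : CnR n (fun=> k).
Proof.
elim: n k => [|n IH] k; first by split=> // t; exact: cvg_cst.
by apply: CnR_intro (IH 0) => t; exact: is_derive_cst.
Qed.

Lemma CnRD n f g : CnR n f -> CnR n g -> CnR n (fun t => f t + g t).
Proof.
elim: n f g => [|n IH] f g; first by move=> [cf _] [cg _]; split=> // t; apply: cvgD; [exact: cf|exact: cg].
move=> [_ [f' [df Cf]]] [_ [g' [dg Cg]]]; exact: CnR_intro (IH _ _ Cf Cg).
Qed.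

Lemma is_derive_mulR (f g : R -> R) (t df dg : R) :
  is_derive t (1 : R) f df -> is_derive t (1 : R) g dg ->
  is_derive t (1 : R) (fun t => f t * g t) (f t * dg + df * g t).
Proof.
move=> d1 d2; have := is_deriveM d1 d2.
by rewrite /GRing.scale /= [g t * df]mulrC.
Qed.

Lemma CnRM n f g : CnR n f -> CnR n g -> CnR n (fun t => f t * g t).
Proof.
elim: n f g => [|n IH] f g; first by move=> [cf _] [cg _]; split=> // t; apply: cvgM; [exact: cf|exact: cg].
move=> Hf Hg; have Cf0 := CnRS Hf; have Cg0 := CnRS Hg.
move: Hf Hg => [_ [f' [df Cf]]] [_ [g' [dg Cg]]].
apply: CnR_intro (CnRD (IH _ _ Cf0 Cg) (IH _ _ Cf Cg0)) => t.
exact: is_derive_mulR.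
Qed.

Lemma is_derive_affine (f : R -> R) (s b t df : R) : is_derive (s * t + b) (1 : R) f df ->
  is_derive t (1 : R) (fun t => f (s * t + b)) (s * df).
Proof.
move=> d.
have d1 : is_derive t (1 : R) (fun t => s * t + b) s.
  by have := is_deriveD (is_derive_mulr s t) (is_derive_cst b t (1 : R)); rewrite addr0.
by have := @is_derive1_comp _ f (fun t => s * t + b) t _ _ d d1; rewrite mulrC.
Qed.

Lemma CnR_affine n f (s b : R) : CnR n f -> CnR n (fun t => f (s * t + b)).
Proof.
elim: n f => [|n IH] f.
  move=> [cf _]; split=> // t; apply: continuous_comp; last exact: cf.
  by apply: cvgD; [exact: mulrl_continuous|exact: cvg_cst].
move=> [_ [f' [df Cf]]]; apply: CnR_intro (CnRM (CnR_cst n s) (IH _ Cf)) => t.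
exact: is_derive_affine.
Qed.

Lemma CnR_trig n (k a b : R) : CnR n (fun t => a * cos (k * t) + b * sin (k * t)).
Proof.
elim: n a b => [|n IH] a b.
  split=> // t; apply: cvgD; apply: cvgM;
  [exact: cvg_cst|exact: continuous_cosM|exact: cvg_cst|exact: continuous_sinM].
apply: CnR_intro (IH (b * k) (- a * k)) => t.
have d1 := @is_deriveZ _ _ _ (fun t => cos (k * t)) a t (1 : R) _ (is_derive_cosM k t).
have d2 := @is_deriveZ _ _ _ (fun t => sin (k * t)) b t (1 : R) _ (is_derive_sinM k t).
have := is_deriveD d1 d2; rewrite /GRing.scale /=.
have -> : a * - (k * sin (k * t)) + b * (k * cos (k * t)) =
  b * k * cos (k * t) + - a * k * sin (k * t) by ring.
by [].
Qed.

Definition smooth f := forall n, CnR n f.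

Lemma smooth_derivative f g : (forall t : R, is_derive t (1 : R) f (g t)) -> smooth f -> smooth g.
Proof.
move=> d sf n; have [_ [h [dh Ch]]] := sf n.+1.
rewrite (_ : g = h)//; apply/funext => t.
by case: (d t) => _ <-; case: (dh t) => _ <-.
Qed.

(** Both partial derivatives of a product of this form are again of this form, so one induction on
    [n] covers all mixed derivatives. *)
Lemma smooth_Cn f g : smooth f -> smooth g -> forall n, Cn n (fun t x => f t * g x).
Proof.
move=> sf sg n; elim: n f g sf sg => [|n IH] f g sf sg.
  split=> // -[t x]; apply: cvgM.
    by apply: (cvg_comp _ _ (cvg_fst (F := nbhs t) (G := nbhs x))); exact: (CnR_continuous (sf 0)).
  by apply: (cvg_comp _ _ (cvg_snd (F := nbhs t) (G := nbhs x))); exact: (CnR_continuous (sg 0)).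
have [_ [f' [df _]]] := sf 1; have [_ [g' [dg _]]] := sg 1.
have sf' := smooth_derivative df sf; have sg' := smooth_derivative dg sg.
have dft t x : is_derive t (1 : R) (fun s => f s * g x) (f' t * g x).
  have := is_derive_mulR (df t) (is_derive_cst (g x) t (1 : R)).
  by rewrite mulr0 add0r.
have dgx t x : is_derive x (1 : R) (fun y => f t * g y) (f t * g' x).
  have := is_derive_mulR (is_derive_cst (f t) x (1 : R)) (dg x).
  by rewrite mul0r addr0.
simpl; split; first by case: n IH => [|n] IH; case: (IH f g sf sg).
split.
- by move=> t x; have := dft t x => ?.
- by move=> t x; have := dgx t x => ?.
- rewrite (_ : dt _ = (fun t x => f' t * g x)); first exact: IH.
  by apply/funext => t; apply/funext => x; rewrite /dt derive1E; have := dft t x => ?; rewrite derive_val.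
- rewrite (_ : dx _ = (fun t x => f t * g' x)); first exact: IH.
  by apply/funext => t; apply/funext => x; rewrite /dx derive1E; have := dgx t x => ?; rewrite derive_val.
Qed.

(** With a polynomial parameter the family [p(1/t) exp(-1/t)] is closed under differentiation, and
    smoothness follows by induction without a formula for higher derivatives. *)
Definition expinv (p : {poly R}) (t : R) : R :=
  if 0 < t then p.[t^-1] * expR (- t^-1) else 0.

(** [y / i <= expR (y / i)], raised to the power [i], gives [y ^+ i <= i ^+ i * expR y]. *)
Lemma poly_le_expR (p : {poly R}) : exists2 C : R, 0 <= C &
  forall y, 0 <= y -> `|p.[y]| <= C * expR y.
Proof.
exists (\sum_(i < size p) `|p`_i| * i%:R ^+ i).
  by apply: sumr_ge0 => i _; rewrite mulr_ge0 ?exprn_ge0.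
move=> y y0; rewrite horner_coef mulr_suml; apply: (le_trans (ler_norm_sum _ _ _)).
apply: ler_sum => i _; rewrite normrM -mulrA ler_wpM2l// normrX ger0_norm//.
case: (i : nat) => [|n]; first by rewrite !expr0 mul1r (le_trans _ (expR_ge1Dx y))// lerDl.
have n0 : 0 < n.+1%:R :> R by rewrite ltr0n.
have -> : expR y = expR (y / n.+1%:R) ^+ n.+1 by rewrite -expRM_natl mulrC divfK ?gt_eqF.
rewrite -exprMn ler_pXn2r ?nnegrE ?mulr_ge0 ?expR_ge0 ?(ltW n0)//.
rewrite mulrC -ler_pdivrMr//; apply: le_trans (expR_ge1Dx _).
by rewrite lerDr.
Qed.

Lemma is_derive_expinv (p : {poly R}) (t : R) :
  is_derive t (1 : R) (expinv p) (expinv ('X^2 * (p - p^`())) t).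
Proof.
have [t0|t0|->] := ltgtP t 0.
- rewrite /expinv ltNge (ltW t0) /=.
  have H : is_derive t (1 : R) (fun=> 0 : R) 0 by exact: is_derive_cst.
  apply: (near_eq_is_derive _ H).
  near=> s; suff : s < 0 by move=> s0; rewrite ltNge (ltW s0).
  by near: s; exact: lt_nbhsl.
- rewrite /expinv t0.
  have dV : is_derive t (1 : R) (fun s : R => s^-1) (- t ^- 2).
    have tn0 : id t != 0 by rewrite /= gt_eqF.
    have := @is_deriveV _ id t 1 1 tn0 (is_derive_id _ _).
    by rewrite /GRing.scale /= mulr1.
  have dp : is_derive (t^-1) (1 : R) (horner p) (p^`()).[t^-1].
    by apply: DeriveDef; [exact: derivable_horner|rewrite -derive1E derivE].
  have d1 := @is_derive1_comp _ (horner p) (fun s : R => s^-1) t _ _ dp dV.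
  have dN : is_derive t (1 : R) (fun s : R => - s^-1) (t ^- 2).
    by have := is_deriveN dV; rewrite opprK.
  have d2 := @is_derive1_comp _ expR (fun s : R => - s^-1) t _ _ (is_derive_expR _) dN.
  have d3 := is_derive_mulR d1 d2.
  have d4 : is_derive t (1 : R) (fun s => p.[s^-1] * expR (- s^-1))
      (('X^2 * (p - p^`())).[t^-1] * expR (- t^-1)).
    apply: (is_derive_eq d3); rewrite !hornerE /= exprVn; ring.
  apply: (near_eq_is_derive _ d4).
  near=> s; suff -> : 0 < s by [].
  by near: s; exact: lt_nbhsr.
- rewrite {2}/expinv ltxx.
  have cv : h^-1 *: (expinv p (h *: 1 + 0) - expinv p 0) @[h --> (0 : R)^'] --> (0 : R).
    (* The difference quotient at [h > 0] is [p(y) y^2 exp(-y) h] with [y = 1 / h], hence at most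
       [C * h]. *)
    have [C C0 HC] := poly_le_expR (p * 'X^2).
    apply: (@cvg_to_0_linear _ _ C 1) => // h /andP[h0 h1].
    rewrite /expinv ltxx subr0 addr0 /GRing.scale /= mulr1.
    case: ifP => [hp|_]; last by rewrite mulr0 normr0 mulr_ge0.
    have hi : 0 < h^-1 by rewrite invr_gt0.
    have := HC h^-1 (ltW hi); rewrite hornerM hornerXn => H.
    have -> : h^-1 * (p.[h^-1] * expR (- h^-1)) = (p.[h^-1] * h^-1 ^+ 2) * expR (- h^-1) * h.
      by field; rewrite gt_eqF.
    rewrite normrM ler_wpM2r// normrM (ger0_norm (expR_ge0 _)) expRN.
    by rewrite ler_pdivrMr ?expR_gt0.
  apply: DeriveDef.
    by apply/cvg_ex; exists 0; exact: cv.
  by apply: cvg_lim cv.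
Unshelve. all: by end_near. Qed.

Lemma smooth_expinv p : smooth (expinv p).
Proof. by move=> n; elim: n p => [|n IH] p; [split=> //; exact: is_derive_continuous (is_derive_expinv p)|exact: CnR_intro (is_derive_expinv p) (IH _)]. Qed.

Definition bump (t : R) : R := expinv 1 (1 * t + 1) * expinv 1 (-1 * t + 1).

Lemma smooth_bump : smooth bump.
Proof. by move=> n; apply: CnRM; apply: CnR_affine; exact: smooth_expinv. Qed.

Lemma expinv1_ge0 t : 0 <= expinv 1 t.
Proof. by rewrite /expinv; case: ifP => // _; rewrite hornerE mul1r expR_ge0. Qed.

Lemma bump_ge0 t : 0 <= bump t.
Proof. by rewrite mulr_ge0 ?expinv1_ge0. Qed.

Lemma bump_out t : 1 <= `|t| -> bump t = 0.
Proof.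
rewrite /bump ler_normr /expinv => /orP[h|h].
  by rewrite (_ : (0 < -1 * t + 1) = false) ?mulr0//; apply/negbTE; rewrite -leNgt; lra.
by rewrite (_ : (0 < 1 * t + 1) = false) ?mul0r//; apply/negbTE; rewrite -leNgt; lra.
Qed.

Lemma bump_gt0 t : `|t| <= 1 / 2 -> expR (- 4) <= bump t.
Proof.
rewrite ler_norml => /andP[h1 h2].
have H s : 1 / 2 <= s -> expR (- 2) <= expinv 1 s.
  move=> hs; have s0 : 0 < s by lra.
  rewrite /expinv s0 hornerE mul1r ler_expR lerN2.
  by rewrite -[leRHS]invrK lef_pV2 ?posrE ?invr_gt0//; lra.
have -> : expR (- 4) = expR (- 2) * expR (- 2) :> R by rewrite -expRD; congr expR; ring.
by apply: ler_pM; rewrite ?expR_ge0//; apply: H; lra.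
Qed.

End SmoothFunctions.

(** * Weak solutions of scalar equations *)

Section WeakODE.
Variable R : realType.
Local Notation mu := (@lebesgue_measure R).
Local Notation cj := (@conjc R).

Lemma continuous_itv_integrable (g : R -> R) (a b : R) : continuous g ->
  mu.-integrable `[a, b] (EFin \o g).
Proof.
move=> cg; apply: continuous_compact_integrable; first exact: segment_compact.
exact: continuous_subspaceT.
Qed.

Lemma compact_support_patch (g : R -> R) (N : R) : (forall t, N < `|t| -> g t = 0) ->
  g \_ `[- N, N] = g.
Proof.
move=> gN; apply/funext => t; rewrite patchE mem_setE in_itv /= -ler_norml.
by case: leP => // /gN.
Qed.

Lemma compact_support_integrable (g : R -> R) (N : R) : continuous g ->
  (forall t, N < `|t| -> g t = 0) -> mu.-integrable setT (EFin \o g).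
Proof.
move=> cg gN; have := continuous_itv_integrable (- N) N cg.
rewrite integrable_mkcond; last exact: measurable_itv.
by rewrite restrict_EFin (compact_support_patch gN).
Qed.

Lemma compact_support_integral (g : R -> R) (N : R) :
  (forall t, N < `|t| -> g t = 0) ->
  \int[mu]_(t in setT) g t = \int[mu]_(t in `[- N, N]) g t.
Proof. by move=> gN; rewrite [RHS]Rintegral_mkcond (compact_support_patch gN). Qed.

(** The base point lies strictly to the left of the support [[-1, 1]] of [bump]: the primitive is 0
    before the support and constant after it. *)
Definition bump_primitive (x : R) : R := \int[mu]_(t in `[-2, x]) bump t.

Let cbump : continuous (@bump R).
Proof. exact: (CnR_continuous (@smooth_bump R 0)). Qed.

Lemma bump_primitive_lt x : x <= -1 -> bump_primitive x = 0.
Proof.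
move=> x1; rewrite /bump_primitive (@eq_Rintegral _ _ _ mu _ (fun=> 0)) ?Rintegral_cst ?mul0r//.
move=> t; rewrite inE /= in_itv /= => /andP[_ tx]; apply: bump_out.
by rewrite ler_normr; apply/orP; right; lra.
Qed.

Lemma is_derive_bump_primitive (x : R) : is_derive x (1 : R) bump_primitive (bump x).
Proof.
have [x2|x2] := leP x (-2).
  rewrite bump_out; last by rewrite ler_normr; apply/orP; right; lra.
  have H : is_derive x (1 : R) (fun=> 0 : R) 0 by exact: is_derive_cst.
  apply: (near_eq_is_derive _ H); near=> y; rewrite bump_primitive_lt//.
  suff : y < -1 by move/ltW.
  by near: y; apply: lt_nbhsl; lra.
have [||||d1 d2] := @continuous_FTC1 _ (@bump R) (BLeft (-2)) x (x + 1).
- by rewrite ltrDl.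
- exact: continuous_itv_integrable.
- by rewrite /= lte_fin.
- exact: cbump.
by apply: DeriveDef; [exact: d1|rewrite -derive1E; exact: d2].
Unshelve. all: by end_near. Qed.

Lemma smooth_bump_primitive : smooth bump_primitive.
Proof. by move=> n; apply: CnRS; apply: CnR_intro is_derive_bump_primitive _; exact: smooth_bump. Qed.

Lemma bump_primitiveB x y : x <= y ->
  \int[mu]_(t in `[x, y]) bump t = bump_primitive y - bump_primitive x.
Proof. by move=> xy; rewrite (Rintegral_FTC xy is_derive_bump_primitive). Qed.

Lemma bump_primitive_gt x : 1 <= x -> bump_primitive x = bump_primitive 1.
Proof.
move=> x1; apply/eqP; rewrite -subr_eq0 -bump_primitiveB//; apply/eqP.
rewrite (@eq_Rintegral _ _ _ mu _ (fun=> 0)) ?Rintegral_cst ?mul0r//.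
move=> t; rewrite inE /= in_itv /= => /andP[tx _]; apply: bump_out.
by rewrite ler_normr; apply/orP; left.
Qed.

Lemma bump_primitive_mono x y : x <= y -> bump_primitive x <= bump_primitive y.
Proof.
by move=> xy; rewrite -subr_ge0 -bump_primitiveB// Rintegral_ge0// => t _; exact: bump_ge0.
Qed.

Lemma bump_mass_gt0 : 0 < bump_primitive 1.
Proof.
have h : - (1 / 2) <= 1 / 2 :> R by lra.
have : expR (- 4) <= \int[mu]_(t in `[- (1 / 2), 1 / 2]) @bump R t.
  have [E _] := @cintegral_one R (- (1 / 2)) (1 / 2) h.
  have -> : expR (- 4) = \int[mu]_(t in `[- (1 / 2), 1 / 2]) (expR (- 4) * 1) :> R.
    rewrite RintegralZl//; first by rewrite E opprK -splitr mulr1.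
    by apply: rint_cst => //; exact: itv_finite.
  apply: le_Rintegral => //; first by apply: rint_cst => //; exact: itv_finite.
    exact: continuous_itv_integrable.
  by move=> t; rewrite /= in_itv /= -ler_norml mulr1 => ?; exact: bump_gt0.
rewrite bump_primitiveB//.
have := bump_primitive_mono (_ : 1 / 2 <= 1); move=> /(_ _)/[dup] H _.
have H1 : bump_primitive (1 / 2) <= bump_primitive 1 by apply: bump_primitive_mono; lra.
have H2 : 0 <= bump_primitive (- (1 / 2)).
  by rewrite -(@bump_primitive_lt (-1))//; apply: bump_primitive_mono; lra.
have := expR_gt0 (- 4 : R); lra.
Qed.

Definition bump_test (f : R -> R) := smooth f /\ exists N : R, forall t, N < `|t| -> f t = 0.

Lemma smoothM f g : smooth f -> smooth g -> smooth (fun t : R => f t * g t : R).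
Proof. by move=> sf sg n; apply: CnRM. Qed.

(* Test against the difference of two mollifiers of equal mass, which is the
   derivative of a compactly supported function. *)
Lemma du_bois_reymond (z : R -> R) : continuous z ->
  (forall f f', bump_test f -> (forall t : R, is_derive t (1 : R) f (f' t)) ->
     \int[mu]_(t in setT) (z t * f' t) = 0) ->
  forall a b, z a = z b.
Proof.
(* The two mollified values agree, each being within [k] of [z a] or [z b]; exchanging [a] and [b]
   gives the other inequality. *)
move=> cz H; suff W a b k : 0 < k -> z b <= z a + 2 * k.
  move=> a b; apply/eqP; rewrite eq_le; apply/andP; split; apply/ler_addgt0Pl => e e0.
    have := W b a (e / 2); rewrite divr_gt0// => /(_ isT); lra.
  have := W a b (e / 2); rewrite divr_gt0// => /(_ isT); lra.
move=> k0.
have /cvgrPdist_le/(_ _ k0)/nbhs_ballP[ea /= ea0 Ha] := cz a.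
have /cvgrPdist_le/(_ _ k0)/nbhs_ballP[eb /= eb0 Hb] := cz b.
pose e := Num.min ea eb.
have e0 : 0 < e by rewrite lt_min ea0.
pose s := e^-1; have s0 : 0 < s by rewrite invr_gt0.
have se1 : s * e = 1 by rewrite mulVf ?gt_eqF.
pose rho (c t : R) : R := s * bump (s * t + - (s * c)).
pose N := `|a| + `|b| + e.
have out c t : `|c| <= `|a| + `|b| -> N < `|t| -> 1 <= `|s * t + - (s * c)|.
  move=> cab Nt; rewrite -mulrBr normrM (gtr0_norm s0) mulrC -ler_pdivrMr// mul1r invrK.
  have := lerB_dist t c; rewrite /N in Nt; lra.
have crho c : continuous (rho c).
  have := CnRM (CnR_cst 0 s) (CnR_affine s (- (s * c)) (@smooth_bump R 0)).
  exact: CnR_continuous.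
have drho c (t : R) : is_derive t (1 : R) (fun t => bump_primitive (s * t + - (s * c))) (rho c t).
  exact: is_derive_affine (is_derive_bump_primitive _).
have rho_out c t : `|c| <= `|a| + `|b| -> N < `|t| -> rho c t = 0.
  by move=> cab Nt; rewrite /rho bump_out ?mulr0// out.
have aab : `|a| <= `|a| + `|b| by rewrite lerDl.
have bab : `|b| <= `|a| + `|b| by rewrite lerDr.
have N0 : 0 < N by rewrite ltr_wpDl// addr_ge0.
have mass c : `|c| <= `|a| + `|b| -> \int[mu]_(t in setT) rho c t = bump_primitive 1.
  move=> cab; have O t := @rho_out c t cab.
  rewrite (compact_support_integral O).
  have NN : - N <= N by rewrite ge0_cp// ltW.
  rewrite (Rintegral_FTC NN (drho c) (crho c)).
  have /ler_normlP[c1 c2] := cab; rewrite -!mulrBr.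
  have h1 : 1 <= s * (N - c) by rewrite -se1 ler_pM2l// /N; lra.
  have h2 : s * (- N - c) <= -1 by rewrite -se1 -mulrN ler_pM2l// /N; lra.
  by rewrite (bump_primitive_gt h1) (bump_primitive_lt h2) subr0.
have inz c t : rho c t != 0 -> `|t - c| < e.
  move=> r0; rewrite ltNge; apply/negP => h; move/eqP: r0; apply.
  rewrite /rho bump_out ?mulr0// -mulrBr normrM (gtr0_norm s0) mulrC -ler_pdivrMr//.
  by rewrite mul1r invrK.
have rho0 c t : 0 <= rho c t by rewrite mulr_ge0 ?bump_ge0// ltW.
have irho c : `|c| <= `|a| + `|b| -> mu.-integrable setT (EFin \o rho c).
  by move=> cab; apply: (@compact_support_integrable _ N) => // t; exact: rho_out.
have izr c : `|c| <= `|a| + `|b| -> mu.-integrable setT (EFin \o (fun t => z t * rho c t)).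
  move=> cab; apply: (@compact_support_integrable _ N) => [t|t Nt].
    by apply: cvgM; [exact: cz|exact: crho].
  by rewrite rho_out ?mulr0.
have Ea : \int[mu]_(t in setT) (z t * rho a t) <= (z a + k) * bump_primitive 1.
  rewrite -(mass a aab) -RintegralZl//; last exact: irho.
  apply: le_Rintegral => //; [exact: izr|exact: rintZ _ (irho _ aab)|] => t _.
  have [->|/inz ta] := eqVneq (rho a t) 0; first by rewrite !mulr0.
  apply: ler_wpM2r => //.
  have := Ha t; rewrite /ball /= distrC => /(_ (lt_le_trans ta _)).
  by rewrite ge_min lexx => /(_ isT)/ler_normlP[]; lra.
have Eb : (z b - k) * bump_primitive 1 <= \int[mu]_(t in setT) (z t * rho b t).
  rewrite -(mass b bab) -RintegralZl//; last exact: irho.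
  apply: le_Rintegral => //; [exact: rintZ _ (irho _ bab)|exact: izr|] => t _.
  have [->|/inz tb] := eqVneq (rho b t) 0; first by rewrite !mulr0.
  apply: ler_wpM2r => //.
  have := Hb t; rewrite /ball /= distrC => /(_ (lt_le_trans tb _)).
  by rewrite ge_min lexx orbT => /(_ isT)/ler_normlP[]; lra.
have := H (fun t => bump_primitive (s * t + - (s * a)) + (-1) * bump_primitive (s * t + - (s * b)))
  (fun t => rho a t + (-1) * rho b t).
have bt : bump_test (fun t => bump_primitive (s * t + - (s * a)) + (-1) * bump_primitive (s * t + - (s * b))).
  split.
    move=> n; apply: CnRD; first exact: CnR_affine (smooth_bump_primitive n).
    by apply: CnRM; [exact: CnR_cst|exact: CnR_affine (smooth_bump_primitive n)].
  exists N => t Nt; have [t0|t0] := leP 0 t.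
    rewrite ger0_norm// /N in Nt.
    have g c : c <= `|a| + `|b| -> 1 <= s * t + - (s * c).
      move=> cab; rewrite -mulrBr -se1 ler_pM2l// lerBrDl.
      by rewrite (le_trans (lerD cab (lexx e)))// ltW.
    have := ler_norm a; have := ler_norm b => nb na.
    have ga : a <= `|a| + `|b| by rewrite (le_trans na)// lerDl.
    have gb : b <= `|a| + `|b| by rewrite (le_trans nb)// lerDr.
    by rewrite (bump_primitive_gt (g _ ga)) (bump_primitive_gt (g _ gb)) mulN1r subrr.
  rewrite ltr0_norm// /N in Nt.
  have g c : - c <= `|a| + `|b| -> s * t + - (s * c) <= -1.
    move=> cab; rewrite -mulrBr -se1 -mulrN ler_pM2l// lerBlDl -lerN2 opprD opprK.
    by rewrite (le_trans (lerD cab (lexx e)))// ltW.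
  have := ler_norm (- a); have := ler_norm (- b); rewrite !normrN => nb na.
  have ga : - a <= `|a| + `|b| by rewrite (le_trans na)// lerDl.
  have gb : - b <= `|a| + `|b| by rewrite (le_trans nb)// lerDr.
  by rewrite (bump_primitive_lt (g _ ga)) (bump_primitive_lt (g _ gb)) mulN1r subrr.
move=> /(_ bt) E0.
have {E0} E0 : \int[mu]_(t in setT) (z t * (rho a t + -1 * rho b t)) = 0.
  by apply: E0.
have E1 : \int[mu]_(t in setT) (z t * rho a t) = \int[mu]_(t in setT) (z t * rho b t).
  apply/eqP; rewrite -subr_eq0 -RintegralB//; [|exact: izr|exact: izr].
  apply/eqP; rewrite -[RHS]E0; apply: eq_Rintegral => t _; ring.
have : (z b - k) * bump_primitive 1 <= (z a + k) * bump_primitive 1.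
  by apply: (le_trans Eb); rewrite -E1; exact: Ea.
rewrite ler_pM2r ?bump_mass_gt0// lerBlDr => /le_trans; apply.
by rewrite -addrA -mulr2n mulr_natl.
Qed.

(** The hypothesis says [y' = i w y] weakly, so [z = y * expi (- (w * t))] has a vanishing weak
    derivative. Test functions being real, the factor [expi (- (w * t))] enters through its real and
    imaginary parts separately. *)
Lemma weak_ode (y : R -> R[i]) (w : R) :
  continuous (fun t => complex.Re (y t)) -> continuous (fun t => complex.Im (y t)) ->
  (forall f f', bump_test f -> (forall t : R, is_derive t (1 : R) f (f' t)) ->
    cintegral setT (fun t => y t * (f' t)%:C) +
    (0 +i* w) * cintegral setT (fun t => y t * (f t)%:C) = 0) ->
  forall t, y t = expi (w * t) * y 0.
Proof.
move=> cr ci H.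
pose z t := y t * expi (- (w * t)).
have Iy (g : R -> R) : continuous g -> (exists N, forall t, N < `|t| -> g t = 0) ->
    cintegrable setT (fun t => y t * (g t)%:C).
  move=> cg [N gN]; split.
    apply: (@eq_rint _ _ measurableT (fun t => complex.Re (y t) * g t)).
      by move=> t _; rewrite cReM /= mulr0 subr0.
    apply: (@compact_support_integrable _ N) => [t|t /gN ->]; last by rewrite mulr0.
    by apply: cvgM; [exact: cr|exact: cg].
  apply: (@eq_rint _ _ measurableT (fun t => complex.Im (y t) * g t)).
    by move=> t _; rewrite cImM /= mulr0 add0r.
  apply: (@compact_support_integrable _ N) => [t|t /gN ->]; last by rewrite mulr0.
  by apply: cvgM; [exact: ci|exact: cg].
have Hz f f' : bump_test f -> (forall t : R, is_derive t (1 : R) f (f' t)) ->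
    cintegral setT (fun t => z t * (f' t)%:C) = 0.
  move=> [sf [N fN]] df.
  have sf' := smooth_derivative df sf.
  have f'N t : N < `|t| -> f' t = 0.
    move=> Nt; have H0 : is_derive t (1 : R) (fun=> 0 : R) 0 by exact: is_derive_cst.
    have H1 : is_derive t (1 : R) f 0.
      apply: (near_eq_is_derive _ H0); near=> s; apply/esym/fN.
      by near: s; apply: (@cvgr_norm_gt _ _ _ _ _ id t) => //; exact: cvg_id.
    by case: (df t) => _ <-; case: H1 => _ <-.
  (* [c] and [s] are the real and imaginary parts of [expi (- (w * t))], in the shape required by
     [CnR_trig]. *)
  pose c t := 1 * cos (w * t) + 0 * sin (w * t).
  pose s t := 0 * cos (w * t) + (-1) * sin (w * t).
  have sc : smooth c by move=> n; exact: CnR_trig.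
  have ss : smooth s by move=> n; exact: CnR_trig.
  have dc (t : R) : is_derive t (1 : R) c (w * s t).
    have d1 := @is_deriveZ _ _ _ (fun t => cos (w * t)) 1 t (1 : R) _ (is_derive_cosM w t).
    have d2 := @is_deriveZ _ _ _ (fun t => sin (w * t)) 0 t (1 : R) _ (is_derive_sinM w t).
    have := is_deriveD d1 d2; rewrite /GRing.scale /= => d.
    by apply: (is_derive_eq d); rewrite /s; ring.
  have ds (t : R) : is_derive t (1 : R) s (- w * c t).
    have d1 := @is_deriveZ _ _ _ (fun t => cos (w * t)) 0 t (1 : R) _ (is_derive_cosM w t).
    have d2 := @is_deriveZ _ _ _ (fun t => sin (w * t)) (-1) t (1 : R) _ (is_derive_sinM w t).
    have := is_deriveD d1 d2; rewrite /GRing.scale /= => d.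
    by apply: (is_derive_eq d); rewrite /c; ring.
  have t1 : bump_test (fun t => c t * f t).
    by split; [exact: smoothM|exists N => t /fN ->; rewrite mulr0].
  have t2 : bump_test (fun t => s t * f t).
    by split; [exact: smoothM|exists N => t /fN ->; rewrite mulr0].
  have d1 t := is_derive_mulR (dc t) (df t).
  have d2 t := is_derive_mulR (ds t) (df t).
  have E1 := H _ _ t1 d1; have E2 := H _ _ t2 d2.
  have cont (g : R -> R) : smooth g -> continuous g by move=> sg; exact: (CnR_continuous (sg 0)).
  have I1 : cintegrable setT (fun t => y t * (c t * f t)%:C).
    by apply: Iy; [exact/cont/smoothM|exists N => t /fN ->; rewrite mulr0].
  have I2 : cintegrable setT (fun t => y t * (s t * f t)%:C).
    by apply: Iy; [exact/cont/smoothM|exists N => t /fN ->; rewrite mulr0].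
  have cM (g h : R -> R) : continuous g -> continuous h -> continuous (fun t : R => g t * h t : R).
    by move=> cg ch t; apply: cvgM; [exact: cg|exact: ch].
  have cD (g h : R -> R) : continuous g -> continuous h -> continuous (fun t : R => g t + h t : R).
    by move=> cg ch t; apply: cvgD; [exact: cg|exact: ch].
  have cw k : continuous (fun _ : R => k : R) by move=> t; exact: cvg_cst.
  have I3 : cintegrable setT (fun t => y t * (c t * f' t + w * s t * f t)%:C).
    apply: Iy; last by exists N => t Nt; rewrite fN// f'N// !mulr0 addr0.
    exact: (cD _ _ (cM _ _ (cont _ sc) (cont _ sf')) (cM _ _ (cM _ _ (cw w) (cont _ ss)) (cont _ sf))).
  have I4 : cintegrable setT (fun t => y t * (s t * f' t + - w * c t * f t)%:C).
    apply: Iy; last by exists N => t Nt; rewrite fN// f'N// !mulr0 addr0.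
    exact: (cD _ _ (cM _ _ (cont _ ss) (cont _ sf')) (cM _ _ (cM _ _ (cw (- w)) (cont _ sc)) (cont _ sf))).
  have E t : z t * (f' t)%:C = (y t * (c t * f' t + w * s t * f t)%:C +
       (0 +i* w) * (y t * (c t * f t)%:C)) + (0 +i* 1) *
       (y t * (s t * f' t + - w * c t * f t)%:C + (0 +i* w) * (y t * (s t * f t)%:C)).
    rewrite /z /expi cosN sinN; apply: complex_eqP; rewrite !cE /= /c /s; ring.
  under eq_cintegral => t _ do rewrite E.
  have mR := @measurableT _ (measurableTypeR R).
  have J1 := cintegrableD mR I3 (cintegrableZ mR (0 +i* w) I1).
  have J2 := cintegrableD mR I4 (cintegrableZ mR (0 +i* w) I2).
  rewrite (cintegralD mR J1 (cintegrableZ mR _ J2)) (cintegralZ mR _ J2).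
  rewrite (cintegralD mR I3 (cintegrableZ mR _ I1)) (cintegralD mR I4 (cintegrableZ mR _ I2)).
  by rewrite !(cintegralZ mR) // E1 E2 mulr0 addr0.
have crz : continuous (fun t => complex.Re (z t)).
  rewrite (_ : (fun t => _) = (fun t => complex.Re (y t) * cos (w * t) + complex.Im (y t) * sin (w * t))).
    by move=> t; apply: cvgD; apply: cvgM; [exact: cr|exact: continuous_cosM|exact: ci|exact: continuous_sinM].
  by apply/funext => t; rewrite /z cReM /expi cosN sinN /=; ring.
have ciz : continuous (fun t => complex.Im (z t)).
  rewrite (_ : (fun t => _) = (fun t => complex.Im (y t) * cos (w * t) - complex.Re (y t) * sin (w * t))).
    by move=> t; apply: cvgB; apply: cvgM; [exact: ci|exact: continuous_cosM|exact: cr|exact: continuous_sinM].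
  by apply/funext => t; rewrite /z cImM /expi cosN sinN /=; ring.
have zc a b : z a = z b.
  apply: complex_eqP.
    apply: (du_bois_reymond crz) => f f' bt df; have [E _] := Hz f f' bt df.
    by rewrite -[RHS]E; apply: eq_Rintegral => t _; rewrite [RHS]cReM /= mulr0 subr0.
  apply: (du_bois_reymond ciz) => f f' bt df; have [_ E] := Hz f f' bt df.
  by rewrite -[RHS]E; apply: eq_Rintegral => t _; rewrite [RHS]cImM /= mulr0 add0r.
move=> t; have := zc t 0; rewrite /z mulr0 oppr0 expi0 mulr1 => <-.
by rewrite mulrCA expiNK mulr1.
Unshelve. all: by end_near. Qed.

End WeakODE.

(** * Frequencies *)

Section Frequencies.
Variable R : realType.
Local Notation mu := (@lebesgue_measure R).
Implicit Types (a c d r : R) (k : int) (p : int * bool).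

(** The trace of the symbol of the adjoint system, the matrix with rows [k^3, (d/c) k^3] and
    [a k^3, (k^3 - r k)/c]. *)
Definition tau c r k : R := k%:~R ^+ 3 * (1 + c^-1) - r * c^-1 * k%:~R.

(** The discriminant of the symbol is [k^2] times this radicand. Without the factor [k^2] the root
    is positive for positive parameters even at [k = 0]. *)
Definition disc_sqrt a c d r k : R :=
  Num.sqrt ((k%:~R ^+ 2 * (1 - c^-1) + r * c^-1) ^+ 2 + 4 * a * c^-1 * d * k%:~R ^+ 4).

(* The pair [(k, b)] stands for the eigenvalue [(tau + k * disc_sqrt) / 2] of the
   symbol at the Fourier mode [k] if [b], and at the mode [- k] otherwise. With
   this indexing the sign of the square root is carried by [k]. *)
Definition mode p : int := if p.2 then p.1 else - p.1.

Definition freq a c d r p : R :=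
  (tau c r (mode p) + p.1%:~R * disc_sqrt a c d r p.1) / 2.

(* both eigenvalues of the mode 0 vanish *)
Definition admissible p := (p.1 != 0) || p.2.

Lemma sum_subset_le (I : eqType) (s1 s2 : seq I) (F : I -> R) :
  uniq s1 -> uniq s2 -> {subset s1 <= s2} -> (forall i, 0 <= F i) ->
  \sum_(i <- s1) F i <= \sum_(i <- s2) F i.
Proof.
move=> u1 u2 sub F0; rewrite [leRHS](bigID (mem s1)) /= -[X in X + _]big_filter.
rewrite [X in _ <= X + _](perm_big s1); last first.
  apply: uniq_perm => //; first exact: filter_uniq.
  by move=> i; rewrite mem_filter andb_idr//; exact: sub.
by rewrite lerDl sumr_ge0.
Qed.

(** [(n + 1)^(-3/2)]: summable, yet decaying slowly enough that products of two such terms dominate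
    [|x^3 - y^3|^-1]. *)
Definition beta (n : nat) : R := (n.+1%:R * Num.sqrt n.+1%:R)^-1.

Lemma beta_ge0 n : 0 <= beta n.
Proof. by rewrite invr_ge0 mulr_ge0 ?sqrtr_ge0. Qed.

(** Telescoping: [t^-3 <= 2 / s - 2 / t] when [t^2 = s^2 + 1]. *)
Lemma sum_beta N : \sum_(0 <= n < N.+1) beta n <= 3 - 2 / Num.sqrt N.+1%:R.
Proof.
elim: N => [|N IH].
  by rewrite big_nat1 /beta !sqrtr1 mulr1 invr1; lra.
rewrite big_nat_recr//=; apply: (le_trans (lerD IH (lexx _))).
set s := Num.sqrt N.+1%:R; set t := Num.sqrt N.+2%:R; rewrite /beta -/t.
have s0 : 0 < s by rewrite sqrtr_gt0 ltr0n.
have t0 : 0 < t by rewrite sqrtr_gt0 ltr0n.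
have s2 : s ^+ 2 = N.+1%:R by rewrite sqr_sqrtr.
have t2 : t ^+ 2 = N.+2%:R by rewrite sqr_sqrtr.
have ts : t ^+ 2 = s ^+ 2 + 1 by rewrite s2 t2 -[N.+2%:R]natr1.
rewrite -t2.
have st : s <= t by rewrite -(@ler_pXn2r _ 2) ?nnegrE ?(ltW s0) ?(ltW t0)// ts lerDl.
have H : (t ^+ 2 * t)^-1 <= 2 / s - 2 / t.
  have -> : 2 / s - 2 / t = 2 / (s * t * (t + s)).
    have E : (t - s) * (t + s) = 1 by rewrite -subr_sqr ts addrC addKr.
    have ne : t + s != 0 by rewrite gt_eqF// addr_gt0.
    have -> : 2 / (s * t * (t + s)) = 2 * ((t - s) * (t + s)) / (s * t * (t + s)).
      by rewrite E mulr1.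
    by field; rewrite ne !gt_eqF.
  rewrite -[leLHS]mul1r ler_pdivrMr ?mulr_gt0 ?exprn_gt0//.
  rewrite mulrAC ler_pdivlMr ?mulr_gt0 ?addr_gt0//.
  rewrite mul1r; nra.
lra.
Qed.

Lemma sum_beta_nat (s : seq nat) : uniq s -> \sum_(n <- s) beta n <= 3.
Proof.
move=> us; pose N := \max_(n <- s) n.
apply: (@le_trans _ _ (\sum_(n <- iota 0 N.+1) beta n)).
  apply: sum_subset_le => //; [exact: iota_uniq| |exact: beta_ge0].
  by move=> n ns; rewrite mem_iota /= add0n ltnS; exact: leq_bigmax_seq.
have := sum_beta N; rewrite /index_iota subn0 => /le_trans; apply.
by rewrite gerBl divr_ge0 ?sqrtr_ge0.
Qed.

Lemma sum_beta_int (s : seq int) : uniq s -> \sum_(k <- s) beta (absz k) <= 6.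
Proof.
move=> us; rewrite (bigID (fun k : int => 0 <= k)) /=.
have -> : (6 : R) = 3 + 3 by ring.
have H (P : pred int) : (forall k l, P k -> P l -> absz k = absz l -> k = l) ->
    \sum_(k <- s | P k) beta (absz k) <= 3.
  move=> Pinj; rewrite -big_filter -(big_map absz xpredT beta); apply: sum_beta_nat.
  rewrite map_inj_in_uniq ?filter_uniq// => k l.
  by rewrite !mem_filter => /andP[Pk _] /andP[Pl _]; exact: Pinj.
by apply: lerD; apply: H => k l; lia.
Qed.

Lemma int_dist_ge1 (x y : int) : x != y -> 1 <= `|x%:~R - y%:~R| :> R.
Proof.
move=> xy; have : (1 <= `|x - y|)%R by lia.
by rewrite -(ler_int R) intr_norm intrB.
Qed.

Lemma cube_int_neq (x y : int) : x != y -> x%:~R ^+ 3 - y%:~R ^+ 3 != 0 :> R.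
Proof.
move=> xy; set X : R := x%:~R; set Y : R := y%:~R.
have XY : X - Y != 0 by rewrite subr_eq0 eqr_int.
have -> : X ^+ 3 - Y ^+ 3 = (X - Y) * ((3 * (X + Y) ^+ 2 + (X - Y) ^+ 2) / 4) by field.
have P : 0 < (X - Y) ^+ 2 by rewrite exprn_even_gt0.
by rewrite mulf_neq0// gt_eqF// divr_gt0//; have := sqr_ge0 (X + Y); lra.
Qed.

(** With [J = |x - y|] and [S = x^2 + y^2], the difference of cubes is at least [J S / 2]. Since
    [J^2 <= 2 S], a factor [S^(1/4)] can be traded for [J^(1/2)], so [J S] dominates
    [S^(3/4) J^(3/2)], which is of order at least [(1 + |x|)^(3/2) (1 + J)^(3/2)]. *)
Lemma cube_diff_ge (x y : int) : x != y ->
  (beta (absz x) * beta (absz (x - y)%R)) >=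
  (`|x%:~R ^+ 3 - y%:~R ^+ 3| * 64)^-1 :> R.
Proof.
move=> xy; pose X : R := x%:~R; pose Y : R := y%:~R.
have j1 : 1 <= `|X - Y| by exact: int_dist_ge1.
pose S := X ^+ 2 + Y ^+ 2.
have S1 : 1 <= S.
  have : (1 <= x ^+ 2 + y ^+ 2)%R by nia.
  by rewrite -(ler_int R) intrD !rmorphXn.
have absE (z : int) : (absz z).+1%:R = 1 + `|z%:~R| :> R.
  by rewrite -natr1 addrC natr_absz intr_norm.
rewrite /beta !absE intrB -/X -/Y.
set J := `|X - Y| in j1 *.
have D0 : J * S / 2 <= `|X ^+ 3 - Y ^+ 3|.
  have -> : X ^+ 3 - Y ^+ 3 = (X - Y) * (X ^+ 2 + X * Y + Y ^+ 2) by ring.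
  rewrite normrM -/J -mulrA ler_wpM2l ?normr_ge0//.
  rewrite ger0_norm; rewrite /S; have := sqr_ge0 (X + Y); nra.
have J0 : 0 < J by exact: lt_le_trans j1.
have S0 : 0 < S by exact: lt_le_trans S1.
have JS : J ^+ 2 <= 2 * S by rewrite real_normK ?num_real// /S; have := sqr_ge0 (X + Y); nra.
pose p := 1 + `|X|; have p1 : 1 <= p by rewrite lerDl.
have pS : p ^+ 2 <= 4 * S.
  have XS : `|X| ^+ 2 <= S by rewrite real_normK ?num_real// lerDl sqr_ge0.
  have -> : p ^+ 2 = 2 + 2 * `|X| ^+ 2 - (1 - `|X|) ^+ 2 by rewrite /p; ring.
  by have := sqr_ge0 (1 - `|X|); lra.
pose q := 1 + J; have q2 : q <= 2 * J by rewrite /q; lra.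
have p0 : 0 < p by exact: lt_le_trans p1.
have q0 : 0 < q by rewrite /q; lra.
have key : p * Num.sqrt p * (q * Num.sqrt q) <= J * S / 2 * 64.
  rewrite -(@ler_pXn2r _ 2) ?nnegrE ?mulr_ge0 ?sqrtr_ge0 ?(ltW p0) ?(ltW q0) ?(ltW J0) ?(ltW S0) ?invr_ge0//.
  have -> : (p * Num.sqrt p * (q * Num.sqrt q)) ^+ 2 = p ^+ 3 * q ^+ 3.
    rewrite !exprMn !sqr_sqrtr ?ltW//; ring.
  have q3 : q ^+ 3 <= 8 * J ^+ 3.
    have -> : 8 * J ^+ 3 = (2 * J) ^+ 3 by ring.
    by rewrite ler_pXn2r ?nnegrE ?mulr_ge0 ?(ltW q0) ?(ltW J0).
  have p3 : p ^+ 3 * J <= 12 * S ^+ 2.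
    rewrite -(@ler_pXn2r _ 2) ?nnegrE ?mulr_ge0 ?exprn_ge0 ?(ltW p0) ?(ltW J0) ?(ltW S0)//.
    have -> : (p ^+ 3 * J) ^+ 2 = (p ^+ 2) ^+ 3 * J ^+ 2 by ring.
    apply: (@le_trans _ _ ((4 * S) ^+ 3 * (2 * S))).
      have p20 : 0 <= p ^+ 2 by exact: sqr_ge0.
      have S40 : 0 <= 4 * S by rewrite mulr_ge0// ltW.
      apply: ler_pM => //; [exact: exprn_ge0|exact: sqr_ge0|].
      by rewrite ler_pXn2r.
    have : 0 <= S ^+ 4 by rewrite exprn_ge0// ltW.
    have -> : (4 * S) ^+ 3 * (2 * S) = 128 * S ^+ 4 by ring.
    have -> : (12 * S ^+ 2) ^+ 2 = 144 * S ^+ 4 by ring.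
    lra.
  apply: (@le_trans _ _ (p ^+ 3 * (8 * J ^+ 3))).
    by rewrite ler_wpM2l// exprn_ge0// ltW.
  have -> : p ^+ 3 * (8 * J ^+ 3) = 8 * J ^+ 2 * (p ^+ 3 * J) by ring.
  apply: (@le_trans _ _ (8 * J ^+ 2 * (12 * S ^+ 2))).
    by rewrite ler_wpM2l// mulr_ge0// exprn_ge0// ltW.
  have : 0 <= J ^+ 2 * S ^+ 2 by rewrite mulr_ge0 ?sqr_ge0.
  have -> : (J * S / 2 * 64) ^+ 2 = 1024 * (J ^+ 2 * S ^+ 2) by field.
  nra.
rewrite -invfM lef_pV2 ?posrE; first by apply: (le_trans key); rewrite ler_wpM2r.
  rewrite mulr_gt0//; apply: lt_le_trans D0; by rewrite !mulr_gt0 ?invr_gt0.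
by rewrite !mulr_gt0 ?sqrtr_gt0.
Qed.

Lemma sum_cube_diff (s1 s2 : seq int) : uniq s1 -> uniq s2 ->
  \sum_(x <- s1) \sum_(y <- s2 | x != y) `|x%:~R ^+ 3 - y%:~R ^+ 3|^-1 <= 64 * 36 :> R.
Proof.
move=> u1 u2.
apply: (@le_trans _ _ (64 * (\sum_(x <- s1) beta (absz x) * 6))).
  rewrite mulr_sumr; apply: ler_sum => x _.
  apply: (@le_trans _ _ (64 * (beta (absz x) * \sum_(y <- s2) beta (absz (x - y)%R)))).
    rewrite !mulr_sumr [leRHS](bigID (fun y => x != y)) /= -[leLHS]addr0; apply: lerD.
      apply: ler_sum => y xy; have := cube_diff_ge xy; rewrite invfM => H.
      by rewrite -ler_pdivrMl// mulrC.
    by apply: sumr_ge0 => y _; rewrite !mulr_ge0 ?beta_ge0.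
  rewrite ler_pM2l// ler_wpM2l ?beta_ge0// -(big_map (fun y => x - y) xpredT (fun k => beta (absz k))).
  by apply: sum_beta_int; rewrite map_inj_uniq// => y z /addrI/oppr_inj.
rewrite ler_pM2l// -mulr_suml; have := sum_beta_int u1; lra.
Qed.

(** At a minimum point [x0] of [|f|] one has [|f x - f x0| <= 2 |f x|], hence
    [|f x| >= (D / 2) |x - x0|]. The integrand is then at most the derivative of a rescaled
    arctangent, of total variation [2 * pi / D]. *)
Lemma integral_recip (f : R -> R) (x1 x2 D : R) : x1 <= x2 -> 0 < D -> continuous f ->
  (forall x y, x \in `[x1, x2] -> y \in `[x1, x2] -> D * `|x - y| <= `|f x - f y|) ->
  (\int[mu]_(x in `[x1, x2]) ((1 + f x ^+ 2)^-1)%:E <= (2 * pi / D)%:E)%E.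
Proof.
move=> x12 D0 cf lip.
have cn : continuous (fun x => `|f x|).
  by move=> x; apply: continuous_comp; [exact: cf|exact: norm_continuous].
have [x0 x0in x0min] := @EVT_min R _ x1 x2 x12 (continuous_subspaceT cn).
pose g x := (1 + (D / 2 * (x - x0)) ^+ 2)^-1.
have D20 : 0 < D / 2 by rewrite divr_gt0.
have dF (t : R) : is_derive t (1 : R) (fun t => (D / 2)^-1 * atan (D / 2 * t + - (D / 2 * x0))) (g t).
  have d1 := @is_derive_affine _ _ (D / 2) (- (D / 2 * x0)) t _ (is_derive1_atan (D / 2 * t + - (D / 2 * x0))).
  have := @is_deriveZ _ _ _ _ (D / 2)^-1 t (1 : R) _ d1.
  by rewrite /GRing.scale /= mulKf ?gt_eqF// /g mulrBr.
have cg : continuous g.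
  move=> t; apply: cvgV; first by rewrite gt_eqF// ltr_pwDl// sqr_ge0.
  apply: cvgD; first exact: cvg_cst.
  rewrite expr2; under eq_fun do rewrite expr2.
  by apply: cvgM; apply: cvgM; (exact: cvg_cst || (apply: cvgB; [exact: cvg_id|exact: cvg_cst])).
have E := Rintegral_FTC x12 dF cg.
apply: (@le_trans _ _ (\int[mu]_(x in `[x1, x2]) (g x)%:E)%E).
  apply: ge0_le_integral => //.
  - by move=> x _; rewrite lee_fin invr_ge0 addr_ge0// sqr_ge0.
  - apply/measurable_EFinP; apply: measurable_funS (@subsetT _ _) _ => //.
    apply: continuous_measurable_fun => t.
    apply: cvgV; first by rewrite gt_eqF// ltr_pwDl// sqr_ge0.
    apply: cvgD; first exact: cvg_cst.
    by rewrite expr2; under eq_fun do rewrite expr2; apply: cvgM; exact: cf.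
  - apply/measurable_EFinP; apply: measurable_funS (@subsetT _ _) _ => //.
    exact: continuous_measurable_fun.
  - move=> x xin; rewrite lee_fin lef_pV2 ?posrE ?ltr_pwDl ?sqr_ge0// lerD2l.
    rewrite -[leRHS]real_normK ?num_real// -[leLHS]real_normK ?num_real//.
    rewrite ler_pXn2r ?nnegrE// normrM (gtr0_norm D20).
    have H := lip x x0 xin x0in; have M := x0min x xin.
    have T : `|f x - f x0| <= `|f x| + `|f x0| by exact: ler_normB.
    by rewrite mulrAC ler_pdivrMr//; lra.
have -> : (\int[mu]_(x in `[x1, x2]) (g x)%:E)%E = (\int[mu]_(x in `[x1, x2]) g x)%:E.
  rewrite /Rintegral fineK//; apply: integrable_fin_num => //.
  apply: continuous_compact_integrable; first exact: segment_compact.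
  exact: continuous_subspaceT.
rewrite lee_fin E -mulrBr invf_div mulrAC ler_pM2r ?invr_gt0// ler_pM2l//.
have := atan_ltpi2 (D / 2 * x2 + - (D / 2 * x0)).
have := atan_gtNpi2 (D / 2 * x1 + - (D / 2 * x0)); lra.
Qed.

Lemma sqrt_sqrD_lip (x y B : R) : 0 < B ->
  `|Num.sqrt (x ^+ 2 + B) - Num.sqrt (y ^+ 2 + B)| <= `|x - y|.
Proof.
move=> B0; set s := Num.sqrt _; set t := Num.sqrt _.
have xB : 0 < x ^+ 2 + B by rewrite ltr_wpDl// sqr_ge0.
have yB : 0 < y ^+ 2 + B by rewrite ltr_wpDl// sqr_ge0.
have s0 : 0 < s by rewrite sqrtr_gt0.
have t0 : 0 < t by rewrite sqrtr_gt0.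
have xs : `|x| <= s by rewrite -sqrtr_sqr ler_wsqrtr// lerDl ltW.
have yt : `|y| <= t by rewrite -sqrtr_sqr ler_wsqrtr// lerDl ltW.
have st0 : 0 < s + t by rewrite addr_gt0.
rewrite -(ler_pM2r st0) -[X in `|s - t| * X]gtr0_norm// -normrM -subr_sqr.
rewrite !sqr_sqrtr ?(ltW xB) ?(ltW yB)// opprD addrACA subrr addr0 subr_sqr normrM ler_wpM2l//.
by apply: le_trans (ler_normD _ _) _; exact: lerD.
Qed.

Section FixedParameters.
Variables (a c r : R).
Hypotheses (a0 : 0 < a) (c0 : 0 < c) (r0 : 0 < r).

Let u := 1 - c^-1.
Let w := r * c^-1.
Let E := 4 * a * c^-1.

Let w0 : 0 < w. Proof. by rewrite mulr_gt0 ?invr_gt0. Qed.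
Let E0 : 0 < E. Proof. by rewrite !mulr_gt0 ?invr_gt0. Qed.

Lemma disc_sqr d k : 0 < d ->
  disc_sqrt a c d r k ^+ 2 = (k%:~R ^+ 2 * u + w) ^+ 2 + E * d * k%:~R ^+ 4.
Proof.
move=> d0; rewrite sqr_sqrtr// addr_ge0 ?sqr_ge0// mulr_ge0 ?(mulr_ge0 (ltW E0)) ?(ltW d0)//.
by rewrite -[4%N]/(2 * 2)%N exprM sqr_ge0.
Qed.

Lemma disc_sqrt_gt0 d k : 0 < d -> 0 < disc_sqrt a c d r k.
Proof.
move=> d0; have [->|k0] := eqVneq k 0.
  rewrite sqrtr_gt0 -/w expr0n /= mul0r add0r expr0n /= mulr0 addr0.
  by rewrite exprn_gt0.
have k40 : 0 < k%:~R ^+ 4 :> R.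
  by rewrite -[4%N]/(2 * 2)%N exprM exprn_gt0// exprn_even_gt0//= intr_eq0.
by rewrite sqrtr_gt0 ltr_wpDl ?sqr_ge0// mulr_gt0// (mulr_gt0 E0).
Qed.

Let X d := Num.sqrt (u ^+ 2 + E * d).

(** Divided by [k^2], the root becomes that of [(u + w / k^2)^2 + E d], and [x |-> sqrt (x^2 + E d)]
    is 1-Lipschitz. *)
Lemma disc_sqrt_asymp d k : 0 < d -> k != 0 ->
  `|disc_sqrt a c d r k / k%:~R ^+ 2 - X d| <= w / k%:~R ^+ 2.
Proof.
move=> d0 k0; have k20 : 0 < k%:~R ^+ 2 :> R by rewrite exprn_even_gt0//= intr_eq0.
have Ed : 0 < E * d by rewrite mulr_gt0.
have -> : disc_sqrt a c d r k / k%:~R ^+ 2 = Num.sqrt ((u + w / k%:~R ^+ 2) ^+ 2 + E * d).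
  have K : 0 <= k%:~R ^+ 2 :> R by exact: ltW.
  rewrite -{1}[k%:~R ^+ 2](ger0_norm K) -(sqrtr_sqr (k%:~R ^+ 2)) -sqrtrV ?sqr_ge0//.
  rewrite -sqrtrM -/w; last first.
    rewrite addr_ge0 ?sqr_ge0// mulr_ge0 ?(ltW Ed)//.
    by rewrite -[4%N]/(2 * 2)%N exprM sqr_ge0.
  by congr Num.sqrt; rewrite /E /u; field; rewrite intr_eq0 k0 gt_eqF.
apply: le_trans (sqrt_sqrD_lip _ _ Ed) _.
by rewrite addrC addKr ger0_norm// divr_ge0 ?(ltW w0) ?(ltW k20).
Qed.

Section Interval.
Variables d1 d2 : R.
Hypotheses (d10 : 0 < d1) (d12 : d1 <= d2).

(** For [d] in [[d1, d2]], [y0] is a lower bound of [2 * X d] and of twice [disc_sqrt / k^2], and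
    [X1] is an upper bound of [2 * X d]; both are uniform in [k]. *)
Let y0 := 2 * Num.sqrt (E * d1).
Let X1 := 2 * Num.sqrt (u ^+ 2 + E * d2).

Let y00 : 0 < y0. Proof. by rewrite mulr_gt0// sqrtr_gt0 mulr_gt0. Qed.
Let X10 : 0 < X1.
Proof.
rewrite mulr_gt0// sqrtr_gt0 ltr_wpDl ?sqr_ge0// mulr_gt0//.
exact: lt_le_trans d12.
Qed.

Let Xge d : d1 <= d -> y0 <= 2 * X d.
Proof.
move=> dd; rewrite ler_pM2l// ler_wsqrtr// ler_wpDl ?sqr_ge0//.
by rewrite ler_pM2l.
Qed.

Let Xle d : d <= d2 -> 2 * X d <= X1.
Proof. by move=> dd; rewrite ler_pM2l// ler_wsqrtr// lerD2l ler_pM2l. Qed.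

Let Qge d k : d1 <= d -> k != 0 -> y0 <= 2 * (disc_sqrt a c d r k / k%:~R ^+ 2).
Proof.
move=> dd k0; have k20 : 0 < k%:~R ^+ 2 :> R by rewrite exprn_even_gt0//= intr_eq0.
have d0 : 0 < d by exact: lt_le_trans dd.
have H : (Num.sqrt (E * d1) * k%:~R ^+ 2) ^+ 2 <= disc_sqrt a c d r k ^+ 2.
  rewrite disc_sqr// exprMn sqr_sqrtr; last exact: (mulr_ge0 (ltW E0) (ltW d10)).
  rewrite ler_wpDl ?sqr_ge0// -exprM; apply: ler_wpM2r; last by rewrite ler_pM2l.
  by rewrite -[(2 * 2)%N]/4%N -[4%N]/(2 * 2)%N exprM sqr_ge0.
rewrite ler_pM2l// ler_pdivlMr// -(@ler_pXn2r _ 2)// nnegrE ?sqrtr_ge0//.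
by rewrite mulr_ge0 ?sqrtr_ge0// ltW.
Qed.

Let X12 d d' k : d1 <= d <= d2 -> d1 <= d' <= d2 -> k != 0 ->
  `|k%:~R ^+ 2 / (disc_sqrt a c d r k + disc_sqrt a c d' r k) - (X d + X d')^-1|
    <= 2 * w / y0 ^+ 2 / k%:~R ^+ 2.
Proof.
move=> /andP[dl dh] /andP[d'l d'h] k0.
have k20 : 0 < k%:~R ^+ 2 :> R by rewrite exprn_even_gt0//= intr_eq0.
have d0 : 0 < d by exact: lt_le_trans dl.
have d'0 : 0 < d' by exact: lt_le_trans d'l.
have A := disc_sqrt_asymp d0 k0; have A' := disc_sqrt_asymp d'0 k0.
have q1 := Qge dl k0; have q2 := Qge d'l k0.
have x1 := Xge dl; have x2 := Xge d'l.
set q := disc_sqrt a c d r k / _ in A q1; set q' := disc_sqrt a c d' r k / _ in A' q2.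
have -> : k%:~R ^+ 2 / (disc_sqrt a c d r k + disc_sqrt a c d' r k) = (q + q')^-1.
  by rewrite /q /q' -mulrDl invfM invrK mulrC.
have P : y0 <= q + q' by lra.
have P' : y0 <= X d + X d' by lra.
have P0 : 0 < q + q' by exact: lt_le_trans P.
have P'0 : 0 < X d + X d' by exact: lt_le_trans P'.
have -> : (q + q')^-1 - (X d + X d')^-1 = ((X d - q) + (X d' - q')) / ((q + q') * (X d + X d')).
  by field; rewrite !gt_eqF.
rewrite normrM normfV (gtr0_norm (mulr_gt0 P0 P'0)).
have -> : 2 * w / y0 ^+ 2 / k%:~R ^+ 2 = (w / k%:~R ^+ 2 + w / k%:~R ^+ 2) / y0 ^+ 2.
  by field; rewrite intr_eq0 k0 gt_eqF.
apply: ler_pM => //; first by rewrite invr_ge0 ltW// mulr_gt0.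
  apply: le_trans (ler_normD _ _) _; apply: lerD; by rewrite distrC.
rewrite lef_pV2 ?posrE; [|exact: mulr_gt0|exact: exprn_gt0].
by rewrite expr2; apply: ler_pM => //; exact: ltW.
Qed.

(** Beyond this threshold on [|k| + |l|] the error terms, linear in [k] and [l], are at most half of
    the main term, proportional to [k^3 - l^3]. *)
Let K0 := 16 * w * X1 / y0 ^+ 2.

(** The traces do not depend on [d] and cancel. By rationalization, the variation of [k * disc_sqrt]
    is [E (d - d') k^3 h k], where [h k] tends to a limit [H] common to all branches. The whole
    difference is thus close to [E (d - d') (k^3 - l^3) H / 2]. *)
Lemma freq_diff_lip p p' d d' : d1 <= d <= d2 -> d1 <= d' <= d2 ->
  K0 <= `|p.1%:~R| + `|p'.1%:~R| -> p.1 != p'.1 ->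
  E * `|p.1%:~R ^+ 3 - p'.1%:~R ^+ 3| / (4 * X1) * `|d - d'| <=
  `|(freq a c d r p - freq a c d r p') - (freq a c d' r p - freq a c d' r p')|.
Proof.
move=> dI d'I; set k := p.1; set l := p'.1 => Kkl kl.
have [/andP[dl dh] /andP[d'l d'h]] := (dI, d'I).
have d0 : 0 < d by exact: lt_le_trans dl.
have d'0 : 0 < d' by exact: lt_le_trans d'l.
pose h (k : int) : R := k%:~R ^+ 2 / (disc_sqrt a c d r k + disc_sqrt a c d' r k).
have Qd m : m%:~R * (disc_sqrt a c d r m - disc_sqrt a c d' r m) =
    E * (d - d') * (m%:~R ^+ 3 * h m).
  have P : 0 < disc_sqrt a c d r m + disc_sqrt a c d' r m.
    by rewrite addr_gt0// disc_sqrt_gt0.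
  have : disc_sqrt a c d r m - disc_sqrt a c d' r m =
      (disc_sqrt a c d r m ^+ 2 - disc_sqrt a c d' r m ^+ 2) /
      (disc_sqrt a c d r m + disc_sqrt a c d' r m).
    by rewrite subr_sqr mulfK// gt_eqF.
  move=> ->; rewrite !disc_sqr// /h; field; by rewrite gt_eqF.
have -> : (freq a c d r p - freq a c d r p') - (freq a c d' r p - freq a c d' r p') =
    E * (d - d') * (k%:~R ^+ 3 * h k - l%:~R ^+ 3 * h l) / 2.
  by rewrite mulrBr -!Qd /freq -/k -/l; field.
pose H := (X d + X d')^-1.
have err m : `|m%:~R ^+ 3 * h m - m%:~R ^+ 3 * H| <= `|m%:~R| * (2 * w / y0 ^+ 2).
  have [->|m0] := eqVneq m 0; first by rewrite expr0n /= !mul0r subr0 normr0 mul0r.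
  have m20 : 0 < m%:~R ^+ 2 :> R by rewrite exprn_even_gt0//= intr_eq0.
  rewrite -mulrBr normrM exprS normrM -mulrA ler_wpM2l// (gtr0_norm m20) mulrC.
  by rewrite -ler_pdivlMr//; exact: X12.
have X0 : 0 < X d + X d'.
  by have := Xge dl; have := Xge d'l; have := y00; lra.
have HX : X1^-1 <= H.
  rewrite lef_pV2 ?posrE//; have := Xle dh; have := Xle d'h; lra.
set Z := k%:~R ^+ 3 - l%:~R ^+ 3.
pose S : R := `|k%:~R| + `|l%:~R|.
have ZS : S ^+ 2 / 4 <= `|Z|.
  have kl1 : 1 <= `|k%:~R - l%:~R| :> R by exact: int_dist_ge1.
  have -> : Z = (k%:~R - l%:~R) * (k%:~R ^+ 2 + k%:~R * l%:~R + l%:~R ^+ 2) by rewrite /Z; ring.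
  rewrite normrM; apply: le_trans (ler_wpM2r _ kl1) => //; rewrite mul1r.
  apply: le_trans (ler_norm _).
  have -> : S ^+ 2 = 2 * (`|k%:~R| ^+ 2 + `|l%:~R| ^+ 2) - (`|k%:~R| - `|l%:~R|) ^+ 2.
    by rewrite /S; ring.
  rewrite !real_normK ?num_real//.
  have := sqr_ge0 (k%:~R + l%:~R : R); have := sqr_ge0 (`|k%:~R| - `|l%:~R| : R).
  set kk : R := k%:~R; set ll : R := l%:~R; nra.
have eE : S * (2 * w / y0 ^+ 2) <= `|Z| / (2 * X1).
  rewrite ler_pdivlMr; last exact: mulr_gt0.
  apply: le_trans ZS; rewrite ler_pdivlMr//.
  have -> : S * (2 * w / y0 ^+ 2) * (2 * X1) * 4 = S * K0 by rewrite /K0; ring.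
  by rewrite expr2 ler_wpM2l// addr_ge0.
have main : `|Z| / (2 * X1) <= `|k%:~R ^+ 3 * h k - l%:~R ^+ 3 * h l|.
  have e1 := err k; have e2 := err l.
  have -> : k%:~R ^+ 3 * h k - l%:~R ^+ 3 * h l = Z * H +
     ((k%:~R ^+ 3 * h k - k%:~R ^+ 3 * H) - (l%:~R ^+ 3 * h l - l%:~R ^+ 3 * H)).
    by rewrite /Z; ring.
  set x := _ - _ in e1 *; set y := _ - _ in e2 *.
  have H0 : 0 < H by rewrite invr_gt0.
  have T1 : `|Z * H| <= `|Z * H + (x - y)| + `|x - y|.
    by rewrite -{1}[Z * H](addrK (x - y)); exact: ler_normB.
  have T2 : `|x - y| <= `|x| + `|y| by exact: ler_normB.
  rewrite normrM (gtr0_norm H0) in T1.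
  have T3 : `|Z| / X1 <= `|Z| * H by rewrite ler_wpM2l.
  have T4 : `|Z| / (2 * X1) = `|Z| / X1 / 2 by rewrite invfM mulrA mulrAC.
  have T5 : S * (2 * w / y0 ^+ 2) = `|k%:~R| * (2 * w / y0 ^+ 2) + `|l%:~R| * (2 * w / y0 ^+ 2).
    by rewrite /S mulrDl.
  lra.
set Y := k%:~R ^+ 3 * h k - l%:~R ^+ 3 * h l in main *.
rewrite normrM (normrM _ Y) (normrM E) (gtr0_norm E0) (@ger0_norm _ 2^-1) ?invr_ge0//.
have -> : E * `|Z| / (4 * X1) * `|d - d'| = E * `|d - d'| * (`|Z| / (2 * X1)) / 2.
  by field; rewrite gt_eqF.
by rewrite ler_pM2r ?invr_gt0// ler_wpM2l// mulr_ge0// ltW.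
Qed.

Lemma continuous_freq p : continuous (fun d => freq a c d r p).
Proof.
move=> d; apply: cvgMr_tmp; apply: cvgD; first exact: cvg_cst.
apply: cvgMl_tmp.
apply: (@continuous_comp _ _ _ (fun d => (p.1%:~R ^+ 2 * (1 - c^-1) + r * c^-1) ^+ 2 + 4 * a * c^-1 * d * p.1%:~R ^+ 4) Num.sqrt).
  apply: cvgD; first exact: cvg_cst.
  by apply: cvgMr_tmp; apply: cvgMl_tmp; exact: cvg_id.
exact: sqrt_continuous.
Qed.

Lemma integral_freq_diff : exists C, forall p p', p.1 != p'.1 ->
  (\int[mu]_(d in `[d1, d2]) ((1 + (freq a c d r p - freq a c d r p') ^+ 2)^-1)%:E <=
   (C * `|p.1%:~R ^+ 3 - p'.1%:~R ^+ 3|^-1)%:E)%E.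
Proof.
(* The first constant is [2 * pi / D] for the slope [D] of [freq_diff_lip]. The second serves the
   pairs below the threshold: the integrand is at most 1 and [|k^3 - l^3| <= |K0|^3]. *)
exists (8 * pi * X1 / E + (d2 - d1) * `|K0| ^+ 3) => p p' pp'.
have C1 : 0 <= 8 * pi * X1 / E by rewrite !mulr_ge0 ?invr_ge0 ?pi_ge0 ?(ltW X10) ?(ltW E0).
have C2 : 0 <= (d2 - d1) * `|K0| ^+ 3 by rewrite mulr_ge0 ?subr_ge0// exprn_ge0.
set Z := _ - p'.1%:~R ^+ 3.
have Z0 : 0 < `|Z| by rewrite normr_gt0 cube_int_neq.
have cf : continuous (fun d => freq a c d r p - freq a c d r p').
  by move=> d; apply: cvgB; exact: continuous_freq.
have [Kk|kK] := leP K0 (`|p.1%:~R| + `|p'.1%:~R|).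
  have D0 : 0 < E * `|Z| / (4 * X1) by apply: divr_gt0; apply: mulr_gt0.
  apply: (le_trans (integral_recip d12 D0 cf _)) => [x y|].
    by rewrite !in_itv /= => xI yI; exact: freq_diff_lip.
  rewrite lee_fin; apply: (@le_trans _ _ (8 * pi * X1 / E / `|Z|)).
    by rewrite le_eqVlt; apply/orP; left; apply/eqP; field; rewrite !gt_eqF.
  by rewrite ler_pM2r ?invr_gt0// lerDl.
apply: (@le_trans _ _ (\int[mu]_(d in `[d1, d2]) (1 : \bar R))%E).
  apply: ge0_le_integral => //.
  - by move=> x _; rewrite lee_fin invr_ge0 addr_ge0// sqr_ge0.
  - apply/measurable_EFinP; apply: measurable_funS (@subsetT _ _) _ => //.
    apply: continuous_measurable_fun => t.
    apply: cvgV; first by rewrite gt_eqF// ltr_pwDl// sqr_ge0.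
    apply: cvgD; first exact: cvg_cst.
    by rewrite expr2; under eq_fun do rewrite expr2; apply: cvgM; exact: cf.
  - by move=> x _; rewrite lee_fin invf_le1 ?lerDl ?sqr_ge0// ltr_pwDl// sqr_ge0.
rewrite integral_cst//= mul1e lebesgue_measure_itv /=.
have -> : (if (d1%:E < d2%:E)%E then (d2%:E - d1%:E)%E else 0%E) = (d2 - d1)%:E.
  by case: ifPn => //; rewrite lte_fin -leNgt => H; rewrite (@le_anti _ _ d1 d2) ?d12// subrr.
rewrite lee_fin mulrDl; apply: ler_wpDl; first by rewrite mulr_ge0// invr_ge0.
rewrite -mulrA ler_peMr ?subr_ge0// ler_pdivlMr// mul1r.
apply: (@le_trans _ _ ((`|p.1%:~R| + `|p'.1%:~R|) ^+ 3)).
  apply: le_trans (ler_normB _ _) _; rewrite !normrX.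
  have := normr_ge0 (p.1%:~R : R); have := normr_ge0 (p'.1%:~R : R).
  set x := `|_|; set y := `|_| => x0 y0'; rewrite -subr_ge0.
  have -> : (y + x) ^+ 3 - (y ^+ 3 + x ^+ 3) = 3 * x * y * (x + y) by ring.
  by rewrite !mulr_ge0// addr_ge0.
apply: lerXn2r; rewrite ?nnegrE ?addr_ge0//.
by apply: le_trans (ltW kK) (ler_norm _).
Qed.

End Interval.

(** Where [k^2 >= 2 w], the cubic term of the trace dominates and [|tau| >= |k|^3 / 2]; elsewhere
    [|k|^3 <= k^4 <= 4 w^2]. *)
Lemma tau_bound k : k != 0 ->
  (1 + tau c r k ^+ 2)^-1 <= (1 + 4 * w ^+ 2) * `|k%:~R ^+ 3|^-1.
Proof.
move=> k0; pose x : R := `|k%:~R|.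
have x1 : 1 <= x by rewrite /x -intr_norm ler1z; lia.
have x0 : 0 < x by exact: lt_le_trans x1.
have E1 : `|tau c r k| = x * `|x ^+ 2 * (1 + c^-1) - w|.
  by rewrite /x -normrM real_normK ?num_real// /tau -/w; congr `|_|; ring.
have c10 : 0 < c^-1 by rewrite invr_gt0.
rewrite normrX -/x ler_pdivlMr ?exprn_gt0// mulrC ler_pdivrMr ?ltr_pwDl ?sqr_ge0//.
rewrite -[tau c r k ^+ 2]real_normK ?num_real// E1.
have [xw|xw] := leP (2 * w) (x ^+ 2).
  have H : x ^+ 2 / 2 <= `|x ^+ 2 * (1 + c^-1) - w|.
    have := ler_norm (x ^+ 2 * (1 + c^-1) - w).
    have : 0 <= x ^+ 2 * c^-1 by rewrite mulr_ge0 ?sqr_ge0// ltW.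
    rewrite mulrDr mulr1; lra.
  set y := `|_| in H *.
  have H2 : x ^+ 3 <= 2 * (x * y).
    by rewrite exprS [leRHS]mulrCA ler_pM2l//; lra.
  apply: (@le_trans _ _ (1 + (x * y) ^+ 2)).
    by have := sqr_ge0 (1 - x * y); lra.
  by rewrite ler_peMl ?addr_ge0 ?sqr_ge0// lerDl mulr_ge0 ?sqr_ge0.
apply: (@le_trans _ _ (4 * w ^+ 2)).
  have -> : 4 * w ^+ 2 = (2 * w) ^+ 2 by ring.
  apply: (@le_trans _ _ (x ^+ 2 ^+ 2)).
    by rewrite -exprM ler_weXn2l.
  have w20 : 0 <= 2 * w by apply: mulr_ge0 => //; exact: ltW.
  by rewrite ler_pXn2r ?nnegrE ?sqr_ge0// ltW.
have P : 0 <= (x * `|x ^+ 2 * (1 + c^-1) - w|) ^+ 2 by exact: sqr_ge0.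
have := sqr_ge0 w; nra.
Qed.

Lemma countable_quadratic (x y z : R) : (x != 0) || (y != 0) ->
  countable [set d : R | x * d ^+ 2 + y * d + z = 0].
Proof.
move=> xy; set A := [set _ | _].
have [->|/set0P[d0 Ad0]] := eqVneq A set0; first exact: countable0.
apply: (@sub_countable _ _ _ [set d0; - (y / x) - d0]); last first.
  by apply: finite_set_countable; exact: finite_set2.
apply: subset_card_le => d Ad.
have [->|dd] := eqVneq d d0; [by left|right].
have H : (d - d0) * (x * (d + d0) + y) = 0.
  have -> : (d - d0) * (x * (d + d0) + y) =
    (x * d ^+ 2 + y * d + z) - (x * d0 ^+ 2 + y * d0 + z) by ring.
  by rewrite Ad Ad0 subrr.
move/eqP: H; rewrite mulf_eq0 subr_eq0 (negbTE dd) /= => /eqP H.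
have x0 : x != 0.
  by apply: contraTneq xy => x0; move: H; rewrite x0 mul0r add0r => ->; rewrite eqxx.
have : d + d0 = - (y / x).
  by apply: (mulfI x0); apply/eqP; rewrite -subr_eq0 -H; apply/eqP; field.
by move=> <-; rewrite addrK.
Qed.

(** Squaring twice removes both square roots and leaves a quadratic equation in [d] with leading
    coefficient [E^2 (k^6 - l^6)^2]. This vanishes only for [k = - l], where the two roots coincide
    and a single squaring gives a linear equation. *)
Lemma freq_eq_countable p p' : p.1 != p'.1 ->
  countable [set d | 0 < d /\ freq a c d r p = freq a c d r p'].
Proof.
move=> pp'; pose k : R := p.1%:~R; pose l : R := p'.1%:~R.
have kl : k != l by rewrite eqr_int.
pose t := tau c r (mode p) - tau c r (mode p').
pose A1 := k ^+ 2 * (k ^+ 2 * u + w) ^+ 2; pose A2 := l ^+ 2 * (l ^+ 2 * u + w) ^+ 2.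
pose B1 := E * k ^+ 6; pose B2 := E * l ^+ 6.
have main d : 0 < d -> freq a c d r p = freq a c d r p' ->
    let P1 := A1 + B1 * d in let P2 := A2 + B2 * d in
    (P1 - P2) ^+ 2 - 2 * t ^+ 2 * (P1 + P2) + t ^+ 4 = 0 /\
    (k = - l -> 4 * P1 - t ^+ 2 = 0).
  move=> d0 H P1 P2.
  set Q := disc_sqrt a c d r p.1; set Q' := disc_sqrt a c d r p'.1.
  have eQ : Q ^+ 2 = (k ^+ 2 * u + w) ^+ 2 + E * d * k ^+ 4 by rewrite /Q disc_sqr.
  have eQ' : Q' ^+ 2 = (l ^+ 2 * u + w) ^+ 2 + E * d * l ^+ 4 by rewrite /Q' disc_sqr.
  have H0 : t = l * Q' - k * Q.
    have : freq a c d r p * 2 = freq a c d r p' * 2 by rewrite H.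
    rewrite /freq !divfK ?pnatr_eq0// -/k -/l -/Q -/Q' /t => H2; lra.
  have eP1 : P1 = (k * Q) ^+ 2.
    by rewrite exprMn eQ /P1 /A1 /B1; ring.
  have eP2 : P2 = (l * Q') ^+ 2.
    by rewrite exprMn eQ' /P2 /A2 /B2; ring.
  split; first by rewrite eP1 eP2 H0; ring.
  move=> kl'; have QQ : Q = Q'.
    by rewrite /Q /Q' /disc_sqrt -/k -/l kl'; congr Num.sqrt; ring.
  by rewrite eP1 H0 -QQ kl'; ring.
have [kl'|kl'] := eqVneq k (- l).
  have k0 : k != 0.
    by apply: contra_neq kl => k0; move: kl'; rewrite k0 => /eqP; rewrite eq_sym oppr_eq0 => /eqP ->.
  apply: (sub_countable _ (@countable_quadratic 0 (4 * B1) (4 * A1 - t ^+ 2) _)).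
    apply: subset_card_le => d [d0 H] /=; have [_ H2] := main d d0 H.
    by rewrite -[RHS](H2 kl'); ring.
  rewrite eqxx /=; apply: mulf_neq0; first by rewrite pnatr_eq0.
  by apply: mulf_neq0; [rewrite gt_eqF|rewrite expf_neq0].
apply: (sub_countable _ (@countable_quadratic ((B1 - B2) ^+ 2)
  (2 * (A1 - A2) * (B1 - B2) - 2 * t ^+ 2 * (B1 + B2))
  ((A1 - A2) ^+ 2 - 2 * t ^+ 2 * (A1 + A2) + t ^+ 4) _)).
  apply: subset_card_le => d [d0 H] /=; have [H2 _] := main d d0 H.
  by rewrite -[RHS]H2; ring.
apply/orP; left; rewrite expf_neq0//.
have -> : B1 - B2 = E * ((k - l) * (k + l) * (((k ^+ 2 + l ^+ 2) ^+ 2 * 3 + (k ^+ 2 - l ^+ 2) ^+ 2) / 4)).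
  by rewrite /B1 /B2; field.
have kl2 : k + l != 0 by rewrite -[l]opprK subr_eq0.
have P : 0 < (k ^+ 2 - l ^+ 2) ^+ 2.
  by rewrite exprn_even_gt0//= subr_sqr mulf_neq0// subr_eq0.
apply: mulf_neq0; first by rewrite (gt_eqF E0).
rewrite mulf_neq0 ?mulf_neq0 ?subr_eq0//.
by rewrite gt_eqF//; have := sqr_ge0 (k ^+ 2 + l ^+ 2); lra.
Qed.

Definition freq_box N : seq (int * bool) :=
  [seq p <- [seq (k, b) | k <- freqs N, b <- [:: true; false]] | admissible p].

(** The summand 1 keeps the terms continuous and bounded in [d] across coincidences of frequencies;
    [gap_sum_bounded] removes it afterwards. *)
Definition freq_energy d N :=
  \sum_(p <- freq_box N) \sum_(p' <- freq_box N | p != p')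
    (1 + (freq a c d r p - freq a c d r p') ^+ 2)^-1.

Lemma freq_box_uniq N : uniq (freq_box N).
Proof. by rewrite filter_uniq// allpairs_uniq ?freqs_uniq// => -[? ?] [? ?]. Qed.

Lemma mem_freq_box N p : (p \in freq_box N) = admissible p && (absz p.1 <= N)%N.
Proof.
rewrite mem_filter; congr (_ && _).
apply/allpairsP/idP => [[[k' b'] /= [kN _ ->]]|kN]; first by rewrite -mem_freqs.
by exists p; rewrite mem_freqs kN -surjective_pairing; case: p.2.
Qed.

Let recip_ge0 (x : R) : 0 <= (1 + x ^+ 2)^-1.
Proof. by rewrite invr_ge0 addr_ge0// sqr_ge0. Qed.

Lemma freq_energy_ge0 d N : 0 <= freq_energy d N.
Proof. by apply: sumr_ge0 => p _; apply: sumr_ge0. Qed.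

Lemma energy_subset (lam : int * bool -> R) (s1 s2 : seq (int * bool)) :
  uniq s1 -> uniq s2 -> {subset s1 <= s2} ->
  \sum_(p <- s1) \sum_(p' <- s1 | p != p') (1 + (lam p - lam p') ^+ 2)^-1 <=
  \sum_(p <- s2) \sum_(p' <- s2 | p != p') (1 + (lam p - lam p') ^+ 2)^-1.
Proof.
move=> u1 u2 sub.
apply: (@le_trans _ _ (\sum_(p <- s1) \sum_(p' <- s2 | p != p') (1 + (lam p - lam p') ^+ 2)^-1)).
  apply: ler_sum => p _; rewrite -big_filter -[leRHS]big_filter; apply: sum_subset_le => //.
  - exact: filter_uniq.
  - exact: filter_uniq.
  - by move=> q; rewrite !mem_filter => /andP[-> /sub].
apply: sum_subset_le => // p; exact: sumr_ge0.
Qed.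

Lemma freq_energy_homo d N N' : (N <= N')%N -> freq_energy d N <= freq_energy d N'.
Proof.
move=> NN; apply: energy_subset; rewrite ?freq_box_uniq// => p.
by rewrite !mem_freq_box => /andP[-> /leq_trans]; apply.
Qed.

Lemma continuous_freq_row N p :
  continuous (fun d => \sum_(p' <- freq_box N | p != p')
    (1 + (freq a c d r p - freq a c d r p') ^+ 2)^-1).
Proof.
rewrite (_ : (fun d => _) = (fun d => \sum_(p' <- [seq p' <- freq_box N | p != p'])
    (1 + (freq a c d r p - freq a c d r p') ^+ 2)^-1)); last first.
  by apply/funext => d; rewrite big_filter.
apply: continuous_bigsum => p' d.
apply: cvgV; first by rewrite gt_eqF// ltr_pwDl// sqr_ge0.
apply: cvgD; first exact: cvg_cst.
by rewrite expr2; under eq_fun do rewrite expr2; apply: cvgM; apply: cvgB; exact: continuous_freq.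
Qed.

Lemma continuous_freq_energy N : continuous (freq_energy ^~ N).
Proof. by apply: continuous_bigsum => p; exact: continuous_freq_row. Qed.

Lemma measurable_recip_freq p p' d1 d2 :
  measurable_fun `[d1, d2] (fun d => ((1 + (freq a c d r p - freq a c d r p') ^+ 2)^-1)%:E).
Proof.
apply/measurable_EFinP; apply: measurable_funS (@subsetT _ _) _ => //.
apply: continuous_measurable_fun => d.
apply: cvgV; first by rewrite gt_eqF// ltr_pwDl// sqr_ge0.
apply: cvgD; first exact: cvg_cst.
by rewrite expr2; under eq_fun do rewrite expr2; apply: cvgM; apply: cvgB; exact: continuous_freq.
Qed.

(** On a common branch [k] the terms [k * disc_sqrt] cancel and, the trace being odd in [k], the
    difference is [tau c r k] up to sign: the integrand is constant in [d]. *)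
Lemma integral_freq_diff_eq d1 d2 p p' : 0 < d1 -> d1 <= d2 ->
  admissible p -> admissible p' -> p != p' -> p.1 = p'.1 ->
  (\int[mu]_(d in `[d1, d2]) ((1 + (freq a c d r p - freq a c d r p') ^+ 2)^-1)%:E <=
   ((d2 - d1) * (1 + 4 * w ^+ 2) * `|p.1%:~R ^+ 3|^-1)%:E)%E.
Proof.
case: p p' => k b [k' b'] /= d10 d12 adp adp' pp' kk'; rewrite -{}kk' in adp' pp' *.
(* Only one index with first component 0 is admissible. *)
have k0 : k != 0.
  apply: contraNneq pp' => k0; rewrite /admissible k0 eqxx /= in adp adp'.
  by rewrite xpair_eqE eqxx adp adp'.
have bb' : b' = ~~ b by move: pp'; rewrite xpair_eqE eqxx /=; case: b b' {adp adp'} => -[].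
have E1 d : (1 + (freq a c d r (k, b) - freq a c d r (k, b')) ^+ 2)^-1 = (1 + tau c r k ^+ 2)^-1.
  congr (1 + _)^-1; rewrite /freq /mode /tau bb' /=.
  by case: b {adp adp' pp' bb'} => /=; rewrite !mulrNz; field; rewrite gt_eqF.
under eq_integral do rewrite E1.
rewrite integral_cst//= lebesgue_measure_itv /=.
have -> : (if (d1%:E < d2%:E)%E then (d2%:E - d1%:E)%E else 0%E) = (d2 - d1)%:E.
  by case: ifPn => //; rewrite lte_fin -leNgt => H; rewrite (@le_anti _ _ d1 d2) ?d12// subrr.
rewrite -EFinM lee_fin -mulrA mulrC ler_wpM2l ?subr_ge0//.
exact: tau_bound.
Qed.

Lemma integral_freq_energy d1 d2 : 0 < d1 -> d1 <= d2 ->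
  exists C, forall N, (\int[mu]_(d in `[d1, d2]) (freq_energy d N)%:E <= C%:E)%E.
Proof.
move=> d10 d12; have [C HC] := integral_freq_diff d10 d12.
pose C' := (d2 - d1) * (1 + 4 * w ^+ 2).
have C'0 : 0 <= C' by rewrite mulr_ge0 ?subr_ge0// addr_ge0// mulr_ge0 ?sqr_ge0.
pose b (k l : int) := `|C| * (if k != l then `|k%:~R ^+ 3 - l%:~R ^+ 3|^-1 else 0)
   + (if k == l then C' * `|k%:~R ^+ 3|^-1 else 0) : R.
have b0 k l : 0 <= b k l.
  rewrite /b; apply: addr_ge0; first by apply: mulr_ge0 => //; case: ifP; rewrite ?invr_ge0.
  by case: ifP => // _; rewrite mulr_ge0 ?invr_ge0.
(* The factor 4 counts the pairs of booleans above a pair [(k, l)]; 64 * 36 comes from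
   [sum_cube_diff], once for [k != l] and once for the diagonal. *)
exists (4 * (`|C| * (64 * 36) + C' * (64 * 36))) => N.
under eq_integral do rewrite -sumEFin.
rewrite ge0_integral_sum//; last first.
- by move=> p d _; rewrite lee_fin; exact: sumr_ge0.
- move=> p; apply/measurable_EFinP; apply: measurable_funS (@subsetT _ _) _ => //.
  by apply: continuous_measurable_fun; exact: continuous_freq_row.
apply: (@le_trans _ _ (\sum_(p <- freq_box N) \sum_(p' <- freq_box N) (b p.1 p'.1)%:E)%E).
  rewrite big_seq [leRHS]big_seq; apply: lee_sum => p; rewrite mem_freq_box => /andP[adp _].
  under eq_integral do rewrite -sumEFin -big_filter.
  rewrite ge0_integral_sum//; last first.
  - by move=> p' d _; rewrite lee_fin.
  - by move=> p'; exact: measurable_recip_freq.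
  rewrite big_filter [leLHS]big_mkcond big_seq [leRHS]big_seq /=.
  apply: lee_sum => p'; rewrite mem_freq_box => /andP[adp' _].
  case: ifPn => [pp'|_]; last by rewrite lee_fin.
  have [kk'|kk'] := eqVneq p.1 p'.1.
    apply: (le_trans (integral_freq_diff_eq d10 d12 adp adp' pp' kk')).
    by rewrite lee_fin /b kk' eqxx /= mulr0 add0r.
  apply: (le_trans (HC _ _ kk')); rewrite lee_fin /b kk' (negbTE kk') addr0.
  by rewrite ler_wpM2r ?invr_ge0// ler_norm.
under eq_bigr do rewrite sumEFin.
rewrite sumEFin lee_fin.
have full (F : int * bool -> R) : (forall p, 0 <= F p) ->
    \sum_(p <- freq_box N) F p <= \sum_(k <- freqs N) (F (k, true) + F (k, false)).
  move=> F0; rewrite big_filter big_mkcond /=.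
  apply: (@le_trans _ _ (\sum_(p <- [seq (k, b) | k <- freqs N, b <- [:: true; false]]) F p)).
    by apply: ler_sum => p _; case: ifP.
  rewrite big_allpairs_dep; apply: ler_sum => k _.
  by rewrite !big_cons big_nil /= addr0.
apply: (le_trans (full _ _)) => [p|]; first exact: sumr_ge0.
have E2 k : \sum_(p' <- freq_box N) b k p'.1 <= 2 * \sum_(l <- freqs N) b k l.
  apply: (le_trans (full _ _)) => //; rewrite mulr_sumr; apply: ler_sum => l _ /=; lra.
apply: (@le_trans _ _ (\sum_(k <- freqs N) (4 * \sum_(l <- freqs N) b k l))).
  apply: ler_sum => k _ /=; have := E2 k; lra.
rewrite -mulr_sumr ler_pM2l//.
under eq_bigr do rewrite big_split /= -mulr_sumr -big_mkcond.
rewrite big_split /= -mulr_sumr; apply: lerD.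
  by rewrite ler_wpM2l// sum_cube_diff ?freqs_uniq.
(* The sum of [|k|^-3] is read as a double sum with [l] restricted to 0, so that [sum_cube_diff]
   applies again. The term [k = 0] contributes 0, the inverse of 0 being 0. *)
apply: (@le_trans _ _ (C' * \sum_(k <- freqs N) \sum_(l <- [:: 0] | k != l) `|k%:~R ^+ 3 - l%:~R ^+ 3|^-1)).
  rewrite mulr_sumr big_seq [leRHS]big_seq; apply: ler_sum => k kN.
  rewrite -big_mkcond /= -big_filter (perm_big [:: k]); last first.
    apply: uniq_perm; rewrite ?filter_uniq ?freqs_uniq// => l.
    by rewrite mem_filter inE eq_sym andb_idr// => /eqP ->.
  rewrite big_seq1 big_mkcond big_seq1 expr0n /= subr0.
  by have [->|] := eqVneq k 0; rewrite ?expr0n /= ?normr0 ?invr0// mulr0.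
by rewrite ler_wpM2l// sum_cube_diff ?freqs_uniq.
Qed.

(** The energies increase with [N] and their integrals over a compact interval of [d] are bounded.
    By monotone convergence the limit is integrable, hence finite almost everywhere; the intervals
    [[1/(n+1), n+1]] exhaust the positive [d]. *)
Lemma freq_energy_ae : mu.-negligible
  [set d | 0 < d /\ forall M : nat, exists N, M%:R < freq_energy d N].
Proof.
pose A := [set d : R | forall M : nat, exists N, M%:R < freq_energy d N].
have bad d1 d2 : 0 < d1 -> d1 <= d2 -> mu.-negligible (`[d1, d2] `&` A).
  move=> d10 d12; have [C HC] := integral_freq_energy d10 d12.
  have mI : measurable (`[d1, d2] : set R) by exact: measurable_itv.
  pose g n d := (freq_energy d n)%:E.
  have mg n : measurable_fun `[d1, d2] (g n).
    apply/measurable_EFinP; apply: measurable_funS (@subsetT _ _) _ => //.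
    apply: continuous_measurable_fun; exact: continuous_freq_energy.
  have g0 n d : `[d1, d2]%classic d -> (0 <= g n d)%E.
    by move=> _; rewrite lee_fin freq_energy_ge0.
  have gh d : `[d1, d2]%classic d -> {homo g ^~ d : n m / (n <= m)%N >-> (n <= m)%E}.
    by move=> _ n m nm; rewrite lee_fin freq_energy_homo.
  have cvg_g d : cvgn (g ^~ d).
    by apply: ereal_nondecreasing_is_cvgn => n m nm; rewrite lee_fin freq_energy_homo.
  have H := @cvg_monotone_convergence _ _ _ mu _ mI _ mg g0 gh.
  have L0 d : (0 <= limn (g ^~ d))%E.
    by apply: lime_ge => //; apply: nearW => n; rewrite lee_fin freq_energy_ge0.
  have : mu.-integrable `[d1, d2] (fun d => limn (g ^~ d)).
    apply/integrableP; split.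
      apply: (emeasurable_fun_cvg g) => // d _; exact: cvg_g.
    under eq_integral do rewrite gee0_abs//.
    rewrite -(cvg_lim _ H)//; apply: (@le_lt_trans _ _ C%:E); last by rewrite ltry.
    by apply: lime_le; [apply/cvg_ex; eexists; exact: H|exact: nearW].
  move=> i; have [|B [mB B0 subB]] := integrable_ae _ i; first exact: mI.
  exists B; split=> // d [dI Ad]; apply: subB => /= /(_ dI).
  rewrite fin_numElt => /andP[_ lim_lt].
  have : exists M : nat, forall n, freq_energy d n <= M%:R.
    exists (Num.truncn (fine (limn (g ^~ d)))).+1 => n; apply: ltW.
    apply: le_lt_trans (truncnS_gt _).
    rewrite -lee_fin fineK; last by rewrite fin_numElt lim_lt (lt_le_trans _ (L0 d)).
    by apply: lime_ge; [exact: cvg_g|exists n => // m nm; rewrite lee_fin freq_energy_homo].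
  by move=> [M HM]; have [N] := Ad M; rewrite ltNge HM.
have [B [mB B0 sB]] : mu.-negligible (\bigcup_n (`[n.+1%:R^-1, n.+1%:R] `&` A)).
  apply: negligible_bigcup => n; apply: bad; rewrite ?invr_gt0 ?ltr0n//.
  by rewrite (@le_trans _ _ 1) ?invf_le1 ?ler1n ?ltr0n.
exists B; split=> // d [d0 Ad]; apply: sB.
have [n Hn] : exists n, Num.max d d^-1 < n.+1%:R :> R.
  by exists (Num.truncn (Num.max d d^-1)); exact: truncnS_gt.
move: Hn; rewrite gt_max => /andP[h1 h2].
exists n => //; split=> //; rewrite /= in_itv /= (ltW h1) andbT.
by rewrite -[leRHS]invrK lef_pV2 ?posrE ?invr_gt0// ltW.
Qed.

End FixedParameters.

(** Bounded lengths allow a list of maximal length, and maximality forces it to contain every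
    element satisfying [P]. *)
Lemma finite_predicate (T : eqType) (P : pred T) (x : R) :
  (forall s : seq T, uniq s -> all P s -> (size s)%:R <= x) ->
  exists2 s : seq T, uniq s & forall i, P i = (i \in s).
Proof.
move=> H; pose n := Num.truncn x.
have Hn (s : seq T) : uniq s -> all P s -> (size s <= n)%N.
  move=> us Ps; rewrite -ltnS -(ltr_nat R).
  by apply: le_lt_trans (truncnS_gt _); exact: H.
have : exists s : seq T, [/\ uniq s, all P s & forall s', uniq s' -> all P s' -> (size s' <= size s)%N].
  apply: contrapT => /forallNP No.
  have : forall m : nat, exists s : seq T, [/\ uniq s, all P s & (m <= size s)%N].
    elim=> [|m [s [us Ps ms]]]; first by exists [::].
    have /not_and3P[//|//|/existsNP[s' /not_implyP[us' /not_implyP[Ps' /negP]]]] := No s.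
    by rewrite -ltnNge => ss'; exists s'; split=> //; exact: leq_ltn_trans ss'.
  by move=> /(_ n.+1)[s [us Ps]]; rewrite ltnNge Hn.
move=> [s [us Ps Hs]]; exists s => // i; apply/idP/idP => [Pi|/(allP Ps)//].
apply/negPn/negP => is'; have := Hs (i :: s); rewrite /= is' us Pi Ps ltnn.
by move=> /(_ isT isT).
Qed.

(** A pair at distance less than 1 contributes at least [1 / 2] to the sum bounded by [M], so there
    are at most [2 M] such pairs and they add a fixed finite amount. For every other pair,
    [x^-2 <= 2 (1 + x^2)^-1]. *)
Lemma gap_sum_bounded (I : countType) (lam : I -> R) (M : R) : injective lam ->
  (forall s : seq I, uniq s ->
    \sum_(i <- s) \sum_(j <- s | i != j) (1 + (lam i - lam j) ^+ 2)^-1 <= M) ->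
  exists K, forall s : seq I, uniq s -> gap_sum lam s <= K.
Proof.
move=> lam_inj HM.
pose sq (s : seq I) := [seq (i, j) | i <- s, j <- s].
have sumE (F : I -> I -> R) s : \sum_(i <- s) \sum_(j <- s | i != j) F i j =
    \sum_(z <- sq s | z.1 != z.2) F z.1 z.2.
  rewrite [RHS]big_mkcond big_allpairs_dep /=.
  by apply: eq_bigr => i _; rewrite big_mkcond.
have usq s : uniq s -> uniq (sq s) by move=> us; rewrite allpairs_uniq// => -[? ?] [? ?].
pose g (z : I * I) := (1 + (lam z.1 - lam z.2) ^+ 2)^-1.
pose h (z : I * I) := (lam z.1 - lam z.2) ^- 2.
have g0 z : 0 <= g z by rewrite invr_ge0 addr_ge0// sqr_ge0.
have h0 z : 0 <= h z by rewrite invr_ge0 sqr_ge0.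
pose bad (z : I * I) := (z.1 != z.2) && (`|lam z.1 - lam z.2| < 1).
have [|b ub badE] := @finite_predicate _ bad (2 * M).
  move=> b ub /allP badb; pose s := undup (map fst b ++ map snd b).
  have us : uniq s by exact: undup_uniq.
  have bs : {subset b <= [seq z <- sq s | z.1 != z.2]}.
    move=> z zb; rewrite mem_filter; have /andP[-> _] /= := badb z zb.
    apply/allpairsP; exists z; split; rewrite ?mem_undup ?mem_cat ?map_f ?orbT//.
    exact: surjective_pairing.
  have : \sum_(z <- b) g z <= M.
    apply: le_trans (HM s us); rewrite sumE -[leRHS]big_filter.
    by apply: sum_subset_le; rewrite ?filter_uniq ?usq.
  suff : (size b)%:R / 2 <= \sum_(z <- b) g z by lra.
  rewrite -sum1_size natr_sum mulr_suml big_seq [leRHS]big_seq.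
  apply: ler_sum => z zb; rewrite mul1r lef_pV2 ?posrE ?ltr_pwDl ?sqr_ge0//.
  have /andP[_ lt1] := badb z zb.
  rewrite -[X in _ + X]real_normK ?num_real//.
  by have := normr_ge0 (lam z.1 - lam z.2); nra.
exists (2 * M + \sum_(z <- b) h z) => s us.
rewrite /gap_sum sumE (bigID bad) /= addrC; apply: lerD.
  apply: (@le_trans _ _ (\sum_(z <- sq s | z.1 != z.2) 2 * g z)).
    rewrite big_mkcondr /=; apply: ler_sum => z zz; rewrite /bad zz /= -leNgt.
    case: ifPn => [ge1|_]; last by rewrite mulr_ge0.
    have z0 : 0 < `|lam z.1 - lam z.2| by exact: lt_le_trans ge1.
    rewrite /g -real_normK ?num_real//; set y := `|_| in ge1 z0 *.
    have y2 : 1 <= y ^+ 2 by rewrite exprn_ege1.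
    have y20 : 0 < y ^+ 2 by exact: lt_le_trans y2.
    rewrite ler_pdivlMr ?ltr_pwDl ?sqr_ge0// mulrC ler_pdivrMr//; lra.
  by rewrite -mulr_sumr ler_pM2l// -(sumE (fun i j => g (i, j))) HM.
rewrite -[leLHS]big_filter; apply: sum_subset_le; rewrite ?filter_uniq ?usq// => z.
by rewrite mem_filter -badE => /andP[/andP[]].
Qed.
End Frequencies.

(** * Separation of the frequencies for almost all parameters *)

Section ProductNull.
Context d1 d2 (T1 : measurableType d1) (T2 : measurableType d2) (R : realType).
Variables (m1 : {sigma_finite_measure set T1 -> \bar R})
  (m2 : {sigma_finite_measure set T2 -> \bar R}).

Lemma null_xsections A : measurable A -> (forall x, m2 [set y | A (x, y)] = 0%E) ->
  (m1 \x m2)%E A = 0%E.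
Proof.
move=> mA A0; rewrite /product_measure1 integral0_eq// => x _ /=.
rewrite -[RHS](A0 x); congr (m2 _); apply/seteqP.
by split=> y; rewrite /xsection /= inE.
Qed.

Lemma null_ysections A : measurable A -> (forall y, m1 [set x | A (x, y)] = 0%E) ->
  (m1 \x m2)%E A = 0%E.
Proof.
move=> mA A0; rewrite (@product_measure_unique _ _ _ _ _ m1 m2 (m1 \x^ m2)%E)//; last first.
  by move=> B C mB mC; exact: product_measure2E.
rewrite /= /product_measure2 integral0_eq// => y _ /=.
rewrite -[RHS](A0 y); congr (m1 _); apply/seteqP.
by split=> x; rewrite /ysection /= inE.
Qed.

Let product_sigma_finite : sigma_finite setT (m1 \x m2)%E.
Proof.
have [F FT mF] := sigma_finiteT m1; have [G GT mG] := sigma_finiteT m2.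
pose pr n := odflt (0%N, 0%N) (unpickle n).
exists (fun n => F (pr n).1 `*` G (pr n).2) => [|n].
  apply/seteqP; split=> // -[x y] _.
  have [i _ Fi] : (\bigcup_i F i) x by rewrite -FT.
  have [j _ Gj] : (\bigcup_j G j) y by rewrite -GT.
  by exists (pickle (i, j)) => //; rewrite /pr pickleK.
have [mFn Fn] := mF (pr n).1; have [mGn Gn] := mG (pr n).2.
split; first exact: measurableX.
by rewrite product_measure1E// lte_mul_pinfty// ge0_fin_numE.
Qed.

(* The library's canonical sigma-finite structure on [m1 \x m2] is only found
   for subprobability measures. *)
Definition product_sigma_finite_measure :
    {sigma_finite_measure set (T1 * T2)%type -> \bar R} :=
  HB.pack (m1 \x m2)%E (Measure.on (m1 \x m2)%E)
    (Measure_isSigmaFinite.Build _ _ _ (m1 \x m2)%E product_sigma_finite).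

End ProductNull.

Lemma negligible_bigcup_countType d (T : measurableType d) (R : realType)
    (m : {measure set T -> \bar R}) (J : countType) (F : J -> set T) :
  (forall j, m.-negligible (F j)) -> m.-negligible (\bigcup_j F j).
Proof.
move=> F0; pose G n := if unpickle n is Some j then F j else set0.
have [B [mB B0 sB]] : m.-negligible (\bigcup_n G n).
  apply: negligible_bigcup => n; rewrite /G.
  by case: unpickle => [j|]; [exact: F0|exact: negligible_set0].
exists B; split=> // x [j _ Fj]; apply: sB; exists (pickle j) => //.
by rewrite /G pickleK.
Qed.

(** * Exceptional sets of parameters *)

Section AlmostEverywhere.
Variable R : realType.
Local Notation l := (@lebesgue_measure R).
Local Notation l4 := (l \x l \x l \x l)%E.
Local Notation MR := (measurableTypeR R).
Local Notation MR4 := (MR * MR * MR * MR)%type.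

Let section_d (A : set MR4) a c r :
  [set d | A (a, c, d, r)] = xsection (ysection A r) (a, c).
Proof. by apply/seteqP; split=> d; rewrite /xsection/ysection /= !inE /= ?inE. Qed.

(** The product is nested as [((a, c), d), r]: once [r] is fixed, [d] is the last coordinate of what
    remains. *)
Lemma null_section_d (A : set MR4) : measurable A ->
  (forall a c r, l.-negligible [set d | A (a, c, d, r)]) -> l4 A = 0%E.
Proof.
move=> mA A0.
pose l2 := product_sigma_finite_measure l l; pose l3 := product_sigma_finite_measure l2 l.
apply: (@null_ysections _ _ _ _ _ l3 l A mA) => r.
have mr : measurable [set x : MR * MR * MR | A (x, r)].
  rewrite (_ : [set _ | _] = ysection A r); first exact: measurable_ysection.
  by apply/seteqP; split=> x; rewrite /ysection /= inE.
apply: (@null_xsections _ _ _ _ _ l2 l _ mr) => -[a c].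
have := A0 a c r; rewrite negligibleP//= section_d.
exact/measurable_xsection/measurable_ysection.
Qed.

Lemma null_section_r (A : set MR4) : measurable A ->
  (forall a c d, l.-negligible [set r | A (a, c, d, r)]) -> l4 A = 0%E.
Proof.
move=> mA A0.
pose l2 := product_sigma_finite_measure l l; pose l3 := product_sigma_finite_measure l2 l.
apply: (@null_xsections _ _ _ _ _ l3 l A mA) => -[[a c] d].
have := A0 a c d; rewrite negligibleP//=.
rewrite (_ : [set _ | _] = xsection A (a, c, d)); first exact: measurable_xsection.
by apply/seteqP; split=> x; rewrite /xsection /= inE.
Qed.

Let ma : measurable_fun setT (fun q : MR4 => q.1.1.1 : MR).
Proof. by do 2! [apply: (measurableT_comp measurable_fst)]; exact: measurable_fst. Qed.
Let mc : measurable_fun setT (fun q : MR4 => q.1.1.2 : MR).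
Proof. by apply: (measurableT_comp measurable_snd); apply: (measurableT_comp measurable_fst); exact: measurable_fst. Qed.
Let md : measurable_fun setT (fun q : MR4 => q.1.2 : MR).
Proof. by apply: (measurableT_comp measurable_snd); exact: measurable_fst. Qed.
Let mr : measurable_fun setT (fun q : MR4 => q.2 : MR).
Proof. exact: measurable_snd. Qed.

Lemma measurable_inv (d : measure_display) (T : measurableType d) (f : T -> R) :
  measurable_fun setT f -> measurable_fun setT (fun x => (f x)^-1).
Proof.
move=> mf; apply: (@measurableT_comp _ _ _ _ MR MR (fun x => x^-1)) => //.
have -> : [set: MR] = [set 0] `|` ~` [set 0] by rewrite setUv.
have m0 : measurable ([set 0] : set MR) by exact: measurable_set1.
apply/measurable_funU => //; first exact: measurableC.
split; first exact: measurable_fun_set1.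
apply: open_continuous_measurable_fun.
  by rewrite openC; exact: closed_eq.
by move=> x; rewrite inE /= => /eqP x0; exact: inv_continuous.
Qed.

Lemma measurable_freq p : measurable_fun setT
  (fun q : MR4 => freq q.1.1.1 q.1.1.2 q.1.2 q.2 p).
Proof.
have mci := measurable_inv mc.
have cst (x : R) : measurable_fun setT (fun _ : MR4 => x) by exact: measurable_cst.
apply: measurable_funM => //; apply: measurable_funD.
  apply: measurable_funB; first by apply: measurable_funM => //; exact: measurable_funD.
  by apply: measurable_funM => //; exact: measurable_funM.
apply: measurable_funM => //.
apply: (@measurableT_comp _ _ _ _ MR MR Num.sqrt).
  by apply: continuous_measurable_fun; exact: sqrt_continuous.
apply: measurable_funD.
  apply: measurable_funX; apply: measurable_funD; last exact: measurable_funM.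
  by apply: measurable_funM => //; exact: measurable_funB.
apply: measurable_funM => //; apply: measurable_funM => //.
by apply: measurable_funM => //; apply: measurable_funM.
Qed.

Lemma measurable_freq_energy N : measurable_fun setT
  (fun q : MR4 => freq_energy q.1.1.1 q.1.1.2 q.2 q.1.2 N).
Proof.
apply: measurable_sum => p.
rewrite (_ : (fun q => _) = (fun q : MR4 => \sum_(p' <- [seq p' <- freq_box N | p != p'])
  (1 + (freq q.1.1.1 q.1.1.2 q.1.2 q.2 p - freq q.1.1.1 q.1.1.2 q.1.2 q.2 p') ^+ 2)^-1)); last first.
  by apply/funext => q; rewrite big_filter.
apply: measurable_sum => p'; apply: measurable_inv; apply: measurable_funD; first exact: measurable_cst.
by apply: measurable_funX; apply: measurable_funB; exact: measurable_freq.
Qed.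

Definition positive_params : set MR4 :=
  [set q | [/\ 0 < q.1.1.1, 0 < q.1.1.2, 0 < q.1.2 & 0 < q.2]].

Lemma measurable_positive_params : measurable positive_params.
Proof.
have H (f : MR4 -> MR) : measurable_fun setT f -> measurable [set q | 0 < f q].
  move=> mf; rewrite (_ : [set _ | _] = setT `&` f @^-1` `]0, +oo[); last first.
    by apply/seteqP; split=> q; rewrite /= in_itv /= andbT => // -[].
  by apply: mf => //; exact: measurable_itv.
rewrite (_ : positive_params = [set q | 0 < q.1.1.1] `&` [set q | 0 < q.1.1.2] `&`
   [set q | 0 < q.1.2] `&` [set q | 0 < q.2]); last first.
  by apply/seteqP; split=> q /= => [[? ? ? ?]|[[[? ?] ?] ?]].
by do 3! [apply: measurableI; last exact: H]; exact: H.
Qed.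

Definition eigen_index := {p : int * bool | admissible p}.

Definition separated_freqs (a c d r : R) := let lam (i : eigen_index) := freq a c d r (val i) in
  injective lam /\ exists K, forall s : seq eigen_index, uniq s -> gap_sum lam s <= K.

Let bad_energy : set MR4 := positive_params `&`
  \bigcap_(M : nat) \bigcup_N [set q | M%:R < freq_energy q.1.1.1 q.1.1.2 q.2 q.1.2 N].

Let bad_pair (z : (int * bool) * (int * bool)) : set MR4 := positive_params `&`
  [set q | freq q.1.1.1 q.1.1.2 q.1.2 q.2 z.1 = freq q.1.1.1 q.1.1.2 q.1.2 q.2 z.2].

(** For [k != 0] the equation means [tau c r k = 0], the only way for the two frequencies of the
    same branch to coincide. It does not involve [d], which is why [r] is varied instead. *)
Let bad_mode (k : int) : set MR4 := positive_params `&`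
  [set q | q.2 = k%:~R ^+ 2 * (1 + q.1.1.2)].

Let null_bad_energy : l4.-negligible bad_energy.
Proof.
have mA : measurable bad_energy.
  apply: measurableI; first exact: measurable_positive_params.
  apply: bigcap_measurable => [|M _]; first by exists 0%N.
  apply: bigcup_measurable => N _.
  rewrite (_ : [set _ | _] = setT `&` (fun q : MR4 => freq_energy q.1.1.1 q.1.1.2 q.2 q.1.2 N) @^-1` `]M%:R, +oo[); last first.
    by apply/seteqP; split=> q; rewrite /= in_itv /= andbT => // -[].
  by apply: measurable_freq_energy => //; exact: measurable_itv.
exists bad_energy; split=> //; apply: null_section_d => // a c r.
have [[a0 c0 r0]|npos] := pselect [/\ 0 < a, 0 < c & 0 < r].
  have [B [mB B0 sB]] := freq_energy_ae a0 c0 r0.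
  exists B; split=> // d [[/= _ _ d0 _] H]; apply: sB; split=> // M.
  by have [N _ HN] := H M I; exists N.
exists set0; split=> // d [[/= ? ? ? ?] _]; exact: npos.
Qed.

Let null_bad_pair z : z.1.1 != z.2.1 -> l4.-negligible (bad_pair z).
Proof.
move=> z12; have mA : measurable (bad_pair z).
  apply: measurableI; first exact: measurable_positive_params.
  rewrite (_ : [set _ | _] = setT `&` (fun q : MR4 => freq q.1.1.1 q.1.1.2 q.1.2 q.2 z.1 - freq q.1.1.1 q.1.1.2 q.1.2 q.2 z.2) @^-1` [set 0]); last first.
    apply/seteqP; split=> q /=; first by move=> ->; rewrite subrr.
    by move=> [_ /eqP]; rewrite subr_eq0 => /eqP.
  by apply: measurable_funB; [exact: measurable_freq|exact: measurable_freq| |exact: measurable_set1].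
exists (bad_pair z); split=> //; apply: null_section_d => // a c r.
have [[a0 c0 r0]|npos] := pselect [/\ 0 < a, 0 < c & 0 < r].
  have C := @freq_eq_countable _ a c r a0 c0 _ _ z12.
  exists [set d | 0 < d /\ freq a c d r z.1 = freq a c d r z.2]; split.
  - exact: countable_measurable.
  - exact: countable_lebesgue_measure0.
  - by move=> d [[/= _ _ d0 _] H].
exists set0; split=> // d [[/= ? ? ? ?] _]; exact: npos.
Qed.

Let null_bad_mode k : l4.-negligible (bad_mode k).
Proof.
have mA : measurable (bad_mode k).
  apply: measurableI; first exact: measurable_positive_params.
  rewrite (_ : [set _ | _] = setT `&` (fun q : MR4 => q.2 - k%:~R ^+ 2 * (1 + q.1.1.2)) @^-1` [set 0]); last first.
    apply/seteqP; split=> q /=; first by move=> ->; rewrite subrr.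
    by move=> [_ /eqP]; rewrite subr_eq0 => /eqP.
  apply: measurable_funB; [exact: mr| |by []|exact: measurable_set1].
  apply: measurable_funM; first exact: measurable_cst.
  by apply: measurable_funD => //; exact: measurable_cst.
exists (bad_mode k); split=> //; apply: null_section_r => // a c d.
exists [set k%:~R ^+ 2 * (1 + c)]; split.
- exact: measurable_set1.
- exact: lebesgue_measure_set1.
- by move=> r [_ /= ->].
Qed.

Lemma separated_ae : l4.-negligible (~` [set q : MR4 | positive_params q ->
  separated_freqs q.1.1.1 q.1.1.2 q.1.2 q.2]).
Proof.
pose B1 z := if z.1.1 != z.2.1 then bad_pair z else set0.
pose m4 : {measure set MR4 -> \bar R} := l4.
have [B [mB B0 sB]] : m4.-negligible (bad_energy `|` (\bigcup_z B1 z `|` \bigcup_k bad_mode k)).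
  apply: negligibleU => //; apply: negligibleU; apply: negligible_bigcup_countType => //.
  rewrite /B1 => z; case: ifPn => // z12; first exact: null_bad_pair.
  exact: (@negligible_set0 _ _ _ m4).
exists B; split=> // -[[[a c] d] r] /=; apply: contra_notP => /= nB.
move: (contra_not (@sB _) nB) => {mB B0 sB nB B} nB pq; have [/= a0 c0 d0 r0] := pq.
have inj p p' : admissible p -> admissible p' -> freq a c d r p = freq a c d r p' -> p = p'.
  move=> adp adp' H; have [pp'|pp'] := eqVneq p.1 p'.1; last first.
    exfalso; apply: nB; right; left; exists (p, p') => //.
    by rewrite /B1 /= pp'.
  case: p p' => k b [k' b'] /= in pp' H adp adp' *; rewrite -{}pp' in H adp' *.
  have [->//|bb] := eqVneq b b'.
  have k0 : k != 0.
    apply: contraNneq bb => k0; rewrite /admissible k0 eqxx /= in adp adp'.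
    by rewrite adp adp'.
  exfalso; apply: nB; right; right; exists k => //.
  split=> //=.
  have bE : b' = ~~ b by case: b b' bb {H adp adp'} => -[].
  have kR : k%:~R != 0 :> R by rewrite intr_eq0.
  have T0 : tau c r k = 0.
    move: H; rewrite bE /freq /mode /tau /= => /(congr1 ( *%R^~ 2)).
    rewrite !divfK ?pnatr_eq0// => /addIr.
    by case: b {adp adp' bb bE} => /=; rewrite mulrNz => H; lra.
  move: T0; rewrite /tau => T0; apply/eqP; rewrite -subr_eq0.
  have : k%:~R * (r - k%:~R ^+ 2 * (1 + c)) = - c * (k%:~R ^+ 3 * (1 + c^-1) - r * c^-1 * k%:~R).
    by field; rewrite gt_eqF.
  by rewrite T0 mulr0 => /eqP; rewrite mulf_eq0 (negbTE kR).
split; first by move=> i j H; apply: val_inj; apply: inj; rewrite ?(valP i) ?(valP j).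
have [M HM] : exists M : nat, forall N, freq_energy a c r d N <= M%:R.
  apply: contrapT => /forallNP H; apply: nB; left; split=> // M _.
  by have /existsNP[N /negP] := H M; rewrite -ltNge => HN; exists N.
apply: (@gap_sum_bounded _ _ _ M%:R).
  by move=> i j H; apply: val_inj; apply: inj; rewrite ?(valP i) ?(valP j).
move=> s us; pose N := \max_(i <- s) absz (val i).1.
apply: le_trans (HM N).
rewrite -(big_map val xpredT (fun p => \sum_(j <- s | p != val j) (1 + (freq a c d r p - freq a c d r (val j)) ^+ 2)^-1)).
under eq_bigr do rewrite -(big_map val (fun p' => _ != p') (fun p' => (1 + (freq a c d r _ - freq a c d r p') ^+ 2)^-1)).
apply: energy_subset; [by rewrite (map_inj_uniq val_inj)|exact: freq_box_uniq|].
move=> _ /mapP[i si ->]; rewrite mem_freq_box (valP i) /=.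
exact: (@leq_bigmax_seq _ s xpredT (fun i => absz (val i).1)).
Qed.

End AlmostEverywhere.

(** * Fourier modes of the adjoint system *)

Section AdjointModes.
Variable R : realType.
Local Notation mu := (@lebesgue_measure R).
Local Notation T := (@circle R).
Local Notation mT := (@measurable_circle R).
Local Notation mR := (@measurableT _ (measurableTypeR R)).
Implicit Types (phi psi : R -> R -> R[i]) (k : int) (f g : R -> R).

Lemma cts_of_nsq (h : R -> R[i]) (t0 : R) :
  (forall eps : R, 0 < eps -> \forall t \near t0, nsq (h t - h t0) <= eps) ->
  {for t0, continuous (fun t => complex.Re (h t))} /\
  {for t0, continuous (fun t => complex.Im (h t))}.
Proof.
move=> H; split; apply/cvgrPdist_le => eps eps0.
  have e2 : 0 < eps ^+ 2 by rewrite exprn_gt0.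
  near=> t; rewrite distrC -(@ler_pXn2r _ 2) ?nnegrE ?(ltW eps0)// real_normK ?num_real//.
  have : nsq (h t - h t0) <= eps ^+ 2 by near: t; exact: H.
  by apply: le_trans; have := Re_le_nsq (h t - h t0); rewrite !cE.
have e2 : 0 < eps ^+ 2 by rewrite exprn_gt0.
near=> t; rewrite distrC -(@ler_pXn2r _ 2) ?nnegrE ?(ltW eps0)// real_normK ?num_real//.
have : nsq (h t - h t0) <= eps ^+ 2 by near: t; exact: H.
by apply: le_trans; have := Im_le_nsq (h t - h t0); rewrite !cE.
Unshelve. all: by end_near. Qed.

Lemma pairing_continuous phi (w : R -> R[i]) : continuous_L2T phi -> L2T w ->
  continuous (fun t => complex.Re (pairing (phi t) w)) /\
  continuous (fun t => complex.Im (pairing (phi t) w)).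
Proof.
move=> [Lphi cphi] Lw.
suff H t0 : forall eps : R, 0 < eps ->
    \forall t \near t0, nsq (pairing (phi t) w - pairing (phi t0) w) <= eps.
  by split=> t0; have [] := cts_of_nsq (H t0).
move=> eps eps0.
have W0 : 0 < norm2 T w + 1 by rewrite ltr_wpDl// norm2_ge0.
have /fine_cvgP[_ /cvgrPdist_lt H] := cphi t0.
have e0 : 0 < eps / (norm2 T w + 1) by rewrite divr_gt0.
near=> t.
have LD : L2T (fun x => phi t x - phi t0 x) by apply: (L2B mT); exact: Lphi.
have : `|0 - fine (sqnorm T (fun x => phi t x - phi t0 x))| < eps / (norm2 T w + 1).
  by near: t; exact: H.
rewrite sub0r normrN (sqnormE mT LD) /= ger0_norm ?norm2_ge0// => Hlt.
have -> : pairing (phi t) w - pairing (phi t0) w =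
    pairing (fun x => phi t x - phi t0 x) w.
  rewrite /pairing -(cintegralB mT)//; [|exact: (L2_mul mT (Lphi _) Lw)..].
  by apply: eq_cintegral => x _; rewrite mulrBl.
apply: le_trans (integral_CauchySchwarz mT LD Lw) _.
apply: (@le_trans _ _ (eps / (norm2 T w + 1) * norm2 T w)).
  by rewrite ler_wpM2r ?norm2_ge0// ltW.
by rewrite mulrAC ler_pdivrMr// ler_wpM2l// ?(ltW eps0)// lerDl.
Unshelve. all: by end_near. Qed.

Lemma fourier_coef_continuous phi k : continuous_L2T phi ->
  continuous (fun t => complex.Re (fourier_coef (phi t) k)) /\
  continuous (fun t => complex.Im (fourier_coef (phi t) k)).
Proof.
move=> cphi; have Le : L2T (fun x : R => ((2 * pi)^-1)%:C * expi ((- k)%:~R * x)).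
  by apply: (L2Z mT); exact: L2_expi_int.
have E t : fourier_coef (phi t) k = pairing (phi t) (fun x => ((2 * pi)^-1)%:C * expi ((- k)%:~R * x)).
  rewrite /fourier_coef /pairing -(cintegralZ mT)//; last first.
    by apply: (L2_mul mT); [exact: cphi.1|under eq_fun do rewrite -mulNr -intrN; exact: L2_expi_int].
  by apply: eq_cintegral => x _; rewrite mulrCA intrN mulNr.
have [c1 c2] := pairing_continuous cphi Le.
by split; under eq_fun do rewrite E.
Qed.

(** Test functions are real, so the exponential of mode [k] is reached through this two-parameter
    family, which is closed under differentiation. *)
Definition trig (x y : R) k : R -> R := fun t => x * cos (k%:~R * t) + y * sin (k%:~R * t).

Lemma smooth_trig x y k : smooth (trig x y k).
Proof. by move=> n; exact: CnR_trig. Qed.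

Lemma trig_periodic x y k : periodic (trig x y k) (2 * pi).
Proof.
by move=> t; have /(congr1 (@complex.Re R)) /= E1 := expi_int k t;
  have /(congr1 (@complex.Im R)) /= E2 := expi_int k t; rewrite /trig E1 E2.
Qed.

Lemma is_derive_trig x y k (t : R) : is_derive t (1 : R) (trig x y k)
  (trig (k%:~R * y) (- (k%:~R * x)) k t).
Proof.
have H := is_deriveD (is_deriveZ x (is_derive_cosM k%:~R t)) (is_deriveZ y (is_derive_sinM k%:~R t)).
apply: (@is_derive_eq _ _ _ _ _ _ _ _ H).
by rewrite /trig /GRing.scale /=; ring.
Qed.

Lemma dx_mul f x y k : dx (fun t z => f t * trig x y k z) =
  (fun t z => f t * trig (k%:~R * y) (- (k%:~R * x)) k z).
Proof.
apply/funext => t; apply/funext => z; rewrite /dx derive1E.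
have := is_deriveZ (f t) (is_derive_trig x y k z).
by move=> /@derive_val ->.
Qed.

Lemma dt_mul f f' g : (forall t : R, is_derive t (1 : R) f (f' t)) ->
  dt (fun t z => f t * g z) = (fun t z => f' t * g z).
Proof.
move=> df; apply/funext => t; apply/funext => z; rewrite /dt derive1E.
have := is_deriveZ (g z) (df t).
rewrite (_ : (fun s => f s * g z) = g z \*: f); last first.
  by apply/funext => s; rewrite /= mulrC.
by move=> /@derive_val ->; rewrite mulrC.
Qed.

Lemma test_function_trig f x y k : bump_test f -> test_function (fun t z => f t * trig x y k z).
Proof.
move=> [sf [N fN]]; split.
- exact/(smooth_Cn sf)/smooth_trig.
- by move=> t z /=; rewrite trig_periodic.
- by exists N => t z /fN ->; rewrite mul0r.
Qed.

Lemma L2_trig x y k : L2T (fun z => (trig x y k z)%:C).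
Proof.
apply: (@eq_L2 _ _ mT (fun z => 1 * (trig x y k z)%:C)) => [z _|]; first by rewrite mul1r.
apply: (@L2_mul_bounded _ _ _ _ ((`|x| + `|y|) ^+ 2)) => //.
- exact: mT.
- by apply: L2_cst; [exact: mT|exact: circle_finite].
- apply: cmeasurable_continuous; apply: (@CnR_continuous _ 0); exact: smooth_trig.
- move=> z _; rewrite nsqR -real_normK ?num_real// ler_pXn2r ?nnegrE ?addr_ge0//.
  apply: le_trans (ler_normD _ _) _; rewrite !normrM; apply: lerD.
    by rewrite ler_piMr// cos_max.
  by rewrite ler_piMr// sin_max.
Qed.

Lemma pairing_trig phi x y k t : continuous_L2T phi ->
  pairing (phi t) (fun z => (trig x y k z)%:C) =
  x%:C * pairing (phi t) (fun z => (trig 1 0 k z)%:C) +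
  y%:C * pairing (phi t) (fun z => (trig 0 1 k z)%:C).
Proof.
move=> [Lphi _]; have Lp := L2_mul mT (Lphi t) (L2_trig _ _ k).
rewrite /pairing -!(cintegralZ mT)// -(cintegralD mT)//; [|exact: (cintegrableZ mT)..].
apply: eq_cintegral => z _; rewrite /trig !mul1r !mul0r addr0 add0r.
by apply: complex_eqP; rewrite !cE /=; ring.
Qed.

Section TestIntegrals.
Variables (h : R -> R[i]) (f : R -> R) (N : R).
Hypotheses (ch : continuous (fun t => complex.Re (h t)) /\ continuous (fun t => complex.Im (h t))).
Hypotheses (cf : continuous f) (fN : forall t, N < `|t| -> f t = 0).

Lemma cintegrable_test : cintegrable setT (fun t => h t * (f t)%:C).
Proof.
split.
  rewrite (_ : (fun x => _) = (fun t => complex.Re (h t) * f t)); last first.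
    by apply/funext => t; rewrite !cE /= mulr0 subr0.
  apply: (@compact_support_integrable _ _ N) => [t|t /fN ->]; last by rewrite mulr0.
  by apply: cvgM; [exact: ch.1|exact: cf].
rewrite (_ : (fun x => _) = (fun t => complex.Im (h t) * f t)); last first.
  by apply/funext => t; rewrite !cE /= mulr0 add0r.
apply: (@compact_support_integrable _ _ N) => [t|t /fN ->]; last by rewrite mulr0.
by apply: cvgM; [exact: ch.2|exact: cf].
Qed.
End TestIntegrals.

Definition test_integral phi x y k f : R[i] :=
  cintegral setT (fun t => pairing (phi t) (fun z => (trig x y k z)%:C) * (f t)%:C).

Lemma distr_trig phi f x y k N : continuous_L2T phi ->
  continuous f -> (forall t, N < `|t| -> f t = 0) ->
  distr phi (fun t z => f t * trig x y k z) =
  x%:C * test_integral phi 1 0 k f + y%:C * test_integral phi 0 1 k f.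
Proof.
move=> cphi cf fN.
have I x' y' := cintegrable_test (pairing_continuous cphi (L2_trig x' y' k)) cf fN.
rewrite -!(cintegralZ mR)// -(cintegralD mR)//; [|exact: (cintegrableZ mR)..].
apply: eq_cintegral => t _; rewrite !mulrA -mulrDl -pairing_trig// mulrC /pairing -(cintegralZ mT)//.
  by apply: eq_cintegral => z _; rewrite realcM mulrCA.
exact: (L2_mul mT (cphi.1 t) (L2_trig _ _ k)).
Qed.

Lemma fourier_coef_trig (u : R -> R[i]) k : L2T u -> (2 * pi)%:C * fourier_coef u k =
  pairing u (fun z => (trig 1 0 k z)%:C) - (0 +i* 1) * pairing u (fun z => (trig 0 1 k z)%:C).
Proof.
move=> Lu; have Lp x y := L2_mul mT Lu (L2_trig x y k).
rewrite -{1}[k]opprK -fourier_coefE /pairing.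
rewrite -(cintegralZ mT)// -(cintegralB mT)//; last exact: (cintegrableZ mT).
apply: eq_cintegral => z _; rewrite /expi /trig intrN mulNr cosN sinN.
by rewrite !mul1r !mul0r addr0 add0r; apply: complex_eqP; rewrite !cE /=; ring.
Qed.

Variables (a c d r : R) (phi0 psi0 : R -> R[i]) (phi psi : R -> R -> R[i]).
Hypothesis sol : adjoint_solution a c d r phi0 psi0 phi psi.

(* [(x, y)] is a left eigenvector of the symbol of the adjoint system. *)
Lemma adjoint_mode k (x y w : R) :
  x * k%:~R ^+ 3 + y * (a * k%:~R ^+ 3) = w * x ->
  x * (d / c * k%:~R ^+ 3) + y * ((k%:~R ^+ 3 - r * k%:~R) / c) = w * y ->
  forall t, x%:C * fourier_coef (phi t) k + y%:C * fourier_coef (psi t) k =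
    expi (w * t) * (x%:C * fourier_coef (phi 0) k + y%:C * fourier_coef (psi 0) k).
Proof.
move=> ew1 ew2.
have [cphi cpsi _ _ weak] := sol.
pose Y t := x%:C * fourier_coef (phi t) k + y%:C * fourier_coef (psi t) k.
have [c1 c1'] := fourier_coef_continuous k cphi.
have [c2 c2'] := fourier_coef_continuous k cpsi.
apply: (@weak_ode _ Y).
- rewrite (_ : (fun t => _) = (fun t => x * complex.Re (fourier_coef (phi t) k) +
      y * complex.Re (fourier_coef (psi t) k))); last first.
    by apply/funext => t; rewrite /Y cReD !cReM /= !mul0r !subr0.
  by move=> t; apply: cvgD; apply: cvgMl_tmp; [exact: c1|exact: c2].
- rewrite (_ : (fun t => _) = (fun t => x * complex.Im (fourier_coef (phi t) k) +
      y * complex.Im (fourier_coef (psi t) k))); last first.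
    by apply/funext => t; rewrite /Y cImD !cImM /= !mul0r !addr0.
  by move=> t; apply: cvgD; apply: cvgMl_tmp; [exact: c1'|exact: c2'].
move=> f f' tf df.
have [sf [N fN]] := tf.
have cf : continuous f := CnR_continuous (sf 0%N).
have cf' : continuous f' := CnR_continuous (smooth_derivative df sf 0%N).
have f'N t : N < `|t| -> f' t = 0.
  move=> Nt; have D0 : is_derive t (1 : R) f 0.
    apply: (near_eq_is_derive _ (is_derive_cst (0 : R) t (1 : R))).
    have cn : `|s| @[s --> t] --> `|t| by exact: norm_continuous.
    near=> s; rewrite fN//; near: s; exact: (cvgr_gt _ cn).
  by rewrite -(@derive_val _ _ _ _ _ _ _ (df t)) (@derive_val _ _ _ _ _ _ _ D0).
pose J p u v g := test_integral p u v k g.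
have coefE p g : continuous_L2T p -> continuous g -> (forall t, N < `|t| -> g t = 0) ->
    (2 * pi)%:C * cintegral setT (fun t => fourier_coef (p t) k * (g t)%:C) =
    J p 1 0 g - (0 +i* 1) * J p 0 1 g.
  move=> cp cg gN.
  have I x' y' := cintegrable_test (pairing_continuous cp (L2_trig x' y' k)) cg gN.
  rewrite /J /test_integral -[X in _ - X]mulrC -[_ * (0 +i* 1)]mulrC.
  rewrite -(cintegralZ mR)//; last exact: (cintegrable_test (fourier_coef_continuous k cp) cg gN).
  rewrite -(cintegralZ mR)// -(cintegralB mR)//; last exact: (cintegrableZ mR).
  apply: eq_cintegral => t _; rewrite mulrA fourier_coef_trig ?mulrBl ?mulrA//; exact: cp.1.
have YE g : continuous g -> (forall t, N < `|t| -> g t = 0) ->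
    (2 * pi)%:C * cintegral setT (fun t => Y t * (g t)%:C) =
    x%:C * (J phi 1 0 g - (0 +i* 1) * J phi 0 1 g) + y%:C * (J psi 1 0 g - (0 +i* 1) * J psi 0 1 g).
  move=> cg gN; have I p cp := cintegrable_test (@fourier_coef_continuous p k cp) cg gN.
  transitivity ((2 * pi)%:C * (x%:C * cintegral setT (fun t => fourier_coef (phi t) k * (g t)%:C) +
      y%:C * cintegral setT (fun t => fourier_coef (psi t) k * (g t)%:C))); last first.
    have alg (z p1 p2 q1 q2 : R[i]) : z * (p1 * q1 + p2 * q2) = p1 * (z * q1) + p2 * (z * q2).
      by ring.
    by rewrite alg; congr (_ * _ + _ * _); exact: coefE.
  rewrite -(cintegralZ mR x%:C (I _ cphi)) -(cintegralZ mR y%:C (I _ cpsi)).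
  rewrite -(cintegralD mR (cintegrableZ mR _ (I _ cphi)) (cintegrableZ mR _ (I _ cpsi))).
  by congr (_ * _); apply: eq_cintegral => t _; rewrite /Y mulrDl !mulrA.
have W u v := weak _ (test_function_trig u v k tf).
(* Cosine and sine tests in both equations give four identities; the Fourier mode [k] is the cosine
   part minus [i] times the sine part. *)
have [A1 B1] := W 1 0; have [A2 B2] := W 0 1.
rewrite !(dt_mul _ df) !dx_mul in A1 A2 B1 B2.
rewrite !(@distr_trig _ f _ _ k N)// !(@distr_trig _ f' _ _ k N)// in A1 A2 B1 B2.
have pi0 : (2 * pi)%:C != 0 :> R[i] by rewrite (inj_eq (@complexI R)) gt_eqF// pi2_gt0.
apply: (mulfI pi0); rewrite mulr0 mulrDr mulrCA !YE//.
pose K : R[i] := k%:~R%:C.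
rewrite /J; clear -A1 A2 B1 B2 ew1 ew2.
move: A1 A2 B1 B2.
move: (test_integral phi 1 0 k f') (test_integral phi 0 1 k f') (test_integral psi 1 0 k f')
  (test_integral psi 0 1 k f') (test_integral phi 1 0 k f) (test_integral phi 0 1 k f)
  (test_integral psi 1 0 k f) (test_integral psi 0 1 k f) => P1 P2 Q1 Q2 C S C' S'.
rewrite !(rmorphM, rmorphN, rmorph1, rmorph0) /= => A1 A2 B1 B2.
move/(congr1 (real_complex R)): ew1; move/(congr1 (real_complex R)): ew2.
rewrite !(rmorphM, rmorphN, rmorphD, rmorphB, rmorphXn) /= => ew2 ew1.
have i2 : (0 +i* 1) * (0 +i* 1) + 1 = 0 :> R[i] by apply: complex_eqP; rewrite !cE /=; ring.
have -> : 0 +i* w = (0 +i* 1) * w%:C by apply: complex_eqP; rewrite !cE /=; ring.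
move: (0 +i* 1) i2 => I i2.
set K := _%:~R%:C in A1 A2 B1 B2 ew1 ew2.
have A1' : P1 = - (K ^+ 3 * S + d%:C * (c^-1)%:C * K ^+ 3 * S').
  by apply/eqP; rewrite -subr_eq0 -A1; apply/eqP; ring.
have A2' : P2 = K ^+ 3 * C + d%:C * (c^-1)%:C * K ^+ 3 * C'.
  by apply/eqP; rewrite -subr_eq0 -A2; apply/eqP; ring.
have B1' : Q1 = - (- (r%:C * (c^-1)%:C * K * S') + a%:C * K ^+ 3 * S + (c^-1)%:C * K ^+ 3 * S').
  by apply/eqP; rewrite -subr_eq0 -B1; apply/eqP; ring.
have B2' : Q2 = - (r%:C * (c^-1)%:C * K * C') + a%:C * K ^+ 3 * C + (c^-1)%:C * K ^+ 3 * C'.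
  by apply/eqP; rewrite -subr_eq0 -B2; apply/eqP; ring.
rewrite A1' A2' B1' B2'.
set W := w%:C in ew1 ew2 *; set X := x%:C in ew1 ew2 *; set Y := y%:C in ew1 ew2 *.
(* The left-hand side is a combination of [I * I + 1] and of the two eigenvector equations, all of
   which vanish. *)
transitivity (- (I * I + 1) * (W * X * S + W * Y * S')
  + (I * C + S) * (W * X - (X * (K * (K * K)) + Y * (a%:C * (K * (K * K)))))
  + (I * C' + S') * (W * Y - (X * (d%:C * (c^-1)%:C * (K * (K * K))) + Y * ((K * (K * K) - r%:C * K) * (c^-1)%:C)))).
  by ring.
by rewrite i2 ew1 ew2 !subrr; ring.
Unshelve. all: by end_near. Qed.

End AdjointModes.

(** * Controlled trajectories *)

Section ComplexLimits.
Variable R : realType.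
Implicit Types (x y : nat -> R[i]) (l m : R[i]).

Definition ctends x l := forall eps : R, 0 < eps ->
  exists N, forall n, (N <= n)%N -> nsq (x n - l) <= eps.

Lemma ctendsD x y l m : ctends x l -> ctends y m -> ctends (fun n => x n + y n) (l + m).
Proof.
move=> xl ym eps eps0; have e4 : 0 < eps / 4 by rewrite divr_gt0.
have [N1 H1] := xl _ e4; have [N2 H2] := ym _ e4.
exists (maxn N1 N2) => n; rewrite geq_max => /andP[n1 n2].
rewrite opprD addrACA; apply: le_trans (nsqD_le _ _) _.
by have := H1 n n1; have := H2 n n2; lra.
Qed.

Lemma ctendsZ (z : R[i]) x l : ctends x l -> ctends (fun n => z * x n) (z * l).
Proof.
move=> xl eps eps0; have Z0 : 0 < nsq z + 1 by rewrite ltr_wpDl// nsq_ge0.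
have [N H] := xl _ (divr_gt0 eps0 Z0); exists N => n /H{}H.
rewrite -mulrBr nsqM; apply: (@le_trans _ _ (nsq z * (eps / (nsq z + 1)))).
  by rewrite ler_wpM2l// nsq_ge0.
by rewrite mulrCA ger_pMr// ler_pdivrMr// mul1r lerDl.
Qed.

Lemma ctends_unique x y l m : (forall n, x n = y n) -> ctends x l -> ctends y m -> l = m.
Proof.
move=> xy xl ym; apply/eqP; rewrite -subr_eq0; apply/eqP/nsq_eq0.
apply/le_anti; rewrite nsq_ge0 andbT; apply/ler_addgt0Pl => eps eps0.
rewrite addr0; have e4 : 0 < eps / 4 by rewrite divr_gt0.
have [N1 H1] := xl _ e4; have [N2 H2] := ym _ e4; pose n := maxn N1 N2.
have -> : l - m = (y n - m) - (x n - l) by rewrite xy; ring.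
have := H1 n (leq_maxl _ _); have := H2 n (leq_maxr _ _).
by have := nsqB_le (y n - m) (x n - l); lra.
Qed.

End ComplexLimits.

(** * Riesz-Fischer and bounds on moments *)

Section ControlTools.
Variable R : realType.
Local Notation mu := (@lebesgue_measure R).
Local Notation cj := (@conjc R).
Local Notation C := (@circle R).
Local Notation mC := (@measurable_circle R).
Local Notation mR := (@measurableT _ (measurableTypeR R)).
Local Notation D T := (`[0, T]%classic : set R).
Local Notation mD T := (measurable_itv (Interval (BLeft 0) (BRight T)) : measurable (D T : set (measurableTypeR R))).

Lemma norm2_eq0_ae (A : set R) (h : R -> R[i]) :
  measurable (A : set (measurableTypeR R)) -> square_integrable A h ->
  norm2 A h = 0 -> {ae mu, forall x, A x -> h x = 0}.
Proof.
move=> mA Lh h0.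
have H : (\int[mu]_(x in A) `|(nsq (h x))%:E| = 0)%E.
  under eq_integral do rewrite gee0_abs ?lee_fin ?nsq_ge0//.
  have := sqnormE mA Lh; rewrite h0 /sqnorm => E0; rewrite -[RHS]E0.
  by apply: eq_integral => x _; rewrite normc_sqr.
have mh : measurable_fun A (fun x => (nsq (h x))%:E).
  by apply/measurable_EFinP; apply: measurable_nsq; exact: L2_cmeasurable Lh.
have /(ae_eq_integral_abs mu mA mh) [B [mB B0 sB]] := H.
exists B; split=> // x /= hx; apply: sB => /= H2; apply: hx => Ax.
by have [/nsq_eq0] := H2 Ax.
Qed.

Lemma fourier_coef_eq_ae (f g : R -> R[i]) : L2T f -> L2T g ->
  (forall k, fourier_coef f k = fourier_coef g k) -> eqL2T f g.
Proof.
move=> Lf Lg fg; have LB := L2B mC Lf Lg.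
have H0 k : fourier_coef (fun x => f x - g x) k = 0.
  rewrite -[RHS](subrr (fourier_coef g k)) -{1}fg /fourier_coef -mulrBr; congr (_ * _).
  rewrite -(cintegralB mC).
  - by apply: eq_cintegral => x _; rewrite mulrBl.
  - by apply: (L2_mul mC Lf); under eq_fun do rewrite -mulNr -intrN; exact: L2_expi_int.
  - by apply: (L2_mul mC Lg); under eq_fun do rewrite -mulNr -intrN; exact: L2_expi_int.
have [B [mB B0 sB]] := norm2_eq0_ae mC LB (fourier_uniqueness LB H0).
exists B; split=> // x /= nx; apply: sB => /= H; apply: nx => Cx.
by apply/eqP; rewrite -subr_eq0; apply/eqP; exact: H.
Qed.

Lemma eqL2T_fourier_coef (f g : R -> R[i]) k : eqL2T f g -> L2T f -> L2T g ->
  fourier_coef f k = fourier_coef g k.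
Proof.
move=> fg Lf Lg; have Le : L2T (fun x : R => expi (- (k%:~R * x))).
  have := L2_expi_int R (- k); apply: eq_L2; first exact: mC.
  by move=> x _; rewrite intrN mulNr.
have [If1 If2] := L2_mul mC Lf Le; have [Ig1 Ig2] := L2_mul mC Lg Le.
rewrite /fourier_coef /cintegral; congr (_ * (_ +i* _)).
  rewrite /Rintegral; congr fine; apply: ae_eq_integral => //; first exact: mC.
  - exact: measurable_int If1.
  - exact: measurable_int Ig1.
  - have FA := ae_filter_ringOfSetsType mu.
    by apply: filterS fg => x /= H Cx; rewrite H.
rewrite /Rintegral; congr fine; apply: ae_eq_integral => //; first exact: mC.
- exact: measurable_int If2.
- exact: measurable_int Ig2.
- have FA := ae_filter_ringOfSetsType mu.
  by apply: filterS fg => x /= H Cx; rewrite H.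
Qed.

(** The Riesz-Fischer theorem as a moment problem: for the exponentials of the circle the Riesz
    bound is an equality with [delta = 2 * pi]. *)
Lemma fourier_realize (b : int -> R[i]) (M : R) :
  (forall s, uniq s -> \sum_(k <- s) nsq (b k) <= M) ->
  exists u, [/\ L2T u, norm2 C u <= 2 * pi * M & forall k, fourier_coef u (- k) = b k].
Proof.
move=> bM; have pi0 : (2 * pi)%:C != 0 :> R[i].
  by rewrite (inj_eq (@complexI R)) gt_eqF// pi2_gt0.
have bs : square_summable (fun k => (2 * pi)%:C * b k).
  exists ((2 * pi) ^+ 2 * M) => s us; under eq_bigr do rewrite nsqM nsqR.
  by rewrite -mulr_sumr ler_wpM2l ?sqr_ge0// bM.
have riesz (s : seq int) (c : int -> R[i]) : uniq s ->
    2 * pi * \sum_(k <- s) nsq (c k) <= norm2 C (fun x => \sum_(k <- s) c k * expi (k%:~R * x)).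
  by move=> us; rewrite norm2_trig_poly.
have [u Lu Hu] := moment_problem mC (fun k => @L2_expi_int R k) (pi2_gt0 R) riesz bs.
have coef k : fourier_coef u (- k) = b k.
  by apply: (mulfI pi0); rewrite -fourier_coefE Hu.
exists u; split=> //; apply/ler_addgt0Pl => eps eps0.
have [N HN] := fpart_cvg Lu eps0.
have := HN N (leqnn N); rewrite norm2B_fpart ?freqs_uniq//.
have : \sum_(k <- freqs N) nsq (fourier_coef u k) <= M.
  under eq_bigr do rewrite -[X in fourier_coef u X]opprK coef.
  rewrite -(big_map -%R xpredT (fun k => nsq (b k))); apply: bM.
  by rewrite map_inj_uniq ?freqs_uniq//; exact: oppr_inj.
by rewrite -(ler_pM2l (pi2_gt0 R)); lra.
Qed.

(** Dual to [norm2_trig_sum_le]: with the conjugate moments as coefficients, the sum [S] is the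
    integral of [h] against a trigonometric sum of squared norm at most [(T + (1 + K)) * S]. *)
Lemma square_summable_expi_moments (I : countType) (lam : I -> R) (K T : R) :
  injective lam -> (forall s, uniq s -> gap_sum lam s <= K) -> 0 <= T ->
  forall (h : R -> R[i]) (s : seq I), square_integrable (D T) h -> uniq s ->
  \sum_(i <- s) nsq (cintegral (D T) (fun t => h t * expi (lam i * t))) <=
  (T + (1 + K)) * norm2 (D T) h.
Proof.
move=> inj HK T0 h s Lh us; pose m i := cintegral (D T) (fun t => h t * expi (lam i * t)).
rewrite -/(m _).
have Le i : square_integrable (D T) (fun t => expi (lam i * t)).
  by apply: L2_expiM; [exact: measurable_itv|exact: itv_finite].
set S := (X in X <= _).
have S0 : 0 <= S by apply: sumr_ge0 => i _; exact: nsq_ge0.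
have Lt := L2_trig_sum lam T s (fun i => cj (m i)).
have E1 : S%:C = cintegral (D T) (fun t => h t * trig_sum lam s (fun i => cj (m i)) t).
  transitivity (\sum_(i <- s) cj (m i) * m i).
    by rewrite /S rmorph_sum; apply: eq_bigr => i _; rewrite mulrC mulcJ.
  under eq_bigr do rewrite -(cintegralZ (mD T) _ (L2_mul (mD T) Lh (Le _))).
  rewrite -(cintegral_sum (mD T)).
    by apply: eq_cintegral => t _; rewrite /trig_sum mulr_sumr; apply: eq_bigr => i _; rewrite mulrCA.
  by move=> i; exact/(cintegrableZ (mD T))/(L2_mul (mD T) Lh (Le _)).
have := integral_CauchySchwarz (mD T) Lh Lt; rewrite -E1 nsqR.
have := norm2_trig_sum_le inj HK (fun i => cj (m i)) T0 us.
under [X in _ <= _ * X -> _]eq_bigr do rewrite nsqJ.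
rewrite -/S => H1 H2.
have [->|Sn0] := eqVneq S 0.
  by rewrite mulr_ge0 ?norm2_ge0// addr_ge0// addr_ge0//; have := HK [::] isT; rewrite /gap_sum big_nil.
have Sgt : 0 < S by rewrite lt0r Sn0.
rewrite -(ler_pM2r Sgt) -expr2; apply: (le_trans H2).
by rewrite [leRHS]mulrAC [leRHS]mulrC ler_wpM2l// norm2_ge0.
Qed.

Definition zero_ext (A : set R) (f : R -> R[i]) : R -> R[i] := fun x => if x \in A then f x else 0.

Lemma cintegral_patch (A : set R) (f : R -> R[i]) : cintegral setT (zero_ext A f) = cintegral A f.
Proof.
rewrite /cintegral [in RHS]Rintegral_mkcond [X in _ = _ +i* X]Rintegral_mkcond.
by congr (_ +i* _); apply: eq_Rintegral => x _; rewrite /zero_ext patchE; case: ifP.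
Qed.

Lemma L2_patch (A : set R) (f : R -> R[i]) : measurable (A : set (measurableTypeR R)) ->
  square_integrable A f -> square_integrable setT (zero_ext A f).
Proof.
move=> mA /square_integrableP[[m1 m2] If]; apply/square_integrableP; split.
  split; [rewrite (_ : (fun x => _) = (fun x => complex.Re (f x)) \_ A)|
          rewrite (_ : (fun x => _) = (fun x => complex.Im (f x)) \_ A)];
    try by apply/funext => x; rewrite /zero_ext ?patchE; case: ifP.
    by apply/measurable_restrict => //; rewrite setTI.
  by apply/measurable_restrict => //; rewrite setTI.
rewrite (_ : _ \o _ = (EFin \o (fun x => nsq (f x))) \_ A).
  exact/(integrable_mkcond _ mA).
by apply/funext => x; rewrite /= /zero_ext ?patchE; case: ifP => //; rewrite nsq0.
Qed.

Lemma norm2_patch (A : set R) (f : R -> R[i]) : norm2 setT (zero_ext A f) = norm2 A f.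
Proof.
rewrite /norm2 [RHS]Rintegral_mkcond; apply: eq_Rintegral => x _.
by rewrite /zero_ext patchE; case: ifP; rewrite ?nsq0.
Qed.

Lemma compact_L2 (K : set R) (f : R -> R[i]) : compact K -> square_integrable setT f ->
  square_integrable K f.
Proof.
move=> cK; apply: (L2_subset _ mR) => //.
by apply: closed_measurable; exact: compact_closed.
Qed.

Section TruncatedMoments.
Variables (T : R) (f : R -> R[i]).
Hypotheses (T0 : 0 <= T) (Lf : square_integrable setT f).
Hypothesis f0 : forall t, ~~ (0 <= t <= T) -> f t = 0.

Lemma L2_trunc (s : R) : square_integrable (D T) (zero_ext (D s) f).
Proof.
apply: (L2_subset (mD T) mR) => //; apply: L2_patch; first exact: measurable_itv.
by apply: (L2_subset (mD s) mR).
Qed.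

Lemma norm2_trunc (s : R) : norm2 (D T) (zero_ext (D s) f) <= norm2 setT f.
Proof.
apply: (@le_trans _ _ (norm2 setT (zero_ext (D s) f))).
  apply: (norm2_subset (mD T) mR) => //; apply: L2_patch; first exact: measurable_itv.
  by apply: (L2_subset (mD s) mR).
by rewrite norm2_patch; apply: (norm2_subset (mD s) mR).
Qed.

(** Moments on the variable interval [[0, s]] become moments on the fixed interval [[0, T]] of a
    truncation of [f], so the bounds hold uniformly in [s]. *)
Lemma cintegral_trunc (s : R) (h : R -> R[i]) :
  cintegral (D s) (fun t => f t * h t) = cintegral (D T) (fun t => zero_ext (D s) f t * h t).
Proof.
rewrite -[LHS]cintegral_patch -[RHS]cintegral_patch; apply: eq_cintegral => t _.
rewrite /zero_ext ?patchE; case: ifPn => ts; case: ifPn => // tT; rewrite ?mul0r//.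
rewrite f0 ?mul0r//; apply: contraNN tT => tT.
by rewrite mem_setE /= in_itv.
Qed.

(** Two truncated kernels differ only between [s'] and [s], by at most 1 in modulus; by
    Cauchy-Schwarz [nsq (F s - F s') <= norm2 setT f * |s - s'|]. *)
Lemma cintegral_trunc_continuous (w : R) :
  let F s := cintegral (D s) (fun t => f t * expi (w * t)) in
  continuous (fun s => complex.Re (F s)) /\ continuous (fun s => complex.Im (F s)).
Proof.
move=> F; pose e (s : R) : R -> R[i] := zero_ext (D s) (fun t => expi (w * t)).
have Le s : square_integrable setT (e s).
  by apply: L2_patch; [exact: measurable_itv|apply: L2_expiM; [exact: measurable_itv|exact: itv_finite]].
have FE s : F s = cintegral setT (fun t => f t * e s t).
  rewrite /F -cintegral_patch; apply: eq_cintegral => t _.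
  by rewrite /e /zero_ext; case: ifP => //; rewrite mulr0.
have H s s' : s' <= s -> nsq (F s - F s') <= norm2 setT f * (s - s').
  move=> ss; rewrite !FE -(cintegralB mR); [|exact: (L2_mul mR Lf (Le _))..].
  pose g t := e s t - e s' t.
  rewrite (_ : (fun t => _) = (fun t => f t * g t)); last first.
    by apply/funext => t; rewrite /g mulrBr.
  have Lg : square_integrable setT g by apply: (L2B mR).
  apply: le_trans (integral_CauchySchwarz mR Lf Lg) _.
  rewrite ler_wpM2l ?norm2_ge0//.
  have mss : measurable (`[s', s] : set (measurableTypeR R)) by exact: measurable_itv.
  have -> : norm2 setT g = norm2 `[s', s] g.
    rewrite -[RHS]norm2_patch; apply: eq_norm2 => t _; rewrite /zero_ext; case: ifPn => //.
    rewrite /g /e /zero_ext !mem_setE /= !in_itv /= => nts.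
    have [ts|ts] := boolP (_ <= t <= s); have [ts'|ts'] := boolP (_ <= t <= s');
      rewrite ?subrr//; exfalso.
      by move/negP: nts; apply; move: ts ts'; case: (leP s' t); case: (leP t s); case: (leP 0 t); case: (leP t s') => //; lra.
    by move: ts ts'; case: (leP t s); case: (leP 0 t); case: (leP t s') => //; lra.
  apply: (@le_trans _ _ (\int[mu]_(t in `[s', s]) 1)).
    apply: le_Rintegral => //.
    - by apply: L2_nsq; apply: (L2_subset mss mR).
    - by apply: rint_cst => //; exact: itv_finite.
    - move=> t _; rewrite /g /e /zero_ext; case: ifP; case: ifP => _ _; rewrite ?subrr ?subr0 ?sub0r ?nsqN ?nsq0 ?nsq_expi//.
  have := cintegral_one ss => /(congr1 (@complex.Re R)) /= ->.
  by [].
have Fs s0 : forall eps : R, 0 < eps -> \forall s \near s0, nsq (F s - F s0) <= eps.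
  move=> eps eps0; have N0 : 0 < norm2 setT f + 1 by rewrite ltr_wpDl// norm2_ge0.
  have e0 : 0 < eps / (norm2 setT f + 1) by rewrite divr_gt0.
  near=> s.
  have Hs : `|s0 - s| <= eps / (norm2 setT f + 1).
    by near: s; apply: (@cvgr_dist_le _ _ _ _ _ id s0) => //; exact: cvg_id.
  have : nsq (F s - F s0) <= norm2 setT f * `|s0 - s|.
    have [ss|ss] := leP s0 s; first by rewrite distrC ger0_norm ?subr_ge0//; exact: H.
    by rewrite -opprB nsqN ger0_norm ?subr_ge0 ?(ltW ss)//; apply/H/ltW.
  move=> /le_trans; apply; apply: (@le_trans _ _ (norm2 setT f * (eps / (norm2 setT f + 1)))).
    by rewrite ler_wpM2l// norm2_ge0.
  by rewrite mulrCA ger_pMr// ler_pdivrMr// mul1r lerDl.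
by split=> s0; have [] := cts_of_nsq (Fs s0).
Unshelve. all: by end_near. Qed.

End TruncatedMoments.
End ControlTools.

Section ComplexContinuity.
Variable R : realType.
Local Notation C := (@circle R).
Local Notation mC := (@measurable_circle R).
Implicit Types h : R -> R[i].

Definition ccontinuous h :=
  continuous (fun s => complex.Re (h s)) /\ continuous (fun s => complex.Im (h s)).

Lemma ccontinuous_cst (z : R[i]) : ccontinuous (fun=> z).
Proof. by split=> s; exact: cvg_cst. Qed.

Lemma ccontinuousD h h' : ccontinuous h -> ccontinuous h' -> ccontinuous (fun s => h s + h' s).
Proof.
move=> [h1 h2] [h1' h2']; split.
  by under eq_fun do rewrite cReD; move=> s; apply: cvgD; [exact: h1|exact: h1'].
by under eq_fun do rewrite cImD; move=> s; apply: cvgD; [exact: h2|exact: h2'].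
Qed.

Lemma ccontinuousM h h' : ccontinuous h -> ccontinuous h' -> ccontinuous (fun s => h s * h' s).
Proof.
move=> [h1 h2] [h1' h2']; split.
  under eq_fun do rewrite cReM; move=> s; apply: cvgB; apply: cvgM;
    [exact: h1|exact: h1'|exact: h2|exact: h2'].
under eq_fun do rewrite cImM; move=> s; apply: cvgD; apply: cvgM;
  [exact: h1|exact: h2'|exact: h2|exact: h1'].
Qed.

Lemma ccontinuous_sum (I : Type) (s : seq I) (F : I -> R -> R[i]) :
  (forall i, ccontinuous (F i)) -> ccontinuous (fun t => \sum_(i <- s) F i t).
Proof.
move=> cF; elim: s => [|i s IH].
  by under eq_fun do rewrite big_nil; exact: ccontinuous_cst.
by under eq_fun do rewrite big_cons; exact: ccontinuousD.
Qed.

Lemma ccontinuous_expi (w : R) : ccontinuous (fun s => expi (w * s)).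
Proof. by split; [exact: continuous_cosM|exact: continuous_sinM]. Qed.

Lemma ccontinuous_nsq h (s0 : R) : ccontinuous h -> forall eps : R, 0 < eps ->
  \forall s \near s0, nsq (h s - h s0) <= eps.
Proof.
move=> [h1 h2] eps eps0.
have cn : continuous (fun s => nsq (h s - h s0)).
  rewrite (_ : (fun s => _) = (fun s =>
      (complex.Re (h s) - complex.Re (h s0)) * (complex.Re (h s) - complex.Re (h s0)) +
      (complex.Im (h s) - complex.Im (h s0)) * (complex.Im (h s) - complex.Im (h s0)))); last first.
    by apply/funext => s; rewrite /nsq !cE !expr2.
  by move=> s; apply: cvgD; apply: cvgM; apply: cvgB;
    (exact: cvg_cst || exact: h1 || exact: h2).
have := cn s0; rewrite /prop_for /continuous_at subrr nsq0 => H.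
by apply: (cvgr_le _ H).
Qed.

(** The bound [M] makes the replacement of [w] by a partial Fourier sum uniform in [s], after which
    only finitely many continuous coefficients matter. *)
Lemma pairing_weakly_continuous (u : R -> R -> R[i]) (M : R) (w : R -> R[i]) :
  (forall s, L2T (u s)) -> (forall s, norm2 C (u s) <= M) ->
  (forall k, ccontinuous (fun s => fourier_coef (u s) k)) -> L2T w ->
  ccontinuous (fun s => pairing (u s) w).
Proof.
move=> Lu uM cu Lw.
have M0 : 0 < M + 1 by rewrite ltr_wpDl// (le_trans (norm2_ge0 _ _) (uM 0)).
suff H s0 : forall eps : R, 0 < eps ->
    \forall s \near s0, nsq (pairing (u s) w - pairing (u s0) w) <= eps.
  by split=> s0; have [] := cts_of_nsq (H s0).
move=> eps eps0.
have e0 : 0 < eps / (16 * (M + 1)) by rewrite divr_gt0// mulr_gt0.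
have [N HN] := fpart_cvg Lw e0; have {HN} := HN N (leqnn N).
set p := fpart w (freqs N) => Hp.
have Lp : L2T p by exact: L2_fpart.
have near_p s : nsq (pairing (u s) w - pairing (u s) p) <= eps / 16.
  have -> : pairing (u s) w - pairing (u s) p = pairing (u s) (fun x => w x - p x).
    rewrite /pairing -(cintegralB mC (L2_mul mC (Lu s) Lw) (L2_mul mC (Lu s) Lp)).
    by apply: eq_cintegral => x _; rewrite mulrBr.
  apply: (le_trans (integral_CauchySchwarz mC (Lu s) (L2B mC Lw Lp))).
  apply: (@le_trans _ _ ((M + 1) * (eps / (16 * (M + 1))))).
    by apply: ler_pM; rewrite ?norm2_ge0// (le_trans (uM s))// lerDl.
  by rewrite le_eqVlt; apply/orP; left; apply/eqP; field; rewrite gt_eqF.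
have cp : ccontinuous (fun s => pairing (u s) p).
  rewrite (_ : (fun s => _) = (fun s => \sum_(k <- freqs N) fourier_coef w k * ((2 * pi)%:C * fourier_coef (u s) (- k)))).
    apply: ccontinuous_sum => k; apply: ccontinuousM; first exact: ccontinuous_cst.
    by apply: ccontinuousM; [exact: ccontinuous_cst|exact: cu].
  by apply/funext => s; rewrite /pairing /p /fpart trig_poly_mul//; exact: Lu.
have e4 : 0 < eps / 4 by rewrite divr_gt0.
have := ccontinuous_nsq s0 cp e4; apply: filterS => s Hs.
set A := pairing (u s) w; set A0 := pairing (u s0) w.
set B := pairing (u s) p in Hs *; set B0 := pairing (u s0) p in Hs *.
have -> : A - A0 = ((A - B) - (A0 - B0)) + (B - B0) by ring.
apply: le_trans (nsqD_le _ _) _.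
have := nsqB_le (A - B) (A0 - B0); have := near_p s; have := near_p s0.
by rewrite -/A -/B -/A0 -/B0; lra.
Qed.

End ComplexContinuity.

(** * Spectral projections of the symbol *)

Section Modes.
Variable R : realType.
Implicit Types (k : int) (b : bool).
Variables (a c d r : R).
Hypotheses (a0 : 0 < a) (c0 : 0 < c) (d0 : 0 < d) (r0 : 0 < r).

(** The sign in the index makes its [mode] equal to [k] for both values of [b]: these are the two
    eigenvalues of the symbol at [k]. *)
Definition eigen k b : R := freq a c d r (if b then k else - k, b).

Definition sgb b : R := if b then 1 else -1.

Local Notation kR k := (k%:~R : R).
Local Notation half_gap k := (kR k * disc_sqrt a c d r k).
Local Notation skew k := (kR k ^+ 3 * (1 - c^-1) + r * c^-1 * kR k).

(* The entries of the spectral projections [1/2 + sgb b * (A - tau / 2) / (k Q)] of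
   the symbol [A] of the adjoint system, [Q] being [disc_sqrt]. At the mode 0 the
   symbol vanishes and the junk value of the division by 0 makes both of them 1/2. *)
Definition proj11 k b : R := 1 / 2 + sgb b * (skew k / 2 / half_gap k).
Definition proj12 k b : R := sgb b * (d / c * kR k ^+ 3 / half_gap k).
Definition proj21 k b : R := sgb b * (a * kR k ^+ 3 / half_gap k).
Definition proj22 k b : R := 1 / 2 - sgb b * (skew k / 2 / half_gap k).

Lemma disc_sqrtN k : disc_sqrt a c d r (- k) = disc_sqrt a c d r k.
Proof. by rewrite /disc_sqrt intrN sqrrN; congr Num.sqrt; ring. Qed.

Lemma eigenE k b : eigen k b = (tau c r k + sgb b * half_gap k) / 2.
Proof.
rewrite /eigen /freq /mode /sgb; case: b => /=; first by rewrite mul1r.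
by rewrite opprK disc_sqrtN intrN mulN1r mulNr.
Qed.

Let gap_sqr k : half_gap k ^+ 2 = skew k ^+ 2 + 4 * a * d / c * kR k ^+ 6.
Proof. by rewrite exprMn disc_sqr//; ring. Qed.

Let gap_neq0 k : k != 0 -> half_gap k != 0.
Proof. by move=> k0; rewrite mulf_neq0 ?intr_eq0// gt_eqF// disc_sqrt_gt0. Qed.

Let sgb2 b : sgb b ^+ 2 = 1.
Proof. by case: b; rewrite /sgb ?sqrrN expr1n. Qed.

(** The rows of a spectral projection are left eigenvectors; this is the form that [adjoint_mode]
    requires. *)
Lemma proj_eigen1 k b :
  proj11 k b * kR k ^+ 3 + proj12 k b * (a * kR k ^+ 3) = eigen k b * proj11 k b /\
  proj11 k b * (d / c * kR k ^+ 3) + proj12 k b * ((kR k ^+ 3 - r * kR k) / c) =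
    eigen k b * proj12 k b.
Proof.
have [->|k0] := eqVneq k 0.
  by rewrite /proj12 eigenE /tau expr0n /= !(mul0r, mulr0, addr0, subr0).
have g0 := gap_neq0 k0; have g2 := gap_sqr k; have s2 := sgb2 b.
rewrite eigenE /proj11 /proj12 /tau; set D := half_gap k in g0 g2 *; set s := sgb b in s2 *.
set x := kR k in g2 *.
split; apply/eqP; rewrite -subr_eq0; apply/eqP.
  (* The defect is a combination of the discriminant formula [g2] and of [s ^+ 2 = 1]. *)
  transitivity (s / (4 * D) * ((x ^+ 3 * (1 - c^-1) + r * c^-1 * x) ^+ 2 + 4 * a * d / c * x ^+ 6 - D ^+ 2)
     + (1 - s ^+ 2) * (x ^+ 3 * (1 - c^-1) + r * c^-1 * x) / 4).
    by field; rewrite g0 gt_eqF.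
  by rewrite g2 s2 !subrr mulr0 !mul0r addr0.
transitivity ((1 - s ^+ 2) * (d / c * x ^+ 3) / 2).
  by field; rewrite g0 gt_eqF.
by rewrite s2 subrr !mul0r.
Qed.

Lemma proj_eigen2 k b :
  proj21 k b * kR k ^+ 3 + proj22 k b * (a * kR k ^+ 3) = eigen k b * proj21 k b /\
  proj21 k b * (d / c * kR k ^+ 3) + proj22 k b * ((kR k ^+ 3 - r * kR k) / c) =
    eigen k b * proj22 k b.
Proof.
have [->|k0] := eqVneq k 0.
  by rewrite /proj21 eigenE /tau expr0n /= !(mul0r, mulr0, addr0, subr0).
have g0 := gap_neq0 k0; have g2 := gap_sqr k; have s2 := sgb2 b.
rewrite eigenE /proj21 /proj22 /tau; set D := half_gap k in g0 g2 *; set s := sgb b in s2 *.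
set x := kR k in g2 *.
split; apply/eqP; rewrite -subr_eq0; apply/eqP.
  transitivity ((1 - s ^+ 2) * (a * x ^+ 3) / 2).
    by field; rewrite g0 gt_eqF.
  by rewrite s2 subrr !mul0r.
transitivity (s / (4 * D) * ((x ^+ 3 * (1 - c^-1) + r * c^-1 * x) ^+ 2 + 4 * a * d / c * x ^+ 6 - D ^+ 2)
     - (1 - s ^+ 2) * (x ^+ 3 * (1 - c^-1) + r * c^-1 * x) / 4).
  by field; rewrite g0 gt_eqF.
by rewrite g2 s2 !subrr mulr0 !mul0r subr0.
Qed.

Lemma proj_sum k : [/\ proj11 k true + proj11 k false = 1,
  proj12 k true + proj12 k false = 0, proj21 k true + proj21 k false = 0 &
  proj22 k true + proj22 k false = 1].
Proof. by rewrite /proj11 /proj12 /proj21 /proj22 /sgb; split; lra. Qed.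

(** The summands bound the squares of the diagonal entries, of [proj12] and of [proj21]. The bounds
    are uniform in [k] because the discriminant contains [4 a d / c * k^6], of the same order as the
    squared off-diagonal entries of the symbol. *)
Definition proj_bound : R := 1 + d / (4 * a * c) + a * c / (4 * d).

Lemma proj_bounded k b : [/\ proj11 k b ^+ 2 <= proj_bound,
  proj12 k b ^+ 2 <= proj_bound, proj21 k b ^+ 2 <= proj_bound &
  proj22 k b ^+ 2 <= proj_bound].
Proof.
have B1 : 0 < d / (4 * a * c) by rewrite divr_gt0// !mulr_gt0.
have B2 : 0 < a * c / (4 * d) by rewrite divr_gt0// !mulr_gt0.
have [->|k0] := eqVneq k 0.
  rewrite /proj11 /proj12 /proj21 /proj22 /proj_bound expr0n /= !(mul0r, mulr0, addr0, subr0).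
  by split; rewrite ?expr0n /=; lra.
have g0 := gap_neq0 k0; have g2 := gap_sqr k; have s2 := sgb2 b.
have K6 : 0 < kR k ^+ 6.
  by rewrite -[6%N]/(2 * 3)%N exprM exprn_gt0// exprn_even_gt0//= intr_eq0.
rewrite /proj11 /proj12 /proj21 /proj22.
set D := half_gap k in g0 g2 *; set s := sgb b in s2 *; set x := kR k in g2 K6 *.
have D2 : 0 < D ^+ 2 by rewrite exprn_even_gt0.
have Q0 : 0 <= 4 * a * d / c * x ^+ 6 by rewrite mulr_ge0 ?ltW// divr_gt0// !mulr_gt0.
set al := x ^+ 3 * (1 - c^-1) + r * c^-1 * x in g2 *.
have H1 : (al / D) ^+ 2 <= 1.
  by rewrite expr_div_n ler_pdivrMr// mul1r g2 lerDl.
have H2 : (d / c * x ^+ 3 / D) ^+ 2 <= d / (4 * a * c).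
  rewrite expr_div_n ler_pdivrMr// g2.
  have -> : (d / c * x ^+ 3) ^+ 2 = d / (4 * a * c) * (4 * a * d / c * x ^+ 6).
    by field; rewrite !gt_eqF.
  by rewrite ler_pM2l// lerDr sqr_ge0.
have H3 : (a * x ^+ 3 / D) ^+ 2 <= a * c / (4 * d).
  rewrite expr_div_n ler_pdivrMr// g2.
  have -> : (a * x ^+ 3) ^+ 2 = a * c / (4 * d) * (4 * a * d / c * x ^+ 6).
    by field; rewrite !gt_eqF.
  by rewrite ler_pM2l// lerDr sqr_ge0.
have -> : al / 2 / D = al / D / 2 by rewrite mulrAC.
set y := al / D in H1 *.
have sy : `|y| <= 1 by rewrite -(@ler_pXn2r _ 2) ?nnegrE// expr1n real_normK ?num_real.
have /andP[y1 y2] : -1 <= y <= 1 by rewrite -ler_norml.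
have sE : (s * (y / 2)) ^+ 2 = y ^+ 2 / 4 by rewrite exprMn s2; field.
have P1 : (1 / 2 + s * (y / 2)) ^+ 2 <= 1 /\ (1 / 2 - s * (y / 2)) ^+ 2 <= 1.
  by rewrite /s /sgb; case: b {s2 sE s}; split; nra.
rewrite /proj_bound; split.
- by apply: (le_trans P1.1); lra.
- by rewrite exprMn s2 mul1r; lra.
- by rewrite exprMn s2 mul1r; lra.
- by apply: (le_trans P1.2); lra.
Qed.

Section Evolution.
Variables (phi0 psi0 : R -> R[i]) (phi psi : R -> R -> R[i]).
Hypothesis sol : adjoint_solution a c d r phi0 psi0 phi psi.

(** With [amp2], the two components of the spectral projection of the adjoint state at the mode [k];
    each oscillates at the single frequency [eigen k b]. *)
Definition amp1 k b (t : R) : R[i] :=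
  (proj11 k b)%:C * fourier_coef (phi t) k + (proj12 k b)%:C * fourier_coef (psi t) k.
Definition amp2 k b (t : R) : R[i] :=
  (proj21 k b)%:C * fourier_coef (phi t) k + (proj22 k b)%:C * fourier_coef (psi t) k.

Lemma amp1E k b t : amp1 k b t = expi (eigen k b * t) * amp1 k b 0.
Proof. by have [e1 e2] := proj_eigen1 k b; exact: (adjoint_mode sol e1 e2). Qed.

Lemma amp2E k b t : amp2 k b t = expi (eigen k b * t) * amp2 k b 0.
Proof. by have [e1 e2] := proj_eigen2 k b; exact: (adjoint_mode sol e1 e2). Qed.

Lemma amp_sum1 k t : fourier_coef (phi t) k = amp1 k true t + amp1 k false t.
Proof.
have [s1 s2 _ _] := proj_sum k; rewrite /amp1 addrACA -!mulrDl -!rmorphD /= s1 s2.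
by rewrite rmorph1 rmorph0 mul1r mul0r addr0.
Qed.

Lemma amp_sum2 k t : fourier_coef (psi t) k = amp2 k true t + amp2 k false t.
Proof.
have [_ _ s1 s2] := proj_sum k; rewrite /amp2 addrACA -!mulrDl -!rmorphD /= s1 s2.
by rewrite rmorph1 rmorph0 mul1r mul0r add0r.
Qed.

End Evolution.
End Modes.

(** * Construction of the controls and of the trajectory *)

Section Controllability.
Variable R : realType.
Local Notation mu := (@lebesgue_measure R).
Local Notation C := (@circle R).
Local Notation mC := (@measurable_circle R).
Local Notation mR := (@measurableT _ (measurableTypeR R)).
Local Notation D T := (`[0, T]%classic : set R).
Implicit Types (k : int) (b : bool).
Variables (a c d r : R).
Hypotheses (a0 : 0 < a) (c0 : 0 < c) (d0 : 0 < d) (r0 : 0 < r).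
Hypothesis sep : separated_freqs a c d r.

Local Notation w k b := (eigen a c d r k b).
Local Notation lam := (fun i : eigen_index => freq a c d r (val i)).

Let mD (s : R) : measurable (D s : set (measurableTypeR R)).
Proof. exact: measurable_itv. Qed.

Lemma admissible_mode k b : admissible (if b || (k == 0) then (k, true) else (- k, false)).
Proof.
have [->|k0] := eqVneq k 0; first by rewrite orbT.
by case: b; rewrite /admissible /= ?orbT// oppr_eq0 k0.
Qed.

(** At [k = 0] both branches are sent to the only admissible index; this is consistent because both
    eigenvalues and both target moments coincide there. *)
Definition mode_index k b : eigen_index :=
  exist _ (if b || (k == 0) then (k, true) else (- k, false)) (admissible_mode k b).

Lemma mode_indexK k b : mode (val (mode_index k b)) = k.
Proof. by rewrite /mode /=; case: (b || (k == 0)) => //=; rewrite opprK. Qed.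

Lemma freq_mode_index k b : lam (mode_index k b) = w k b.
Proof.
rewrite /eigen /=; case: b => //=; case: eqVneq => [->|//].
by rewrite oppr0 /freq /mode /= oppr0 !mul0r.
Qed.

Lemma mode_index_inj b : injective (mode_index ^~ b).
Proof. by move=> k l /(congr1 (fun i => mode (val i))); rewrite !mode_indexK. Qed.

Lemma sum_mode_le (h : int -> R) (M : R) : (forall k, 0 <= h k) ->
  (forall s : seq int, uniq s -> \sum_(k <- s) h k <= M) ->
  forall s : seq eigen_index, uniq s -> \sum_(i <- s) h (mode (val i)) <= 2 * M.
Proof.
move=> h0 hM s us; rewrite (bigID (fun i : eigen_index => (val i).2)) /= mulr_natl mulr2n.
have H (P : pred eigen_index) : (forall i j, P i -> P j -> mode (val i) = mode (val j) -> i = j) ->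
    \sum_(i <- s | P i) h (mode (val i)) <= M.
  move=> Pinj; rewrite -big_filter -(big_map (fun i : eigen_index => mode (val i)) xpredT h).
  apply: hM; rewrite map_inj_in_uniq ?filter_uniq// => i j.
  by rewrite !mem_filter => /andP[Pi _] /andP[Pj _]; exact: Pinj.
apply: lerD; apply: H => -[[k []] kb] [[l []] lb] //= _ _; rewrite /mode /=.
  by move=> kl; apply: val_inj => /=; rewrite kl.
by move=> /oppr_inj kl; apply: val_inj => /=; rewrite kl.
Qed.

Variables (x0 T : R).
Hypothesis T0 : 0 < T.

(* moments driving the coefficient [U0] of the initial state to [UT] *)
Definition target_moment (z : R[i]) (U0 UT : int -> R[i]) (i : eigen_index) : R[i] :=
  let k := mode (val i) in
  z * (2 * pi)%:C * expi (- (k%:~R * x0)) * (expi (lam i * T) * UT k - U0 k).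

Lemma target_moment_summable z U0 UT : square_summable U0 -> square_summable UT ->
  square_summable (target_moment z U0 UT).
Proof.
move=> [M0 H0] [MT HT].
pose h k := 2 * nsq (UT k) + 2 * nsq (U0 k).
have h0 k : 0 <= h k by rewrite addr_ge0// mulr_ge0// nsq_ge0.
have hM (s : seq int) : uniq s -> \sum_(k <- s) h k <= 2 * MT + 2 * M0.
  by move=> us; rewrite big_split /= -!mulr_sumr; have := H0 s us; have := HT s us; lra.
exists (nsq (z * (2 * pi)%:C) * (2 * (2 * MT + 2 * M0))) => s us.
apply: (@le_trans _ _ (nsq (z * (2 * pi)%:C) * \sum_(i <- s) h (mode (val i)))).
  rewrite mulr_sumr; apply: ler_sum => i _.
  rewrite /target_moment nsqM nsqM nsq_expi mulr1 ler_wpM2l ?nsq_ge0//.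
  by apply: le_trans (nsqB_le _ _) _; rewrite nsqM nsq_expi mul1r.
by rewrite ler_wpM2l ?nsq_ge0// (sum_mode_le h0 hM us).
Qed.

Lemma control_exists (bm : eigen_index -> R[i]) : square_summable bm ->
  exists f : R -> R[i], [/\ square_integrable setT f,
    (forall t, ~~ (0 <= t <= T) -> f t = 0) &
    forall k b, cintegral (D T) (fun t => f t * expi (w k b * t)) = bm (mode_index k b)].
Proof.
move=> bs; have [inj [K HK]] := sep.
have [delta delta0 Hd] := ingham_inequality inj HK T0.
have Le i : square_integrable (D T) (fun t => expi (lam i * t)).
  by apply: L2_expiM; [exact: mD|exact: itv_finite].
have riesz (s : seq eigen_index) (e : eigen_index -> R[i]) : uniq s ->
    delta * \sum_(i <- s) nsq (e i) <= norm2 (D T) (fun t => \sum_(i <- s) e i * expi (lam i * t)).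
  by move=> us; exact: (Hd s e us (all_predT s)).
have [F LF HF] := moment_problem (mD T) Le delta0 riesz bs.
exists (zero_ext (D T) F); split.
- exact: L2_patch.
- by move=> t tT; rewrite /zero_ext mem_setE /= in_itv /= (negbTE tT).
- move=> k b; rewrite -HF freq_mode_index; apply: eq_cintegral => t tT.
  by rewrite /zero_ext mem_set.
Qed.

Lemma sum_moments_le (f : R -> R[i]) : square_integrable setT f ->
  (forall t, ~~ (0 <= t <= T) -> f t = 0) ->
  exists M, forall b s (l : seq int), uniq l ->
    \sum_(k <- l) nsq (cintegral (D s) (fun t => f t * expi (w k b * t))) <= M.
Proof.
move=> Lf f0; have [inj [K HK]] := sep.
exists ((T + (1 + K)) * norm2 setT f) => b s l ul.
have K0 : 0 <= K by have := HK [::] isT; rewrite /gap_sum big_nil.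
apply: (@le_trans _ _ ((T + (1 + K)) * norm2 (D T) (zero_ext (D s) f))); last first.
  apply: ler_wpM2l; last exact: norm2_trunc.
  by rewrite addr_ge0 ?addr_ge0// ltW.
under eq_bigr do rewrite (cintegral_trunc f0) -freq_mode_index.
rewrite -(big_map (mode_index ^~ b) xpredT (fun i => nsq (cintegral (D T) (fun t => zero_ext (D s) f t * expi (lam i * t))))).
apply: (square_summable_expi_moments inj HK (ltW T0)); first exact: L2_trunc.
by rewrite map_inj_uniq//; exact: mode_index_inj.
Qed.

Lemma cintegral_from0_supp (h : R -> R[i]) (s : R) :
  (forall t, ~~ (0 <= t <= T) -> h t = 0) -> cintegral_from0 s h = cintegral (D s) h.
Proof.
move=> h0; rewrite /cintegral_from0; case: ifPn => //; rewrite -ltNge => s0.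
have -> : D s = set0 by apply/seteqP; split=> t //=; rewrite in_itv /=; lra.
rewrite /cintegral !Rintegral_set0.
have Z (g : R -> R) : (forall t, t < 0 -> g t = 0) -> \int[mu]_(t in `[s, 0]) g t = 0.
  (* Nothing is known about the value at 0, so the endpoint is dropped before the integrand is
     replaced by 0. *)
  move=> g0; have gI t : t \in (`[s, 0[%classic : set R) -> g t = 0.
    by rewrite mem_setE /= in_itv /= => /andP[_ /g0].
  rewrite -Rintegral_itv_bndo_bndc.
    by rewrite (@eq_Rintegral _ _ _ mu _ (fun=> 0)) ?Rintegral_cst ?mul0r// => t /gI.
  apply: (eq_integrable _ (fun=> 0%E)) => //; last exact: integrable0.
  by move=> t /gI /= ->.
have nT t : t < 0 -> ~~ (0 <= t <= T) by move=> t0; rewrite negb_and -ltNge t0.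
by rewrite !Z ?oppr0// => t /nT/h0 ->.
Qed.

Section Trajectory.
Variables (f g : R -> R[i]) (u0 v0 : R -> R[i]).
Hypotheses (Lf : square_integrable setT f) (Lg : square_integrable setT g).
Hypotheses (f0 : forall t, ~~ (0 <= t <= T) -> f t = 0)
  (g0 : forall t, ~~ (0 <= t <= T) -> g t = 0).
Hypotheses (Lu0 : L2T u0) (Lv0 : L2T v0).

Local Notation F k b s := (cintegral (D s) (fun t => f t * expi (w k b * t))).
Local Notation G k b s := (cintegral (D s) (fun t => g t * expi (w k b * t))).
Local Notation E k := (((2 * pi)^-1)%:C * expi (k%:~R * x0)).

(** Duhamel's formula at [- k], seen in the frame that rotates with the frequency [w k b] and before
    any spectral projection; [E k] is the Fourier coefficient at [- k] of the Dirac mass at [x0]. *)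
Definition forced1 k b s : R[i] := fourier_coef u0 (- k) + E k * F k b s.
Definition forced2 k b s : R[i] := fourier_coef v0 (- k) + E k * ((c^-1)%:C * G k b s).

Local Notation P11 k b := ((proj11 a c d r k b)%:C).
Local Notation P12 k b := ((proj12 a c d r k b)%:C).
Local Notation P21 k b := ((proj21 a c d r k b)%:C).
Local Notation P22 k b := ((proj22 a c d r k b)%:C).

(* Fourier coefficients at [- k] of the solution of the controlled system *)
Definition traj1 k s : R[i] :=
  expi (- (w k true * s)) * (forced1 k true s * P11 k true + forced2 k true s * P21 k true) +
  expi (- (w k false * s)) * (forced1 k false s * P11 k false + forced2 k false s * P21 k false).
Definition traj2 k s : R[i] :=
  expi (- (w k true * s)) * (forced1 k true s * P12 k true + forced2 k true s * P22 k true) +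
  expi (- (w k false * s)) * (forced1 k false s * P12 k false + forced2 k false s * P22 k false).

Lemma forced_bound : exists M, forall b s (l : seq int), uniq l ->
  \sum_(k <- l) (nsq (forced1 k b s) + nsq (forced2 k b s)) <= M.
Proof.
have [M1 H1] := sum_moments_le Lf f0; have [M2 H2] := sum_moments_le Lg g0.
have [N1 K1] := fourier_coef_sum Lu0; have [N2 K2] := fourier_coef_sum Lv0.
pose e : R := (2 * pi)^-1 ^+ 2.
have nE k (z : R[i]) : nsq (E k * z) = e * nsq z by rewrite !nsqM nsq_expi nsqR mulr1.
have e0 : 0 <= e by exact: sqr_ge0.
have ci : 0 <= c^-1 ^+ 2 by exact: sqr_ge0.
exists (2 * N1 + 2 * (e * M1) + (2 * N2 + 2 * (e * (c^-1 ^+ 2 * M2)))) => b s l ul.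
have neg (h : R -> R[i]) N (K : forall s, uniq s -> \sum_(k <- s) nsq (fourier_coef h k) <= N) :
    \sum_(k <- l) nsq (fourier_coef h (- k)) <= N.
  rewrite -(big_map -%R xpredT (fun k => nsq (fourier_coef h k))); apply: K.
  by rewrite map_inj_uniq//; exact: oppr_inj.
rewrite big_split /=; apply: lerD.
  apply: (@le_trans _ _ (\sum_(k <- l) (2 * nsq (fourier_coef u0 (- k)) + 2 * (e * nsq (F k b s))))).
    by apply: ler_sum => k _; rewrite -(nE k); exact: nsqD_le.
  rewrite big_split /= -!mulr_sumr; apply: lerD; rewrite ler_pM2l//; first exact: neg.
  by rewrite ler_wpM2l// H1.
apply: (@le_trans _ _ (\sum_(k <- l) (2 * nsq (fourier_coef v0 (- k)) + 2 * (e * (c^-1 ^+ 2 * nsq (G k b s)))))).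
  by apply: ler_sum => k _; rewrite -nsqR -nsqM -(nE k); exact: nsqD_le.
rewrite big_split /= -!mulr_sumr; apply: lerD; rewrite ler_pM2l//; first exact: neg.
by rewrite ler_wpM2l// ler_wpM2l// H2.
Qed.

Definition forced_nsq k b s : R := nsq (forced1 k b s) + nsq (forced2 k b s).

Lemma forced_proj_le k b s (p p' B : R) : p ^+ 2 <= B -> p' ^+ 2 <= B ->
  nsq (forced1 k b s * p%:C + forced2 k b s * p'%:C) <= 2 * B * forced_nsq k b s.
Proof.
rewrite /forced_nsq; move: (forced1 k b s) (forced2 k b s) => x y pB p'B.
apply: le_trans (nsqD_le _ _) _; rewrite !nsqM !nsqR.
have := ler_wpM2l (nsq_ge0 x) pB; have := ler_wpM2l (nsq_ge0 y) p'B; lra.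
Qed.

Lemma nsq_expi_combo (x y : R[i]) (t t' A B : R) : nsq x <= A -> nsq y <= B ->
  nsq (expi t * x + expi t' * y) <= 2 * A + 2 * B.
Proof.
by move=> xA yB; apply: le_trans (nsqD_le _ _) _; rewrite !nsqM !nsq_expi !mul1r; lra.
Qed.

Lemma traj_bound : exists M, forall s (l : seq int), uniq l ->
  \sum_(k <- l) nsq (traj1 k s) <= M /\ \sum_(k <- l) nsq (traj2 k s) <= M.
Proof.
have [M HM] := forced_bound; pose B := proj_bound a c d.
have Bk k b := proj_bounded a0 c0 d0 r0 k b.
have B0 : 0 <= B by have [/(le_trans (sqr_ge0 _))] := Bk 0 true.
exists (2 * (2 * B * M) + 2 * (2 * B * M)) => s l ul.
have main (y : int -> R[i]) :
    (forall k, nsq (y k) <= 2 * (2 * B * forced_nsq k true s) + 2 * (2 * B * forced_nsq k false s)) ->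
    \sum_(k <- l) nsq (y k) <= 2 * (2 * B * M) + 2 * (2 * B * M).
  move=> H; apply: (@le_trans _ _ (\sum_(k <- l)
      (2 * (2 * B * forced_nsq k true s) + 2 * (2 * B * forced_nsq k false s)))).
    by apply: ler_sum => k _; exact: H.
  have S b : \sum_(k <- l) 2 * (2 * B * forced_nsq k b s) <= 2 * (2 * B * M).
    have -> : \sum_(k <- l) 2 * (2 * B * forced_nsq k b s) = 2 * (2 * B * \sum_(k <- l) forced_nsq k b s).
      by rewrite !mulr_sumr.
    by rewrite ler_pM2l// ler_wpM2l ?mulr_ge0// (HM b s l ul).
  by rewrite big_split /=; exact: lerD.
split; apply: main => k; apply: nsq_expi_combo; apply: forced_proj_le.
- by have [] := Bk k true.
- by have [] := Bk k true.
- by have [] := Bk k false.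
- by have [] := Bk k false.
- by have [] := Bk k true.
- by have [] := Bk k true.
- by have [] := Bk k false.
- by have [] := Bk k false.
Qed.

Lemma traj_continuous k : ccontinuous (traj1 k) /\ ccontinuous (traj2 k).
Proof.
have cF h b : square_integrable setT h -> ccontinuous (fun s => cintegral (D s) (fun t => h t * expi (w k b * t))).
  by move=> Lh; exact: cintegral_trunc_continuous.
have c1 b : ccontinuous (forced1 k b).
  apply: ccontinuousD; first exact: ccontinuous_cst.
  by apply: ccontinuousM; [exact: ccontinuous_cst|exact: cF].
have c2 b : ccontinuous (forced2 k b).
  apply: ccontinuousD; first exact: ccontinuous_cst.
  apply: ccontinuousM; first exact: ccontinuous_cst.
  by apply: ccontinuousM; [exact: ccontinuous_cst|exact: cF].
have ce b : ccontinuous (fun s => expi (- (w k b * s))).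
  rewrite (_ : (fun s => _) = (fun s => expi (- w k b * s))); first exact: ccontinuous_expi.
  by apply/funext => s; rewrite mulNr.
have term b (p p' : R) : ccontinuous (fun s => expi (- (w k b * s)) *
    (forced1 k b s * p%:C + forced2 k b s * p'%:C)).
  apply: ccontinuousM; first exact: ce.
  apply: ccontinuousD; first by apply: ccontinuousM; [exact: c1|exact: ccontinuous_cst].
  by apply: ccontinuousM; [exact: c2|exact: ccontinuous_cst].
by split; apply: ccontinuousD; exact: term.
Qed.

Section Transposition.
Variables (phi0 psi0 : R -> R[i]) (phi psi : R -> R -> R[i]).
Hypothesis sol : adjoint_solution a c d r phi0 psi0 phi psi.

(** The factors [expi (- (w * s))] in the trajectory bring the adjoint amplitudes at time [s] back
    to time 0. What remains pairs the adjoint data at 0 with the initial state and the control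
    moments. *)
Lemma mode_identity k s :
  (2 * pi)%:C * (fourier_coef (phi s) k * traj1 k s + fourier_coef (psi s) k * traj2 k s) =
  (2 * pi)%:C * (fourier_coef (phi 0) k * fourier_coef u0 (- k) +
                 fourier_coef (psi 0) k * fourier_coef v0 (- k)) +
  cintegral (D s) (fun t => f t * (fourier_coef (phi t) k * expi (k%:~R * x0)) +
    (c^-1)%:C * (g t * (fourier_coef (psi t) k * expi (k%:~R * x0)))).
Proof.
pose A1 b := amp1 a c d r phi psi k b 0; pose A2 b := amp2 a c d r phi psi k b 0.
have E1 t : fourier_coef (phi t) k = expi (w k true * t) * A1 true + expi (w k false * t) * A1 false.
  by rewrite (amp_sum1 a c d r phi psi) !(amp1E a0 c0 d0 r0 sol _ _ t).
have E2 t : fourier_coef (psi t) k = expi (w k true * t) * A2 true + expi (w k false * t) * A2 false.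
  by rewrite (amp_sum2 a c d r phi psi) !(amp2E a0 c0 d0 r0 sol _ _ t).
have Le b : square_integrable (D s) (fun t => expi (w k b * t)).
  by apply: L2_expiM; [exact: mD|exact: itv_finite].
have LfD : square_integrable (D s) f by apply: (L2_subset (mD s) mR).
have LgD : square_integrable (D s) g by apply: (L2_subset (mD s) mR).
have If b := L2_mul (mD s) LfD (Le b); have Ig b := L2_mul (mD s) LgD (Le b).
have -> : cintegral (D s) (fun t => f t * (fourier_coef (phi t) k * expi (k%:~R * x0)) +
    (c^-1)%:C * (g t * (fourier_coef (psi t) k * expi (k%:~R * x0)))) =
  (expi (k%:~R * x0) * A1 true) * F k true s + (expi (k%:~R * x0) * A1 false) * F k false s +
  ((c^-1)%:C * expi (k%:~R * x0) * A2 true * G k true s +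
   (c^-1)%:C * expi (k%:~R * x0) * A2 false * G k false s).
  rewrite -!(cintegralZ (mD s) _ (If _)) -!(cintegralZ (mD s) _ (Ig _)).
  rewrite -!(cintegralD (mD s)); try by do ?[apply: (cintegrableD (mD s))]; apply: (cintegrableZ (mD s)); (exact: If || exact: Ig).
  by apply: eq_cintegral => t _; rewrite E1 E2; ring.
(* The trajectory applies the transposed projections, so regrouping moves them onto the adjoint
   coefficients. *)
have S1 b : expi (- (w k b * s)) * (P11 k b * fourier_coef (phi s) k + P12 k b * fourier_coef (psi s) k) = A1 b.
  by rewrite -/(amp1 a c d r phi psi k b s) (amp1E a0 c0 d0 r0 sol) mulrA [expi _ * expi _]mulrC expiNK mul1r.
have S2 b : expi (- (w k b * s)) * (P21 k b * fourier_coef (phi s) k + P22 k b * fourier_coef (psi s) k) = A2 b.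
  by rewrite -/(amp2 a c d r phi psi k b s) (amp2E a0 c0 d0 r0 sol) mulrA [expi _ * expi _]mulrC expiNK mul1r.
have -> : fourier_coef (phi s) k * traj1 k s + fourier_coef (psi s) k * traj2 k s =
   forced1 k true s * A1 true + forced1 k false s * A1 false +
   (forced2 k true s * A2 true + forced2 k false s * A2 false).
  rewrite -!S1 -!S2 /traj1 /traj2.
  move: (forced1 k true s) (forced1 k false s) (forced2 k true s) (forced2 k false s).
  move: (expi (- (w k true * s))) (expi (- (w k false * s))) (fourier_coef (phi s) k) (fourier_coef (psi s) k).
  move: (P11 k true) (P12 k true) (P21 k true) (P22 k true) (P11 k false) (P12 k false) (P21 k false) (P22 k false).
  clear => *; ring.
rewrite (amp_sum1 a c d r phi psi k 0) (amp_sum2 a c d r phi psi k 0) -/(A1 true) -/(A1 false) -/(A2 true) -/(A2 false).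
have piE : (2 * pi)%:C * ((2 * pi)^-1)%:C = 1 :> R[i].
  by rewrite -realcM divff ?rmorph1// gt_eqF// pi2_gt0.
rewrite /forced1 /forced2.
move: (F k true s) (F k false s) (G k true s) (G k false s) (expi _) (A1 true) (A1 false) (A2 true) (A2 false).
move: ((c^-1)%:C) (fourier_coef u0 _) (fourier_coef v0 _) piE.
move: ((2 * pi)%:C) (((2 * pi)^-1)%:C) => z z' ci U V zz' F1 F2 G1 G2 e a1 a2 b1 b2.
transitivity (z * ((a1 + a2) * U + (b1 + b2) * V) +
  z * z' * (e * a1 * F1 + e * a2 * F2 + (ci * e * b1 * G1 + ci * e * b2 * G2))); first by ring.
by rewrite zz' mul1r.
Qed.

End Transposition.
Lemma mode_trace_cvg (p : R -> R -> R[i]) (tau h : R -> R[i]) (s : R) :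
  square_integrable setT h -> is_trace p x0 tau ->
  (forall N, square_integrable (D s) (fun t => fourier_sum (p t) x0 N)) ->
  ctends (fun N => cintegral (D s) (fun t => h t * fourier_sum (p t) x0 N))
         (cintegral (D s) (fun t => h t * tau t)).
Proof.
move=> Lh [Ltau ctau] LS.
have cD : compact (D s) by exact: segment_compact.
have LhD : square_integrable (D s) h by apply: (L2_subset (mD s) mR).
have LtD := Ltau _ cD; have := ctau _ cD.
have LB N : square_integrable (D s) (fun t => fourier_sum (p t) x0 N - tau t).
  by apply: (L2B (mD s)).
move=> /fine_cvgP[_ /cvgrPdist_le H] eps eps0.
have n0 : 0 < norm2 (D s) h + 1 by rewrite ltr_wpDl// norm2_ge0.
have [N _ HN] := H _ (divr_gt0 eps0 n0); exists N => n Nn.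
have := HN n Nn; rewrite /= sub0r normrN (sqnormE (mD s) (LB n)) /= ger0_norm ?norm2_ge0// => Hn.
rewrite -(cintegralB (mD s) (L2_mul (mD s) LhD (LS n)) (L2_mul (mD s) LhD LtD)).
rewrite (_ : cintegral _ _ = cintegral (D s) (fun t => h t * (fourier_sum (p t) x0 n - tau t))); last first.
  by apply: eq_cintegral => t _; rewrite mulrBr.
apply: le_trans (integral_CauchySchwarz (mD s) LhD (LB n)) _.
apply: (@le_trans _ _ (norm2 (D s) h * (eps / (norm2 (D s) h + 1)))).
  by rewrite ler_wpM2l// norm2_ge0.
by rewrite mulrCA ger_pMr// ler_pdivrMr// mul1r lerDl.
Qed.

Lemma parseval_tends (f1 f2 : R -> R[i]) : L2T f1 -> L2T f2 ->
  ctends (fun N => (2 * pi)%:C * \sum_(k <- freqs N) fourier_coef f1 k * fourier_coef f2 (- k))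
         (pairing f2 f1).
Proof.
move=> L1 L2 eps eps0; have [N HN] := parseval L1 L2 eps0; exists N => n /HN.
rewrite -nsqN opprB (_ : pairing f2 f1 = pairing f1 f2)//.
by apply: eq_cintegral => x _; rewrite mulrC.
Qed.

(** Both sides are limits of symmetric partial sums over the modes, by Parseval for the pairings and
    by the definition of the trace for the control terms; [mode_identity] equates these sums term by
    term. *)
Lemma transposition_identity (phi0 psi0 : R -> R[i]) phi psi (phix psix : R -> R[i])
    (us vs : R -> R[i]) (s : R) :
  adjoint_solution a c d r phi0 psi0 phi psi -> L2T phi0 -> L2T psi0 ->
  is_trace phi x0 phix -> is_trace psi x0 psix ->
  L2T us -> L2T vs ->
  (forall k, fourier_coef us (- k) = traj1 k s) ->
  (forall k, fourier_coef vs (- k) = traj2 k s) ->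
  pairing us (phi s) + pairing vs (psi s) =
  pairing u0 phi0 + pairing v0 psi0 +
  cintegral_from0 s (fun t => f t * phix t + (c^-1)%:C * (g t * psix t)).
Proof.
move=> sol Lphi0 Lpsi0 trphi trpsi Lus Lvs usE vsE.
have [[Lphi _] [Lpsi _] phi00 psi00 _] := sol.
have coefL2 (p : R -> R -> R[i]) k (z z' : R[i]) :
    (forall t, fourier_coef (p t) k = expi (w k true * t) * z + expi (w k false * t) * z') ->
    square_integrable (D s) (fun t => fourier_coef (p t) k * expi (k%:~R * x0)).
  move=> zE; have Le b : square_integrable (D s) (fun t => expi (w k b * t)).
    by apply: L2_expiM; [exact: mD|exact: itv_finite].
  rewrite (_ : (fun t => _) = (fun t => expi (k%:~R * x0) * z * expi (w k true * t) +
     expi (k%:~R * x0) * z' * expi (w k false * t))).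
    by apply: (L2D (mD s)); apply: (L2Z (mD s)).
  by apply/funext => t; rewrite zE; ring.
have Lphik k : square_integrable (D s) (fun t => fourier_coef (phi t) k * expi (k%:~R * x0)).
  apply: (coefL2 phi k (amp1 a c d r phi psi k true 0) (amp1 a c d r phi psi k false 0)) => t.
  by rewrite (amp_sum1 a c d r phi psi) !(amp1E a0 c0 d0 r0 sol _ _ t).
have Lpsik k : square_integrable (D s) (fun t => fourier_coef (psi t) k * expi (k%:~R * x0)).
  apply: (coefL2 psi k (amp2 a c d r phi psi k true 0) (amp2 a c d r phi psi k false 0)) => t.
  by rewrite (amp_sum2 a c d r phi psi) !(amp2E a0 c0 d0 r0 sol _ _ t).
have LS (p : R -> R -> R[i]) :
    (forall k, square_integrable (D s) (fun t => fourier_coef (p t) k * expi (k%:~R * x0))) ->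
    forall N, square_integrable (D s) (fun t => fourier_sum (p t) x0 N).
  move=> pL N; rewrite (_ : (fun t => _) = (fun t => \sum_(k <- freqs N) fourier_coef (p t) k * expi (k%:~R * x0))).
    exact: (L2_sum (mD s)).
  by apply/funext => t; rewrite fourier_sumE.
have LSphi := LS phi Lphik; have LSpsi := LS psi Lpsik.
have LfD : square_integrable (D s) f by apply: (L2_subset (mD s) mR).
have LgD : square_integrable (D s) g by apply: (L2_subset (mD s) mR).
have cD : compact (D s) by exact: segment_compact.
have Iphi := L2_mul (mD s) LfD (trphi.1 _ cD); have Ipsi := L2_mul (mD s) LgD (trpsi.1 _ cD).
have -> : cintegral_from0 s (fun t => f t * phix t + (c^-1)%:C * (g t * psix t)) =
    cintegral (D s) (fun t => f t * phix t) + (c^-1)%:C * cintegral (D s) (fun t => g t * psix t).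
  rewrite cintegral_from0_supp; last by move=> t tT; rewrite f0// g0// !mul0r mulr0 addr0.
  by rewrite (cintegralD (mD s))// ?(cintegralZ (mD s))//; exact: (cintegrableZ (mD s)).
(* The adjoint state takes its initial data only almost everywhere, which still determines the
   Fourier coefficients and thereby the pairings. *)
have -> : pairing u0 phi0 + pairing v0 psi0 = pairing u0 (phi 0) + pairing v0 (psi 0).
  have eqp (z y y' : R -> R[i]) : L2T z -> L2T y -> L2T y' -> eqL2T y y' -> pairing z y' = pairing z y.
    move=> Lz Ly Ly' yy; apply: (ctends_unique _ (parseval_tends Ly' Lz) (parseval_tends Ly Lz)) => n.
    by congr (_ * _); apply: eq_bigr => k _; rewrite (eqL2T_fourier_coef k yy Ly Ly').
  by rewrite (eqp u0 (phi 0) phi0)// (eqp v0 (psi 0) psi0).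
apply: (ctends_unique _
  (ctendsD (parseval_tends (Lphi s) Lus) (parseval_tends (Lpsi s) Lvs))
  (ctendsD (ctendsD (parseval_tends (Lphi 0) Lu0) (parseval_tends (Lpsi 0) Lv0))
    (ctendsD (mode_trace_cvg Lf trphi LSphi) (ctendsZ (c^-1)%:C (mode_trace_cvg Lg trpsi LSpsi))))) => N /=.
rewrite -!mulrDr -!big_split /=.
have IS1 k := L2_mul (mD s) LfD (Lphik k); have IS2 k := L2_mul (mD s) LgD (Lpsik k).
have SE (h : R -> R[i]) (p : R -> R -> R[i]) :
    (forall k, cintegrable (D s) (fun t => h t * (fourier_coef (p t) k * expi (k%:~R * x0)))) ->
    cintegral (D s) (fun t => h t * fourier_sum (p t) x0 N) =
    \sum_(k <- freqs N) cintegral (D s) (fun t => h t * (fourier_coef (p t) k * expi (k%:~R * x0))).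
  move=> I; rewrite -(cintegral_sum (mD s))//; apply: eq_cintegral => t _.
  by rewrite fourier_sumE /fpart mulr_sumr.
rewrite (SE _ _ IS1) (SE _ _ IS2) !mulr_sumr -!big_split /=; apply: eq_bigr => k _.
rewrite usE vsE (mode_identity sol); congr (_ + _).
by rewrite (cintegralD (mD s))// ?(cintegralZ (mD s))//; exact: (cintegrableZ (mD s)).
Qed.

End Trajectory.

(** The moments are chosen so that at time [T] the forced terms equal [expi (w k b * T)] times the
    target coefficients, for both [b]. The exponentials then cancel in [traj1] and [traj2], and the
    projections sum to the identity. *)
Lemma controllable (u0 v0 uT vT : R -> R[i]) :
  L2T u0 -> L2T v0 -> L2T uT -> L2T vT ->
  exists f g : R -> R[i], [/\ L2loc f, L2loc g &
    exists u v : R -> R -> R[i],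
      [/\ transposition_solution a c d r x0 f g u0 v0 u v, eqL2T (u T) uT & eqL2T (v T) vT]].
Proof.
move=> Lu0 Lv0 LuT LvT.
have neg (h : R -> R[i]) : L2T h -> square_summable (fun k => fourier_coef h (- k)).
  move=> Lh; have [M HM] := fourier_coef_sum Lh; exists M => s us.
  rewrite -(big_map -%R xpredT (fun k => nsq (fourier_coef h k))); apply: HM.
  by rewrite map_inj_uniq//; exact: oppr_inj.
have [f [Lf f0 fE]] := control_exists (target_moment_summable 1 (neg _ Lu0) (neg _ LuT)).
(* The factor [c] compensates the [1 / c] in front of [g] in the transposition formula. *)
have [g [Lg g0 gE]] := control_exists (target_moment_summable c%:C (neg _ Lv0) (neg _ LvT)).
exists f, g; split; try by move=> K cK; exact: compact_L2.
have [M HM] := traj_bound Lf Lg f0 g0 Lu0 Lv0.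
have ex1 s := fourier_realize (fun l ul => (HM s l ul).1).
have ex2 s := fourier_realize (fun l ul => (HM s l ul).2).
have [u Hu] := choice ex1; have [v Hv] := choice ex2.
have uE s k : fourier_coef (u s) (- k) = traj1 f g u0 v0 k s by have [_ _] := Hu s.
have vE s k : fourier_coef (v s) (- k) = traj2 f g u0 v0 k s by have [_ _] := Hv s.
have Lu s : L2T (u s) by have [] := Hu s.
have Lv s : L2T (v s) by have [] := Hv s.
have cu k : ccontinuous (fun s => fourier_coef (u s) k).
  have [H _] := traj_continuous u0 v0 Lf Lg (- k).
  by rewrite (_ : (fun s => _) = traj1 f g u0 v0 (- k)) //; apply/funext => s; rewrite -uE opprK.
have cv k : ccontinuous (fun s => fourier_coef (v s) k).
  have [_ H] := traj_continuous u0 v0 Lf Lg (- k).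
  by rewrite (_ : (fun s => _) = traj2 f g u0 v0 (- k)) //; apply/funext => s; rewrite -vE opprK.
have ueT k b : forced1 f u0 k b T = expi (w k b * T) * fourier_coef uT (- k).
  rewrite /forced1 fE /target_moment mode_indexK freq_mode_index mul1r.
  have -> (z z' e e' x y : R[i]) : x + z' * e * (z * e' * (y - x)) = x + (z * z') * (e * e') * (y - x) by ring.
  rewrite -realcM divff ?gt_eqF ?pi2_gt0// expiNK rmorph1 !mul1r.
  by rewrite addrC subrK.
have veT k b : forced2 g v0 k b T = expi (w k b * T) * fourier_coef vT (- k).
  rewrite /forced2 gE /target_moment mode_indexK freq_mode_index.
  have -> (z z' e e' x y q q' : R[i]) : x + z' * e * (q' * (q * z * e' * (y - x))) =
    x + (q * q') * (z * z') * (e * e') * (y - x) by ring.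
  rewrite -!realcM !divff ?gt_eqF ?pi2_gt0// expiNK !mulr1 rmorph1 !mul1r.
  by rewrite addrC subrK.
have cancel k b (x y : R[i]) : expi (- (w k b * T)) * (expi (w k b * T) * x * y) = x * y.
  by rewrite !mulrA [expi _ * expi _]mulrC expiNK mul1r.
exists u, v; split.
- split.
    split=> // w1 w2 Lw1 Lw2.
    have uM s : norm2 C (u s) <= 2 * pi * M by have [] := Hu s.
    have vM s : norm2 C (v s) <= 2 * pi * M by have [] := Hv s.
    exact: (ccontinuousD (pairing_weakly_continuous Lu uM cu Lw1) (pairing_weakly_continuous Lv vM cv Lw2)).
  move=> phi0 psi0 Lphi0 Lpsi0 phi psi sol phix psix tr1 tr2 s.
  exact: (transposition_identity Lf Lg f0 g0 Lu0 Lv0 sol Lphi0 Lpsi0 tr1 tr2 (Lu s) (Lv s) (uE s) (vE s)).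
- apply: fourier_coef_eq_ae => // k; rewrite -[k]opprK uE /traj1 !ueT !veT.
  have [s1 _ s3 _] := proj_sum a c d r (- k); rewrite !mulrDr !cancel addrACA -!mulrDr -!rmorphD /= s1 s3.
  by rewrite rmorph1 rmorph0 mulr1 mulr0 addr0.
- apply: fourier_coef_eq_ae => // k; rewrite -[k]opprK vE /traj2 !ueT !veT.
  have [_ s2 _ s4] := proj_sum a c d r (- k); rewrite !mulrDr !cancel addrACA -!mulrDr -!rmorphD /= s2 s4.
  by rewrite rmorph1 rmorph0 mulr1 mulr0 add0r.
Qed.

End Controllability.

Theorem theorem1p1 (R : realType) :
  {ae (@lebesgue_measure R \x @lebesgue_measure R \x
       @lebesgue_measure R \x @lebesgue_measure R)%E, forall q : R * R * R * R,
    let: (a, c, d, r) := q in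
    0 < a -> 0 < c -> 0 < d -> 0 < r ->
    forall (x0 T : R), 0 < T ->
    forall u0 v0 uT vT : R -> R[i],
    L2T u0 -> L2T v0 -> L2T uT -> L2T vT ->
    exists f g : R -> R[i],
      [/\ L2loc f, L2loc g &
       exists u v : R -> R -> R[i],
         [/\ transposition_solution a c d r x0 f g u0 v0 u v,
             eqL2T (u T) uT &
             eqL2T (v T) vT]]}.
Proof.
have [B [mB B0 sB]] := @separated_ae R; exists B; split=> // -[[[a c] d] r] /= H.
apply: sB => /= sep; apply: H => a0 c0 d0 r0 x0 T T0 u0 v0 uT vT.
by apply: controllable => //; apply: sep.
Qed.
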